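(* Let $B$ be a skew-symmetrizable $n\times n$ integer matrix which is mutation-infinite, i.e. infinitely many distinct matrices are mutation equivalent to $B$. Then the $g$-vector fan $\mathcal{F}(B)$ is not dense in $\mathbb{R}^n$.
   Context: An $n\times n$ integer matrix $B=(b_{ij})$ is skew-symmetrizable if there is a diagonal matrix with positive integer entries $d_i$ such that $d_ib_{ij}=-d_jb_{ji}$. Mutation: $\mu_kB=(b'_{ij})$ with $b'_{ij}=-b_{ij}$ if $i=k$ or $j=k$, and $b'_{ij}=b_{ij}+b_{ik}[b_{kj}]_++[-b_{ik}]_+b_{kj}$ otherwise, $[a]_+=\max(a,0)$ (same rule for $2n\times n$ matrices with skew-symmetrizable upper part). Two matrices are mutation equivalent if one is obtained from the other by a finite sequence of mutations. Cluster algebra with principal coefficients $\mathcal{A}(B)$: from the initial seed $((x_1,\dots,x_n,y_1,\dots,y_n),\hat B)$, $\hat B$ having upper part $B$ and lower part the identity, mutation at $k$ of a seed $(\mathbf{x},C)$ replaces $C$ by $\mu_kC$ and $x_k$ by $x_k'$ with $x_kx_k'=\prod_i x_i^{[c_{ik}]_+}+\prod_i x_i^{[-c_{ik}]_+}$ (rows $n+1,\dots,2n$ corresponding to $y_1,\dots,y_n$); the resulting tuples $(x_1,\dots,x_n)$ are clusters. Each cluster variable is homogeneous for the $\mathbb{Z}^n$-grading $\deg x_i=e_i$, $\deg y_j=-\sum_ib_{ij}e_i$; its degree is its $g$-vector. The $g$-vector fan $\mathcal{F}(B)$ is the simplicial fan in $\mathbb{R}^n$ whose maximal cones are the cones spanned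 by the $g$-vectors of cluster variables of a cluster; it is dense if the union of its cones is dense in $\mathbb{R}^n$. *)

(* Defs.v *)
From HB Require Import structures.
From mathcomp Require Import all_boot all_order all_algebra.
From mathcomp Require Import fraction.
From mathcomp Require Import mpoly.
From mathcomp Require Import reals.

Set Implicit Arguments.
Unset Strict Implicit.
Unset Printing Implicit Defensive.

Import Order.TTheory GRing.Theory Num.Theory.
Local Open Scope ring_scope.

Definition pospart (a : int) : nat := if (0 < a)%R then `|a|%N else 0%N.

Definition skew_symmetrizable (n : nat) (B : 'M[int]_n) : Prop :=
  exists d : 'I_n -> int,
    (forall i, 0 < d i) /\ (forall i j, d i * B i j = - (d j * B j i)).

Definition mutmx (n : nat) (k : 'I_n) (B : 'M[int]_n) : 'M[int]_n :=
  \matrix_(i, j)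
    if (i == k) || (j == k) then - B i j
    else B i j + B i k * (pospart (B k j))%:Z + (pospart (- B i k))%:Z * B k j.

Definition mutseq (n : nat) (B : 'M[int]_n) (ks : seq 'I_n) : 'M[int]_n :=
  foldl (fun M k => mutmx k M) B ks.

Definition mutation_infinite (n : nat) (B : 'M[int]_n) : Prop :=
  ~ exists s : seq 'M[int]_n, forall ks : seq 'I_n, mutseq B ks \in s.

Notation "x %:F" := (@FracField.tofrac _ x).

Definition ratfun (n : nat) := {fraction {mpoly int[n + n]}}.

Definition xvar (n : nat) (i : 'I_n) : ratfun n := ('X_(lshift n i))%:F.
Definition yvar (n : nat) (j : 'I_n) : ratfun n := ('X_(rshift n j))%:F.

(* A seed with principal coefficients: the cluster, and the 2n x n extended
   exchange matrix, stored as its top part (rows 1..n) and its bottom part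
   (rows n+1..2n). *)
Record seed (n : nat) := Seed {
  sclus : 'I_n -> ratfun n;
  stop  : 'M[int]_n;
  sbot  : 'M[int]_n }.

(* Mutation of the 2n x n matrix (top T, bottom C) at k:
   the top part is mutated as usual; the bottom part by the same rule. *)
Definition mutbot (n : nat) (k : 'I_n) (T C : 'M[int]_n) : 'M[int]_n :=
  \matrix_(i, j)
    if j == k then - C i j
    else C i j + C i k * (pospart (T k j))%:Z + (pospart (- C i k))%:Z * T k j.

Definition mutseed (n : nat) (k : 'I_n) (s : seed n) : seed n :=
  let x := sclus s in
  let T := stop s in
  let C := sbot s in
  let xk' :=
    ((\prod_(i < n) x i ^+ pospart (T i k)) * (\prod_(j < n) yvar j ^+ pospart (C j k))
     + (\prod_(i < n) x i ^+ pospart (- T i k)) * (\prod_(j < n) yvar j ^+ pospart (- C j k)))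
    / x k in
  Seed (fun i => if i == k then xk' else x i) (mutmx k T) (mutbot k T C).

Definition init_seed (n : nat) (B : 'M[int]_n) : seed n :=
  Seed (@xvar n) B 1%:M.

Definition seed_at (n : nat) (B : 'M[int]_n) (ks : seq 'I_n) : seed n :=
  foldl (fun s k => mutseed k s) (init_seed B) ks.

(* Z^n-grading: deg x_i = e_i, deg y_j = - sum_i b_ij e_i.
   Degree of a monomial, as a function 'I_n -> int. *)
Definition mdeg (n : nat) (B : 'M[int]_n) (m : 'X_{1.. n + n}) : 'I_n -> int :=
  fun i => (m (lshift n i))%:Z - \sum_(j < n) (m (rshift n j))%:Z * B i j.

Definition homog_of (n : nat) (B : 'M[int]_n) (p : {mpoly int[n + n]})
  (g : 'I_n -> int) : Prop :=
  forall m, m \in msupp p -> mdeg B m = g.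

Definition has_gvector (n : nat) (B : 'M[int]_n) (f : ratfun n)
  (g : 'I_n -> int) : Prop :=
  exists (p q : {mpoly int[n + n]}) (a b : 'I_n -> int),
    [/\ p != 0, q != 0, homog_of B p a, homog_of B q b & f = p%:F / q%:F]
    /\ (forall i, g i = a i - b i).

Definition gfan_support (R : realType) (n : nat) (B : 'M[int]_n)
  (v : 'I_n -> R) : Prop :=
  exists (ks : seq 'I_n) (g : 'I_n -> 'I_n -> int) (lam : 'I_n -> R),
    [/\ forall l, has_gvector B (sclus (seed_at B ks) l) (g l),
        forall l, 0 <= lam l
      & forall i, v i = \sum_(l < n) lam l * (g l i)%:~R].

Definition gfan_dense (R : realType) (n : nat) (B : 'M[int]_n) : Prop :=
  forall (v : 'I_n -> R) (e : R), 0 < e ->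
    exists w : 'I_n -> R, gfan_support B w /\ forall i, `|v i - w i| < e.

(* Main.v *)
(* The matrix B has a scattering diagram, encoded by one element g of the
   completed quantum torus: the wall function at a point v is the middle factor
   of the factorization of g by the sign of the pairing of exponents with v, and
   g is determined by its incoming walls, which are the coordinate hyperplanes
   with quantum dilogarithms as functions. Writing g = theta_k h = h' theta_k,
   the absence of other incoming walls bounds the y_k-degrees of h and h', so
   that h theta_k(1/y_k) makes sense and is the element of mu_k B. Hence mutation
   of the initial seed maps chambers to chambers by the piecewise linear map of
   Fomin and Zelevinsky's Conjecture 7.12; no chamber meets a coordinate
   hyperplane, and this gives sign-coherence of g-vectors and c-vectors, by
   induction on the length of mutation sequences.

   If B is mutation-infinite, some mutation of B has b_ij b_ji <= -5, and density
   of the fan is inherited by it. There, any g-vector cone can be brought into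
   the region v_i, v_j >= 0 by mutating the initial seed at i and j only, by
   sign-coherence of rows, while the interior of the irrational cone of the rank
   two pattern (i, j) never enters that region. So the cones miss an open set. *)
Require Import Defs.
From HB Require Import structures.
From mathcomp Require Import all_boot all_order all_algebra.
From mathcomp Require Import reals.
From mathcomp Require Import fraction boolp mpoly zify ring lra.

Set Implicit Arguments.
Unset Strict Implicit.
Unset Printing Implicit Defensive.

Import Order.TTheory GRing.Theory Num.Theory.
Local Open Scope ring_scope.

(** The quantum parameter must not be a root of unity, or the denominators of the dilogarithm
    vanish; the number 2 keeps all coefficients rational. Since elements of the torus are used, and
    not their adjoint action, a degenerate B causes no loss. On a wall only the nonvanishing of one
    coefficient matters, never positivity. Incoming walls are tested on logarithms: in degree a, for
    factors supported orthogonally to a, the logarithm is additive in spite of noncommutativity, so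
    that splitting off theta_k does not disturb the test. The inductions are entangled. A mutation
    at the end of a sequence multiplies the G- and C-matrices by explicit involutions, but needs the
    sign of a c-vector; chambers and walls are transported only by mutating the initial seed. The
    rule comparing the two ends is proved in the same induction. The bound -5 comes from the rank
    two form c x^2 - b c x y - b y^2, of discriminant b c (b c + 4): for b c < 0 it is indefinite
    only below -4, and at -4 the irrational cone shrinks to a ray. *)

Notation deg := mpoly.mdeg.

(** * The quantum torus *)

Section Decompositions.
Variable n : nat.
Implicit Types a b m : 'X_{1..n}.

Definition mnms m : seq 'X_{1..n} :=
  map val (filter (fun a : 'X_{1..n < (deg m).+1} => (val a <= m)%MM) (enum {: 'X_{1..n < (deg m).+1}})).

Lemma lem_deg a b : (a <= b)%MM -> (deg a <= deg b)%N.
Proof. by move=> h; rewrite -(submK h) mdegD leq_addl. Qed.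

Lemma mnms_uniq m : uniq (mnms m).
Proof.
rewrite /mnms map_inj_uniq; last exact: val_inj.
by rewrite filter_uniq ?enum_uniq.
Qed.

Lemma mem_mnms m a : (a \in mnms m) = (a <= m)%MM.
Proof.
apply/mapP/idP => [[x]|h].
  by rewrite mem_filter => /andP[hx _] ->.
have d : (deg a < (deg m).+1)%N by rewrite ltnS lem_deg.
by exists (BMultinom d) => //; rewrite mem_filter mem_enum /= h.
Qed.

Lemma subm_add a b : ((a + b) - a = b)%MM.
Proof. by rewrite addmC addmK. Qed.

Lemma addm_subK a m : (a <= m)%MM -> (a + (m - a) = m)%MM.
Proof. by move=> h; rewrite addmC submK. Qed.

(* The change of variables a + b = c between the two ways of enumerating the
   triples of sum m. *)
Lemma mnms_shift m a : (a <= m)%MM ->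
  perm_eq [seq (a + b)%MM | b <- mnms (m - a)] [seq c <- mnms m | (a <= c)%MM].
Proof.
move=> ham; apply: uniq_perm.
- rewrite map_inj_uniq ?mnms_uniq // => x y; exact: addmI.
- by rewrite filter_uniq ?mnms_uniq.
move=> c; rewrite mem_filter mem_mnms; apply/mapP/andP.
  move=> [b]; rewrite mem_mnms => hb ->; split; first exact: lem_addr.
  apply/mnm_lepP => i; rewrite mnmDE.
  have := mnm_lepP hb i; rewrite mnmBE; have := mnm_lepP ham i; lia.
move=> [hac hcm]; exists (c - a)%MM; last by rewrite addm_subK.
rewrite mem_mnms; apply/mnm_lepP => i; rewrite !mnmBE.
have := mnm_lepP hcm i; lia.
Qed.

Lemma mnms_triple (V : nmodType) (F : 'X_{1..n} -> 'X_{1..n} -> 'X_{1..n} -> V) m :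
  \sum_(a <- mnms m) \sum_(b <- mnms (m - a)%MM) F a b ((m - a) - b)%MM =
  \sum_(c <- mnms m) \sum_(a <- mnms c) F a (c - a)%MM (m - c)%MM.
Proof.
transitivity (\sum_(a <- mnms m) \sum_(c <- mnms m | (a <= c)%MM)
                 F a (c - a)%MM (m - c)%MM).
  apply: eq_big_seq => a; rewrite mem_mnms => ha.
  rewrite -[RHS]big_filter -(perm_big _ (mnms_shift ha)) /= big_map.
  by apply: eq_bigr => b _; rewrite subm_add submDA.
rewrite (exchange_big_dep xpredT) //=; apply: eq_big_seq => c.
rewrite mem_mnms => hc; rewrite -big_filter; apply: perm_big.
apply: uniq_perm; rewrite ?filter_uniq ?mnms_uniq //.
move=> a; rewrite mem_filter !mem_mnms; case: (boolP (a <= c)%MM) => //= h.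
exact: lepm_trans h hc.
Qed.
End Decompositions.

Section Form.
Variables (n : nat) (L : 'M[int]_n).
Implicit Types a b c : 'X_{1..n}.

Definition lam a b : int := \sum_i \sum_j (a i)%:Z * L i j * (b j)%:Z.

Lemma lamDl a b c : lam (a + b)%MM c = lam a c + lam b c.
Proof.
rewrite /lam -big_split; apply: eq_bigr => i _; rewrite -big_split.
by apply: eq_bigr => j _ /=; rewrite mnmDE PoszD !mulrDl.
Qed.

Lemma lamDr a b c : lam a (b + c)%MM = lam a b + lam a c.
Proof.
rewrite /lam -big_split; apply: eq_bigr => i _; rewrite -big_split.
by apply: eq_bigr => j _ /=; rewrite mnmDE PoszD !mulrDr.
Qed.

Lemma lam0l c : lam 0%MM c = 0.
Proof. by rewrite /lam big1 // => i _; rewrite big1 // => j _; rewrite mnmE !mul0r. Qed.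

Lemma lam0r c : lam c 0%MM = 0.
Proof. by rewrite /lam big1 // => i _; rewrite big1 // => j _; rewrite mnmE mulr0. Qed.

Hypothesis skL : forall i j, L i j = - L j i.

Lemma lamC a b : lam a b = - lam b a.
Proof.
rewrite /lam exchange_big /= -sumrN; apply: eq_bigr => i _; rewrite -sumrN.
by apply: eq_bigr => j _; rewrite (skL j i); ring.
Qed.

Lemma lamaa a : lam a a = 0.
Proof. have := lamC a a; lia. Qed.
End Form.

Lemma two_neq0 : (2 : rat) != 0. Proof. by []. Qed.
#[local] Hint Resolve two_neq0 : core.

(* The completed quantum torus of the skew form L, at the quantum parameter 2. *)
Definition qt (n : nat) (L : 'M[int]_n) := 'X_{1..n} -> rat.

Section Ring.
Variables (n : nat) (L : 'M[int]_n).
Implicit Types (f g h : qt L) (a b c m : 'X_{1..n}).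

HB.instance Definition _ := gen_eqMixin (qt L).
HB.instance Definition _ := gen_choiceMixin (qt L).

Definition qt_add f g : qt L := fun a => f a + g a.
Definition qt_opp f : qt L := fun a => - f a.
Definition qt_mul f g : qt L :=
  fun m => \sum_(a <- mnms m) 2%:R ^ lam L a (m - a)%MM * f a * g (m - a)%MM.
Definition qt_one : qt L := fun a => (a == 0%MM)%:R.

Fact qt_addA : associative qt_add.
Proof. by move=> f g h; apply/funext => a; rewrite /qt_add addrA. Qed.
Fact qt_addC : commutative qt_add.
Proof. by move=> f g; apply/funext => a; rewrite /qt_add addrC. Qed.
Fact qt_add0 : left_id (fun=> 0) qt_add.
Proof. by move=> f; apply/funext => a; rewrite /qt_add add0r. Qed.
Fact qt_addN : left_inverse (fun=> 0) qt_opp qt_add.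
Proof. by move=> f; apply/funext => a; rewrite /qt_add addNr. Qed.
HB.instance Definition _ := GRing.isZmodule.Build (qt L) qt_addA qt_addC qt_add0 qt_addN.

Fact qt_mulA : associative qt_mul.
Proof.
move=> f g h; apply/funext => m; rewrite /qt_mul.
pose F a b c := 2%:R ^ (lam L a b + lam L a c + lam L b c) * f a * g b * h c.
transitivity (\sum_(a <- mnms m) \sum_(b <- mnms (m - a)%MM) F a b ((m - a) - b)%MM).
  apply: eq_big_seq => a; rewrite mem_mnms => ha; rewrite big_distrr /=.
  apply: eq_big_seq => b; rewrite mem_mnms => hb.
  by rewrite /F -lamDr addm_subK // expfzDr // -!mulrA; congr (_ * _); rewrite mulrCA.
rewrite (mnms_triple F); apply: eq_big_seq => c; rewrite mem_mnms => hc.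
rewrite big_distrr big_distrl /=; apply: eq_big_seq => a; rewrite mem_mnms => ha.
by rewrite /F -addrA -lamDl addm_subK // expfzDr // [X in X * _ * _ * _]mulrC !mulrA.
Qed.

Fact qt_mul1 : left_id qt_one qt_mul.
Proof.
move=> f; apply/funext => m; rewrite /qt_mul (bigD1_seq 0%MM) /= ?mnms_uniq //.
  rewrite /qt_one eqxx lam0l expr0z subm0 !mul1r big1 ?addr0 // => a /negbTE ->.
  by rewrite mulr0 mul0r.
by rewrite mem_mnms; apply/mnm_lepP => i; rewrite mnm0E.
Qed.

Fact qt_mulr1 : right_id qt_one qt_mul.
Proof.
move=> f; apply/funext => m; rewrite /qt_mul (bigD1_seq m) /= ?mnms_uniq //.
  rewrite /qt_one.
  have -> : (m - m)%MM = 0%MM by apply/mnmP => i; rewrite mnmBE subnn mnm0E.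
  rewrite eqxx lam0r expr0z mulr1 mul1r big1_seq ?addr0 // => a /andP[am].
  rewrite mem_mnms => h; case: eqP => [e|_]; last by rewrite mulr0.
  by move: am; rewrite -(submK h) e add0m eqxx.
by rewrite mem_mnms lepm_refl.
Qed.

Fact qt_mulDl : left_distributive qt_mul qt_add.
Proof.
move=> f g h; apply/funext => m; rewrite /qt_mul /qt_add -big_split.
by apply: eq_bigr => a _ /=; rewrite mulrDr ?mulrDl.
Qed.
Fact qt_mulDr : right_distributive qt_mul qt_add.
Proof.
move=> f g h; apply/funext => m; rewrite /qt_mul /qt_add -big_split.
by apply: eq_bigr => a _ /=; rewrite mulrDr ?mulrDl.
Qed.
HB.instance Definition _ := GRing.Zmodule_isPzRing.Build (qt L)
  qt_mulA qt_mul1 qt_mulr1 qt_mulDl qt_mulDr.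

Lemma qtP f g : (forall a, f a = g a) <-> f = g.
Proof. by split=> [h|-> //]; apply/funext. Qed.
Lemma qtD f g a : (f + g) a = f a + g a. Proof. by []. Qed.
Lemma qtN f a : (- f) a = - f a. Proof. by []. Qed.
Lemma qtB f g a : (f - g) a = f a - g a. Proof. by []. Qed.
Lemma qt0 a : (0 : qt L) a = 0. Proof. by []. Qed.
Lemma qt1 a : (1 : qt L) a = (a == 0%MM)%:R. Proof. by []. Qed.
Lemma qtM f g m :
  (f * g) m = \sum_(a <- mnms m) 2%:R ^ lam L a (m - a)%MM * f a * g (m - a)%MM.
Proof. by []. Qed.
Lemma qt_sum I (r : seq I) (P : pred I) (F : I -> qt L) a :
  (\sum_(i <- r | P i) F i) a = \sum_(i <- r | P i) F i a.
Proof. by elim/big_rec2: _ => // i x y _ <-. Qed.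

Lemma qtM_eq0 f g m :
  (forall a b, (a + b = m)%MM -> f a = 0 \/ g b = 0) -> (f * g) m = 0.
Proof.
move=> h; rewrite qtM big1_seq // => a /andP[_]; rewrite mem_mnms => ha.
by case: (h a (m - a)%MM (addm_subK ha)) => ->; rewrite ?mulr0 ?mul0r.
Qed.

Lemma qtM_neq0 f g m : (f * g) m != 0 ->
  exists a b, [/\ (a + b = m)%MM, f a != 0 & g b != 0].
Proof.
move=> h; apply: contrapT => H; case/negP: h; apply/eqP; apply: qtM_eq0 => a b e.
have [->|fa] := eqVneq (f a) 0; first by left.
have [->|gb] := eqVneq (g b) 0; first by right.
by case: H; exists a, b.
Qed.

Lemma qtM_eq f g f' g' m :
  (forall a, (a <= m)%MM -> f a = f' a) -> (forall a, (a <= m)%MM -> g a = g' a) ->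
  (f * g) m = (f' * g') m.
Proof.
move=> hf hg; rewrite !qtM; apply: eq_big_seq => a; rewrite mem_mnms => ha.
by rewrite hf // hg // lem_subr.
Qed.

Definition van d f := forall a, (deg a < d)%N -> f a = 0.

Lemma lt_deg_add a b m : (a + b = m)%MM -> a != 0%MM -> (deg b < deg m)%N.
Proof. by move=> <-; rewrite mdegD -mdeg_eq0; lia. Qed.

Lemma van_mull x g m : van (deg m) x -> (x * g) m = x m * g 0%MM.
Proof.
move=> hx; rewrite qtM (bigD1_seq m) /= ?mnms_uniq ?mem_mnms ?lepm_refl //.
have -> : (m - m)%MM = 0%MM by apply/mnmP => i; rewrite mnmBE subnn mnm0E.
rewrite lam0r expr0z mul1r big1_seq ?addr0 // => a /andP[am]; rewrite mem_mnms => ha.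
rewrite hx ?mulr0 ?mul0r //.
apply: (@lt_deg_add (m - a)%MM); first by rewrite addmC addm_subK.
apply: contra am => /eqP e; by rewrite -(submK ha) e add0m.
Qed.

Lemma van_mulr x g m : van (deg m) x -> (g * x) m = g 0%MM * x m.
Proof.
move=> hx; rewrite qtM (bigD1_seq 0%MM) /= ?mnms_uniq ?mem_mnms //; last first.
  by apply/mnm_lepP => i; rewrite mnm0E.
rewrite lam0l expr0z mul1r subm0 big1_seq ?addr0 // => a /andP[am].
rewrite mem_mnms => ha; rewrite hx ?mulr0 //.
by apply: (@lt_deg_add a) => //; rewrite addm_subK.
Qed.

Lemma vanM d e f g : van d f -> van e g -> van (d + e) (f * g).
Proof.
move=> hf hg m hm; apply: qtM_eq0 => a b ab.
have [h|h] := ltnP (deg a) d; first by left; apply: hf.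
by right; apply: hg; move: hm; rewrite -ab mdegD; lia.
Qed.

Lemma vanX f r : van 1 f -> van r (f ^+ r).
Proof.
move=> hf; elim: r => [|r IH]; first by move=> a.
by rewrite exprS -add1n; apply: vanM.
Qed.

(** The degree m part of one factor meets only the constant term of the other; all else involves
    lower degrees, where the two products coincide. The recursions on the degree rest on this
    linearization. *)
Lemma qtM_sub f g f' g' m : f 0%MM = 1 -> g' 0%MM = 1 ->
  (forall a, (deg a < deg m)%N -> f a = f' a) ->
  (forall a, (deg a < deg m)%N -> g a = g' a) ->
  f' 0%MM = 1 ->
  (f * g) m - (f' * g') m = (f m - f' m) + (g m - g' m).
Proof.
move=> f0 g'0 hf hg f'0.
rewrite -[LHS]/((f * g - f' * g') m).
have -> : f * g - f' * g' = (f - f') * g' + f * (g - g').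
  by rewrite mulrBl mulrBr [RHS]addrC subrKA.
rewrite qtD van_mull ?van_mulr ?g'0 ?f0 ?mulr1 ?mul1r //.
  by move=> a /hg e; rewrite qtB e subrr.
by move=> a /hf e; rewrite qtB e subrr.
Qed.

Lemma qtM0 f g : (f * g) 0%MM = f 0%MM * g 0%MM.
Proof. by apply: van_mull => a; rewrite mdeg0. Qed.

(** The geometric series: if f has constant term 1, the powers omitted at a vanish there. *)
Definition qtinv f : qt L := fun a => \sum_(r < (deg a).+1) ((1 - f) ^+ r) a.

Lemma van1B f : f 0%MM = 1 -> van 1 (1 - f).
Proof.
move=> f0 a; rewrite ltnS leqn0 mdeg_eq0 => /eqP ->.
by rewrite qtB qt1 eqxx f0 subrr.
Qed.

Lemma qtinvE f a N : f 0%MM = 1 -> (deg a < N)%N ->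
  qtinv f a = (\sum_(r < N) (1 - f) ^+ r) a.
Proof.
move=> f0 hN; rewrite qt_sum /qtinv -(subnKC hN) big_split_ord /=.
rewrite [X in _ = _ + X]big1 ?addr0 // => i _.
by apply: (vanX (van1B f0)); lia.
Qed.

Lemma qt_mulV f : f 0%MM = 1 -> f * qtinv f = 1.
Proof.
move=> f0; apply/qtP => a; set N := (deg a).+1.
have -> : (f * qtinv f) a = (f * \sum_(r < N) (1 - f) ^+ r) a.
  by apply: qtM_eq => // b hb; apply: qtinvE; rewrite // ltnS lem_deg.
have -> : f * \sum_(r < N) (1 - f) ^+ r = 1 - (1 - f) ^+ N.
  elim: (N) => [|k IH]; first by rewrite big_ord0 mulr0 expr0 subrr.
  rewrite big_ord_recr /= mulrDr IH exprS.
  by rewrite [in RHS]mulrBl mul1r opprB [f * _ - _]addrC addrA.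
by rewrite qtB (vanX (van1B f0)) ?subr0 // /N ltnS.
Qed.

Lemma qtinv0 f : f 0%MM = 1 -> qtinv f 0%MM = 1.
Proof. by move=> f0; rewrite /qtinv mdeg0 big_ord_recl big_ord0 expr0 qt1 eqxx addr0. Qed.

Lemma qt_mulVl f : f 0%MM = 1 -> qtinv f * f = 1.
Proof.
move=> f0; have h := qt_mulV f0; have h' := qt_mulV (qtinv0 f0).
by rewrite -[LHS]mulr1 -{1}h' mulrA -(mulrA _ f) h mulr1.
Qed.
End Ring.

(** * Factorizations *)

Lemma deg_ind n (P : 'X_{1..n} -> Prop) :
  (forall a, (forall b, (deg b < deg a)%N -> P b) -> P a) -> forall a, P a.
Proof.
move=> H a; move: {2}(deg a).+1 (ltnSn (deg a)) => d.
elim: d a => // d IH a ha; apply: H => b hb; apply: IH.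
by apply: leq_trans hb _; rewrite -ltnS.
Qed.

(** As [Phi] reads only lower degrees, iterating it deg a + 1 times from any start settles the value
    at a. *)
Lemma deg_fixpoint n (T : Type) (x0 : T) (Phi : ('X_{1..n} -> T) -> 'X_{1..n} -> T) :
  (forall f g a, (forall b, (deg b < deg a)%N -> f b = g b) -> Phi f a = Phi g a) ->
  exists f, forall a, f a = Phi f a.
Proof.
move=> caus; pose F d := iter d Phi (fun=> x0).
have stab d e a : (deg a < d)%N -> (deg a < e)%N -> F d a = F e a.
  elim: d e a => // d IH [|e] a // hd he; apply: caus => b hb.
  by apply: IH; apply: leq_trans hb _; rewrite -ltnS.
exists (fun a => F (deg a).+1 a) => a; apply: caus => b hb.
by apply: stab.
Qed.

Section Fact.
Variables (n : nat).
Implicit Types (v : 'I_n -> int) (a b c : 'X_{1..n}).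

Definition pair v a : int := \sum_i v i * (a i)%:Z.

Lemma pairD v a b : pair v (a + b)%MM = pair v a + pair v b.
Proof.
by rewrite /pair -big_split; apply: eq_bigr => i _; rewrite mnmDE PoszD mulrDr.
Qed.

Lemma pair0 v : pair v 0%MM = 0.
Proof. by rewrite /pair big1 // => i _; rewrite mnm0E mulr0. Qed.

Lemma pairU v k : pair v U_(k)%MM = v k.
Proof.
rewrite /pair (bigD1 k) //= mnm1E eqxx mulr1 big1 ?addr0 // => i ik.
by rewrite mnm1E eq_sym (negbTE ik) mulr0.
Qed.

Variable L : 'M[int]_n.
Implicit Types (f g h p z m : qt L).

(* Factorization of g along the half-spaces cut out by v. The factor z is the
   wall function at the point v, trivial when v lies on no wall. *)
Record fact v g p z m : Prop := Fact {
  fact_eq : g = p * z * m;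
  fact_p0 : p 0%MM = 1;
  fact_z0 : z 0%MM = 1;
  fact_m0 : m 0%MM = 1;
  fact_p : forall a, a != 0%MM -> p a != 0 -> 0 < pair v a;
  fact_z : forall a, a != 0%MM -> z a != 0 -> pair v a = 0;
  fact_m : forall a, a != 0%MM -> m a != 0 -> pair v a < 0 }.

Lemma fact_pE v g p z m a : fact v g p z m -> a != 0%MM -> pair v a <= 0 -> p a = 0.
Proof.
move=> F a0 h; apply/eqP; apply: contraTT h => pa.
by rewrite -ltNge (fact_p F).
Qed.

Lemma fact_zE v g p z m a : fact v g p z m -> a != 0%MM -> pair v a != 0 -> z a = 0.
Proof. by move=> F a0 h; apply/eqP; apply: contraTT h => za; rewrite (fact_z F) ?eqxx. Qed.

Lemma fact_mE v g p z m a : fact v g p z m -> a != 0%MM -> 0 <= pair v a -> m a = 0.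
Proof.
move=> F a0 h; apply/eqP; apply: contraTT h => pa.
by rewrite -ltNge (fact_m F).
Qed.

Lemma qtM3_sub p z m p' z' m' a :
  p 0%MM = 1 -> z 0%MM = 1 -> m 0%MM = 1 -> p' 0%MM = 1 -> z' 0%MM = 1 -> m' 0%MM = 1 ->
  (forall b, (deg b < deg a)%N -> p b = p' b) ->
  (forall b, (deg b < deg a)%N -> z b = z' b) ->
  (forall b, (deg b < deg a)%N -> m b = m' b) ->
  (p * z * m : qt L) a - (p' * z' * m') a =
  (p a - p' a) + (z a - z' a) + (m a - m' a).
Proof.
move=> p0 z0 m0 p'0 z'0 m'0 hp hz hm.
rewrite qtM_sub ?qtM0 ?p0 ?z0 ?p'0 ?z'0 ?mulr1 //; last first.
  move=> b hb; apply: qtM_eq => c /lem_deg hc;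
    [apply: hp | apply: hz]; exact: leq_ltn_trans hb.
by rewrite qtM_sub.
Qed.

(* Only one of the three factors may be nonzero in a given nonzero degree. *)
Lemma fact_agree v g g' p z m p' z' m' d :
  fact v g p z m -> fact v g' p' z' m' ->
  (forall a, (deg a < d)%N -> g a = g' a) ->
  forall a, (deg a < d)%N -> [/\ p a = p' a, z a = z' a & m a = m' a].
Proof.
move=> F F' hg; elim/deg_ind => a IH ad.
have [->|a0] := eqVneq a 0%MM.
  by rewrite (fact_p0 F) (fact_p0 F') (fact_z0 F) (fact_z0 F') (fact_m0 F) (fact_m0 F').
have key : (p a - p' a) + (z a - z' a) + (m a - m' a) = 0.
  rewrite -qtM3_sub ?(fact_p0 F) ?(fact_p0 F') ?(fact_z0 F) ?(fact_z0 F') //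
    ?(fact_m0 F) ?(fact_m0 F') //;
    try by move=> b hb; case: (IH b hb (ltn_trans hb ad)).
  by rewrite -(fact_eq F) -(fact_eq F') hg // subrr.
have [h|h|h] := ltrgtP (pair v a) 0.
- have e1 := fact_pE F a0 (ltW h); have e2 := fact_pE F' a0 (ltW h).
  have e3 := fact_zE F a0 (negbT (lt_eqF h)); have e4 := fact_zE F' a0 (negbT (lt_eqF h)).
  by move: key; rewrite e1 e2 e3 e4 subrr !add0r => /eqP; rewrite subr_eq0 => /eqP.
- have e1 := fact_mE F a0 (ltW h); have e2 := fact_mE F' a0 (ltW h).
  have e3 := fact_zE F a0 (negbT (gt_eqF h)); have e4 := fact_zE F' a0 (negbT (gt_eqF h)).
  by move: key; rewrite e1 e2 e3 e4 subrr !addr0 => /eqP; rewrite subr_eq0 => /eqP.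
have le1 : pair v a <= 0 by rewrite h.
have ge1 : 0 <= pair v a by rewrite h.
rewrite (fact_pE F a0 le1) (fact_pE F' a0 le1) (fact_mE F a0 ge1) (fact_mE F' a0 ge1).
move: key; rewrite (fact_pE F a0 le1) (fact_pE F' a0 le1) (fact_mE F a0 ge1).
by rewrite (fact_mE F' a0 ge1) subrr add0r addr0 => /eqP; rewrite subr_eq0 => /eqP.
Qed.

Lemma fact_uniq v g p z m p' z' m' :
  fact v g p z m -> fact v g p' z' m' -> [/\ p = p', z = z' & m = m'].
Proof.
move=> F F'; have H a : [/\ p a = p' a, z a = z' a & m a = m' a].
  exact: (fact_agree F F' (d := (deg a).+1)).
by split; apply/qtP => a; case: (H a).
Qed.

Definition trunc d g : qt L := fun a => if (deg a < d)%N then g a else 0.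

Lemma fact_exists v g : g 0%MM = 1 -> exists p z m, fact v g p z m.
Proof.
move=> g0.
(* In each nonzero degree only one factor is free, selected by the sign of [pair v a], so one series
   x records all three. Its value at a is what the product of the lower parts leaves of [g a]. *)
pose sel (s : int -> bool) (x : qt L) : qt L :=
  fun a => if a == 0%MM then 1 else if s (pair v a) then x a else 0.
pose P := sel (fun t => 0 < t); pose Z := sel (fun t => t == 0); pose N := sel (fun t => t < 0).
pose Phi (x : qt L) a := let y := trunc (deg a) x in g a - (P y * Z y * N y) a.
have [x|x hx] := @deg_fixpoint n rat 0 Phi.
  move=> y a H; rewrite /Phi.
  suff -> : trunc (deg a) x = trunc (deg a) y by [].
  by apply/qtP => b; rewrite /trunc; case: ifP => // /H.
have sel0 s y : sel s y 0%MM = 1 by rewrite /sel eqxx.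
have eqg : g = P x * Z x * N x.
  apply/qtP => a; have [->|a0] := eqVneq a 0%MM.
    by rewrite !qtM0 /P /Z /N !sel0 g0 !mulr1.
  pose y := trunc (deg a) x.
  have E s b : (deg b < deg a)%N -> sel s x b = sel s y b.
    by rewrite /sel /y /trunc => ->.
  have ya : y a = 0 by rewrite /y /trunc ltnn.
  have := @qtM3_sub (P x) (Z x) (N x) (P y) (Z y) (N y) a.
  move=> /(_ (sel0 _ _) (sel0 _ _) (sel0 _ _) (sel0 _ _) (sel0 _ _) (sel0 _ _)).
  move=> /(_ (E _) (E _) (E _)).
  have -> : (P x a - P y a) + (Z x a - Z y a) + (N x a - N y a) = x a.
    rewrite /P /Z /N /sel (negbTE a0) ya.
    by case: ltrgtP => _ /=; rewrite ?subrr ?subr0 ?addr0 ?add0r.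
  move=> e; have := hx a; rewrite /Phi /= -/y => hxa.
  by apply: (addIr (- (P y * Z y * N y) a)); rewrite e -hxa.
exists (P x), (Z x), (N x); split; rewrite /P /Z /N ?sel0 // => a a0.
- by rewrite /sel (negbTE a0); case: ifP; rewrite ?eqxx.
- by rewrite /sel (negbTE a0) /=; case: (pair v a =P 0); rewrite ?eqxx.
- by rewrite /sel (negbTE a0); case: ifP; rewrite ?eqxx.
Qed.

(** * Supports in submonoids of exponents *)

Definition suppd (d : nat) (S : pred 'X_{1..n}) f :=
  forall a, (deg a < d)%N -> f a != 0 -> S a.

Definition mclosed (S : pred 'X_{1..n}) :=
  S 0%MM /\ forall a b, S a -> S b -> S (a + b)%MM.

Lemma suppd1 d S : mclosed S -> suppd d S (1 : qt L).
Proof.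
move=> [S0 _] a _; have [-> //|a0] := eqVneq a 0%MM.
by rewrite qt1 (negbTE a0) eqxx.
Qed.

Lemma suppdM d S f g : mclosed S -> suppd d S f -> suppd d S g -> suppd d S (f * g).
Proof.
move=> [_ SD] hf hg a ad /qtM_neq0[b [c [e fb gc]]].
rewrite -e; move: ad; rewrite -e mdegD => ad.
by apply: SD; [apply: hf | apply: hg] => //; lia.
Qed.

Lemma suppdN d S f : suppd d S f -> suppd d S (- f).
Proof. by move=> h a ad; rewrite qtN oppr_eq0; apply: h. Qed.

Lemma suppdD d S f g : suppd d S f -> suppd d S g -> suppd d S (f + g).
Proof.
move=> hf hg a ad; rewrite qtD => h; have [e|/hf] := eqVneq (f a) 0; last exact.
by apply: hg => //; move: h; rewrite e add0r.
Qed.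

Lemma suppdX d S f r : mclosed S -> suppd d S f -> suppd d S (f ^+ r).
Proof.
move=> SM hf; elim: r => [|r IH]; first exact: suppd1.
by rewrite exprS; apply: suppdM.
Qed.

Lemma suppd_inv d S f : mclosed S -> f 0%MM = 1 -> suppd d S f -> suppd d S (qtinv f).
Proof.
move=> SM f0 hf a ad; rewrite (@qtinvE _ _ _ _ d) // => h.
suff H k : suppd d S (\sum_(r < k) (1 - f) ^+ r) by apply: (H d).
have s1 : suppd d S (1 - f) by apply: suppdD; [exact: suppd1 | exact: suppdN].
elim: k => [|k IH]; first by move=> b _; rewrite big_ord0 qt0 eqxx.
by rewrite big_ord_recr /=; apply: suppdD => //; apply: suppdX.
Qed.

(** Splitting a into two exponents of lower degree in the supports would put a in S, so only the two
    terms with a zero exponent survive. *)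
Lemma qtM_out S f g a : mclosed S -> ~~ S a -> f 0%MM = 1 -> g 0%MM = 1 ->
  suppd (deg a) S f -> suppd (deg a) S g -> (f * g) a = f a + g a.
Proof.
move=> [S0 SD] Sa f0 g0 hf hg.
have a0 : a != 0%MM by apply: contra Sa => /eqP ->.
pose f' := trunc (deg a) f; pose g' := trunc (deg a) g.
have d0 : (0 < deg a)%N by rewrite lt0n mdeg_eq0.
have f'0 : f' 0%MM = 1 by rewrite /f' /trunc mdeg0 d0.
have g'0 : g' 0%MM = 1 by rewrite /g' /trunc mdeg0 d0.
have e : (f' * g') a = 0.
  apply: qtM_eq0 => b c bc; rewrite /f' /g' /trunc.
  case: ltnP => hb; last by left.
  case: ltnP => hc; last by right.
  have [->|fb] := eqVneq (f b) 0; first by left.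
  have [->|gc] := eqVneq (g c) 0; first by right.
  by case/negP: Sa; rewrite -bc; apply: SD; [apply: hf | apply: hg].
have := @qtM_sub _ _ f g f' g' a f0 g'0.
have Ef b : (deg b < deg a)%N -> f b = f' b by rewrite /f' /trunc => ->.
have Eg b : (deg b < deg a)%N -> g b = g' b by rewrite /g' /trunc => ->.
by move=> /(_ Ef Eg f'0); rewrite e subr0 [f' a]/trunc [g' a]/trunc ltnn !subr0.
Qed.

(** At a lowest exponent a outside S the three coefficients add up to [g a = 0], and the sign of
    [pair v a] allows only one of them to be nonzero. *)
Lemma fact_suppd d S v g p z m : mclosed S -> fact v g p z m -> suppd d S g ->
  [/\ suppd d S p, suppd d S z & suppd d S m].
Proof.
move=> SM F hg.
suff H a : (deg a < d)%N -> [/\ p a != 0 -> S a, z a != 0 -> S a & m a != 0 -> S a].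
  by split=> a /H[].
elim/deg_ind: a => a IH ad.
have [Sa|Sa] := boolP (S a); first by [].
have a0 : a != 0%MM by apply: contra Sa => /eqP ->; case: SM.
have sp : suppd (deg a) S p by move=> b hb; case: (IH b hb (ltn_trans hb ad)).
have sz : suppd (deg a) S z by move=> b hb; case: (IH b hb (ltn_trans hb ad)).
have sm : suppd (deg a) S m by move=> b hb; case: (IH b hb (ltn_trans hb ad)).
have ga : g a = 0 by apply/eqP; apply: contraNT Sa => /(hg _ ad).
have key : p a + z a + m a = 0.
  rewrite -ga (fact_eq F) (@qtM_out S (p * z)) ?qtM0 ?(fact_p0 F) ?(fact_z0 F) ?mulr1 //.
  - by rewrite (@qtM_out S p) ?(fact_p0 F) ?(fact_z0 F).
  - exact: (fact_m0 F).
  - exact: suppdM.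
have [h|h|h] := ltrgtP (pair v a) 0.
- move: key; rewrite (fact_pE F a0 (ltW h)) (fact_zE F a0 (negbT (lt_eqF h))) !add0r => ->.
  by rewrite eqxx.
- move: key; rewrite (fact_mE F a0 (ltW h)) (fact_zE F a0 (negbT (gt_eqF h))) !addr0 => ->.
  by rewrite eqxx.
have le1 : pair v a <= 0 by rewrite h.
have ge1 : 0 <= pair v a by rewrite h.
move: key; rewrite (fact_pE F a0 le1) (fact_mE F a0 ge1) add0r addr0 => ->.
by rewrite eqxx.
Qed.
End Fact.

(** * Logarithms *)

Lemma mnms_rev n (m : 'X_{1..n}) : perm_eq [seq (m - b)%MM | b <- mnms m] (mnms m).
Proof.
have K (x : 'X_{1..n}) : (x <= m)%MM -> (m - (m - x) = x)%MM.
  by move=> h; rewrite -{1}(addm_subK h) addmK.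
apply: uniq_perm; rewrite ?mnms_uniq //.
  rewrite map_inj_in_uniq ?mnms_uniq // => x y; rewrite !mem_mnms => hx hy e.
  by rewrite -(K x hx) e K.
move=> c; rewrite mem_mnms; apply/mapP/idP => [[b _ ->]|h]; first exact: lem_subr.
by exists (m - c)%MM; rewrite ?mem_mnms ?lem_subr // K.
Qed.

Lemma mulr_sub_split (A : pzRingType) (x y x' y' : A) :
  x * y - x' * y' = (x - x') * y + x' * (y - y').
Proof. by rewrite mulrBl mulrBr addrA subrK. Qed.

Section Log.
Variables (n : nat) (L : 'M[int]_n).
Hypothesis skL : forall i j, L i j = - L j i.
Implicit Types (f g u : qt L) (a b m : 'X_{1..n}).

(* The coefficient of y^m in the logarithm of f. *)
Definition lg f m : rat :=
  \sum_(r < deg m) (-1) ^+ r / r.+1%:R * ((f - 1) ^+ r.+1) m.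

Lemma lg_supp S f m : mclosed S -> ~~ S m -> suppd (deg m).+1 S f -> lg f m = 0.
Proof.
move=> SM Sm hf; rewrite /lg big1 // => r _.
suff -> : ((f - 1) ^+ r.+1) m = 0 by rewrite mulr0.
apply/eqP; apply: contraNT Sm => h.
suff : suppd (deg m).+1 S ((f - 1) ^+ r.+1) by apply.
by apply: suppdX => //; apply: suppdD => //; apply: suppdN; apply: suppd1.
Qed.

Lemma lg_agree f f' m : m != 0%MM -> f 0%MM = 1 -> f' 0%MM = 1 ->
  (forall a, (deg a < deg m)%N -> f a = f' a) -> lg f m - lg f' m = f m - f' m.
Proof.
move=> m0 f0 f'0 hf; rewrite /lg -sumrB.
have d0 : (0 < deg m)%N by rewrite lt0n mdeg_eq0.
rewrite (bigD1 (Ordinal d0)) //= !expr1 expr0 invr1 !mul1r big1 ?addr0.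
  by rewrite !qtB opprB subrKA.
move=> [[|r] hr] //= _; rewrite -mulrBr; apply/eqP; rewrite mulf_eq0; apply/orP; right.
pose u := f - 1; pose u' := f' - 1.
have uE a : (deg a < deg m)%N -> u a = u' a by move=> /hf; rewrite /u /u' !qtB => ->.
have wE a : (deg a < deg m)%N -> (u ^+ r.+1) a = (u' ^+ r.+1) a.
  move=> ha; elim: (r.+1) a ha => // k IH a ha; rewrite !exprS.
  by apply: qtM_eq => b /lem_deg hb; [apply: uE | apply: IH]; apply: leq_ltn_trans ha.
have u0 : u 0%MM = 0 by rewrite /u qtB f0 qt1 eqxx subrr.
have u'0 : u' 0%MM = 0 by rewrite /u' qtB f'0 qt1 eqxx subrr.
rewrite -/u -/u' (exprS u) (exprS u').
rewrite -[X in X == _]/((u * u ^+ r.+1 - u' * u' ^+ r.+1) m).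
rewrite mulr_sub_split.
rewrite qtD van_mull ?van_mulr ?u'0 ?exprS ?qtM0 ?u0 ?mul0r ?mulr0 ?addr0 //.
  by move=> a /wE; rewrite !exprS qtB => ->; rewrite subrr.
by move=> a /uE; rewrite qtB => ->; rewrite subrr.
Qed.

(** Truncated below deg m, f is supported in S and has no logarithmic term at m; restoring degree m
    adds [f m], by [lg_agree]. *)
Lemma lg_out S f m : mclosed S -> ~~ S m -> f 0%MM = 1 ->
  suppd (deg m) S f -> lg f m = f m.
Proof.
move=> SM Sm f0 hf.
have m0 : m != 0%MM by apply: contra Sm => /eqP ->; case: SM.
have d0 : (0 < deg m)%N by rewrite lt0n mdeg_eq0.
have t0 : trunc (deg m) f 0%MM = 1 by rewrite /trunc mdeg0 d0.
have := lg_agree m0 f0 t0; rewrite (@lg_supp S (trunc (deg m) f)) //.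
  rewrite /trunc ltnn !subr0; apply.
  by move=> a ->.
move=> a _; rewrite /trunc; case: ltnP => [h|]; last by rewrite eqxx.
exact: hf.
Qed.

Definition par m f := forall a, f a != 0 -> lam L a m = 0.

Lemma parP m f : par m f <-> forall d, suppd d (fun a => lam L a m == 0) f.
Proof.
split=> [h d a _ /h -> //|h a fa]; exact/eqP/(h (deg a).+1 a (ltnSn _) fa).
Qed.

Lemma par_closed m : mclosed (fun a => lam L a m == 0).
Proof.
by split=> [|a b /eqP ha /eqP hb]; rewrite ?lam0l ?lamDl ?ha ?hb.
Qed.

Lemma parM m f g : par m f -> par m g -> par m (f * g).
Proof. by rewrite !parP => hf hg d; apply: suppdM => //; apply: par_closed. Qed.

Lemma parX m f r : par m f -> par m (f ^+ r).
Proof. by rewrite !parP => hf d; apply: suppdX => //; apply: par_closed. Qed.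

Lemma parB1 m f : par m f -> par m (f - 1).
Proof.
rewrite !parP => hf d; apply: suppdD => //; apply: suppdN.
by apply: suppd1; apply: par_closed.
Qed.

Lemma par_inv m f : f 0%MM = 1 -> par m f -> par m (qtinv f).
Proof. by move=> f0; rewrite !parP => hf d; apply: suppd_inv => //; apply: par_closed. Qed.

(* The coefficient at m is a trace: if a + b = m and lam(a, m) = 0 then
   lam(a, b) = 0, so y^a and y^b commute. *)
Lemma qt_trace m f g : par m f -> (f * g) m = (g * f) m.
Proof.
move=> hf; rewrite !qtM.
rewrite -[in RHS](perm_big _ (mnms_rev m)) [RHS]big_map /=.
apply: eq_big_seq => a; rewrite mem_mnms => ha.
have -> : (m - (m - a) = a)%MM by rewrite -{1}(addm_subK ha) addmK.
have [->|fa] := eqVneq (f a) 0; first by rewrite !mulr0 mul0r.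
have e : lam L a (m - a)%MM = 0.
  by have := hf _ fa; rewrite -{1}(addm_subK ha) lamDr lamaa // add0r.
by rewrite (lamC skL (m - a)%MM) e oppr0 expr0z mulrAC.
Qed.

Definition dlt f : qt L := fun a => (deg a)%:R * f a.

Lemma dltM f g : dlt (f * g) = dlt f * g + f * dlt g.
Proof.
apply/qtP => m; rewrite qtD /dlt !qtM big_distrr -big_split /=.
apply: eq_big_seq => a; rewrite mem_mnms => ha.
rewrite -{1}(addm_subK ha) mdegD natrD mulrDl; congr (_ + _).
  by rewrite mulrCA !mulrA; congr (_ * _); rewrite mulrAC.
by rewrite mulrCA.
Qed.

Lemma dlt1B f : dlt (f - 1) = dlt f.
Proof.
apply/qtP => a; rewrite /dlt qtB qt1; have [->|a0] := eqVneq a 0%MM.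
  by rewrite mdeg0 !mul0r.
by rewrite subr0.
Qed.

Lemma dltX_trace m u i r : par m u ->
  (u ^+ i * dlt (u ^+ r.+1)) m = r.+1%:R * (u ^+ (i + r) * dlt u) m.
Proof.
move=> hu; elim: r i => [|r IH] i; first by rewrite expr1 addn0 mul1r.
rewrite exprS dltM mulrDr qtD mulrA -[X in _ + X]/((u ^+ i * (u * dlt (u ^+ r.+1))) m).
rewrite [in X in _ + X]mulrA -exprSr IH.
rewrite (_ : (u ^+ i * dlt u * u ^+ r.+1) m = (u ^+ (i + r.+1) * dlt u) m).
  by rewrite addSnnS -{1}[_ m]mul1r -mulrDl addrC natr1.
rewrite -(qt_trace _ (parX hu)) mulrA -exprD addnC //.
Qed.

(** A logarithmic derivative for the Euler derivation [dlt]. It does not commute with f, but the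
    coefficient at m is a trace on series satisfying [par m], so each power is differentiated as in
    a commutative ring. *)
Lemma lgE f m : f 0%MM = 1 -> par m f ->
  (deg m)%:R * lg f m = (qtinv f * dlt f) m.
Proof.
move=> f0 hf; have hu := parB1 hf.
transitivity ((\sum_(r < deg m) (1 - f) ^+ r * dlt f) m).
  rewrite qt_sum /lg big_distrr; apply: eq_bigr => r _ /=.
  rewrite mulrCA -[X in _ * X]/(dlt ((f - 1) ^+ r.+1) m).
  have := @dltX_trace m (f - 1) 0 r hu; rewrite expr0 mul1r add0n => ->.
  rewrite mulrA divfK ?pnatr_eq0 // dlt1B -[1 - f]opprB [in RHS]exprNn.
  rewrite -signr_odd -[in RHS]signr_odd; case: (odd r); rewrite ?mul1r //.
  by rewrite !expr1 !mulN1r -[in LHS]qtN mulNr.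
rewrite -big_distrl /= !qtM; apply: eq_big_seq => a; rewrite mem_mnms => ha.
have [e|ne] := eqVneq a m.
  have -> : (m - a = 0)%MM by rewrite e; apply/mnmP => i; rewrite mnmBE subnn mnm0E.
  by rewrite /dlt mdeg0 !mul0r !mulr0.
rewrite (@qtinvE _ _ f a (deg m)) //.
apply: (@lt_deg_add _ (m - a)%MM); first by rewrite addmC addm_subK.
by apply: contra ne => /eqP e; rewrite -(submK ha) e add0m.
Qed.

(** The trace kills the commutators of the Baker-Campbell-Hausdorff formula; comparing logarithmic
    derivatives avoids that formula. *)
Lemma lgM f g m : m != 0%MM -> f 0%MM = 1 -> g 0%MM = 1 -> par m f -> par m g ->
  lg (f * g) m = lg f m + lg g m.
Proof.
move=> m0 f0 g0 hf hg.
have d0 : (deg m)%:R != 0 :> rat by rewrite pnatr_eq0 mdeg_eq0.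
apply: (mulfI d0); rewrite mulrDr !lgE ?qtM0 ?f0 ?g0 ?mulr1 //; last exact: parM.
have -> : qtinv (f * g) = qtinv g * qtinv f.
  have h : f * g * (qtinv g * qtinv f) = 1.
    by rewrite mulrA -(mulrA f) qt_mulV // mulr1 qt_mulV.
  have k := @qt_mulVl _ _ (f * g); rewrite qtM0 f0 g0 mulr1 in k.
  by rewrite -[LHS]mulr1 -h mulrA k // mul1r.
rewrite dltM mulrDr qtD -!mulrA; congr (_ + _); last first.
  by rewrite (mulrA (qtinv f)) qt_mulVl // mul1r.
rewrite (qt_trace _ (par_inv g0 hg)) -!mulrA qt_mulV // mulr1 //.
Qed.
End Log.

(** * The quantum dilogarithm *)

Section Seq.
Implicit Types (u w x : nat -> rat).

Definition seqc u w (j : nat) : rat := \sum_(i < j.+1) u i * w (j - i)%N.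

Lemma seqc_poly u w N j : (j < N)%N ->
  seqc u w j = ((\poly_(i < N) u i) * (\poly_(i < N) w i))`_j.
Proof.
move=> hj; rewrite coefM; apply: eq_bigr => i _.
by rewrite !coef_poly !ifT //; have := ltn_ord i; lia.
Qed.

Lemma eq_seqc u w u' w' j : (forall i, (i <= j)%N -> u i = u' i) ->
  (forall i, (i <= j)%N -> w i = w' i) -> seqc u w j = seqc u' w' j.
Proof.
move=> hu hw; apply: eq_bigr => i _; rewrite hu ?hw ?leq_subr //.
by have := ltn_ord i; lia.
Qed.

Lemma seqcC u w j : seqc u w j = seqc w u j.
Proof. by rewrite !(@seqc_poly _ _ j.+1) // mulrC. Qed.

Lemma seqcA u w x j : seqc u (seqc w x) j = seqc (seqc u w) x j.
Proof.
pose p := \poly_(i < j.+1) u i; pose q := \poly_(i < j.+1) w i; pose r := \poly_(i < j.+1) x i.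
transitivity ((p * (q * r))`_j).
  rewrite (@seqc_poly _ _ j.+1) // !coefM; apply: eq_bigr => i _; congr (_ * _).
  by rewrite coef_poly ifT ?ltnS ?leq_subr // (@seqc_poly _ _ j.+1) // ltnS leq_subr.
rewrite mulrA (@seqc_poly _ _ j.+1) // !coefM; apply: eq_bigr => i _; congr (_ * _).
by rewrite coef_poly ifT // (@seqc_poly _ _ j.+1).
Qed.

Lemma seqc_inj u w w' : u 0%N = 1 ->
  (forall j, seqc u w j = seqc u w' j) -> forall j, w j = w' j.
Proof.
move=> u0 h j; elim/ltn_ind: j => j IH.
have := h j; rewrite /seqc !big_ord_recl /= !subn0 u0 !mul1r.
rewrite (eq_bigr (fun i : 'I_j => u (bump 0 i) * w' (j - bump 0 i)%N)); last first.
  by move=> i _; rewrite IH // /bump; have := ltn_ord i; lia.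
by move/addIr.
Qed.
End Seq.

Section Dilog.
Variable Q : rat.
Hypothesis Q1 : 1 < Q.

Let Q0 : Q != 0. Proof. by rewrite gt_eqF // (lt_trans ltr01). Qed.

(* Coefficients of the quantum dilogarithm: the power series solution of
   theta (Q^2 y) = (1 + Q y) theta (y). *)
Fixpoint dl (r : nat) : rat :=
  if r is r'.+1 then Q * dl r' / (Q ^ (2 * r)%:Z - 1) else 1.

(** The coefficients of theta (Q^s y). *)
Definition th (s : int) (r : nat) : rat := dl r * Q ^ (s * r%:Z).

(* Symmetric Gaussian binomials: the coefficients of
   \prod_(i < b) (1 + Q^(2 i + 1 - b) y). *)
Fixpoint qbin (b c : nat) : rat :=
  if b is b'.+1 then
    Q ^ (- c%:Z) * qbin b' c + (if c is c'.+1 then Q ^ (b'%:Z - c'%:Z) * qbin b' c' else 0)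
  else (c == 0%N)%:R.

Lemma qbin_out b c : (b < c)%N -> qbin b c = 0.
Proof.
elim: b c => [|b IH] [|c] //= h.
by rewrite !IH ?mulr0 ?addr0 // ltnW.
Qed.

Lemma qbinS b c : qbin b.+1 c =
  Q ^ (- c%:Z) * qbin b c + (if c is c'.+1 then Q ^ (b%:Z - c'%:Z) * qbin b c' else 0).
Proof. by []. Qed.

(** The definition splits off the factor 1 + Q^b y, this recursion the factor 1 + Q^(-b) y; together
    they give the symmetry [qbin_sym]. *)
Lemma qbin_pascal b c : qbin b.+1 c =
  Q ^ c%:Z * qbin b c + (if c is c'.+1 then Q ^ (c'%:Z - b%:Z) * qbin b c' else 0).
Proof.
elim: b c => [|b IH] [|c].
- by rewrite /= !mulr1.
- rewrite /= !mulr0; case: c => [|c] /=; last by rewrite !mulr0.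
  by rewrite subrr.
- by [].
rewrite (qbinS b c.+1) [in RHS](qbinS b c) [LHS]qbinS !IH.
have E i j X : Q ^ i * (Q ^ j * X) = Q ^ (i + j) * X by rewrite mulrA -expfzDr.
rewrite !mulrDr !E addrACA; congr (_ + _ + (_ + _)).
- by congr (_ ^ _ * _); lia.
- by congr (_ ^ _ * _); lia.
case: c => [|c]; rewrite ?mulr0 // !E; congr (_ ^ _ * _); lia.
Qed.

Lemma qbin_sym b c : (c <= b)%N -> qbin b (b - c) = qbin b c.
Proof.
elim: b c => [|b IH] [|c] // hc.
- rewrite subn0 qbin_pascal [in RHS]/= qbin_out // mulr0 add0r addr0 subrr.
  by have := IH 0%N isT; rewrite subn0 => ->; rewrite oppr0.
rewrite subSS qbin_pascal [in RHS]/= [RHS]addrC IH //.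
congr (_ * _ + _); first by congr (_ ^ _); lia.
have [h|h] := leqP c.+1 b; last first.
  have -> : (b - c)%N = 0%N by lia.
  by rewrite qbin_out // mulr0.
have -> : (b - c = (b - c.+1).+1)%N by lia.
by rewrite IH //; congr (_ ^ _ * _); lia.
Qed.

Lemma Qpow_neq1 r : Q ^ (2 * r.+1)%:Z - 1 != 0.
Proof.
rewrite subr_eq0 gt_eqF // -exprnP; apply: exprn_egt1 => //; lia.
Qed.

Lemma dlS r : dl r.+1 * (Q ^ (2 * r.+1)%:Z - 1) = Q * dl r.
Proof. by rewrite /= divfK // Qpow_neq1. Qed.

Lemma th_shift (s : int) r : th (s + 1) r =
  th (s - 1) r + (if r is r'.+1 then Q ^ s * th (s - 1) r' else 0).
Proof.
rewrite /th; case: r => [|r]; first by rewrite !mulr0 !expr0z addr0.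
have -> : (s + 1) * r.+1%:Z = (s - 1) * r.+1%:Z + (2 * r.+1)%:Z by lia.
have -> : Q ^ s * (dl r * Q ^ ((s - 1) * r%:Z)) = Q * dl r * Q ^ ((s - 1) * r.+1%:Z).
  rewrite mulrCA -expfzDr // -[Q in Q * dl r]expr1z mulrAC -expfzDr // mulrC.
  by congr (_ ^ _ * _); lia.
by rewrite expfzDr // -dlS; move: (Q ^ _) (Q ^ _) (dl _) => x y z; ring.
Qed.

(** The functional equation iterated b times: theta (Q^b y) is theta (Q^(-b) y) times the product of
    1 + Q^e y for e = b - 1, b - 3, ..., 1 - b. *)
Lemma th_qbin (b : nat) r : th b%:Z r = seqc (qbin b) (th (- b%:Z)) r.
Proof.
elim: b r => [|b IH] r.
  rewrite /seqc big_ord_recl /= mul1r subn0 oppr0 big1 ?addr0 // => i _.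
  by rewrite mul0r.
have S (t : int) (e : int) i : th (t + e) i = Q ^ (e * i%:Z) * th t i.
  by rewrite /th mulrDl expfzDr // [RHS]mulrCA; congr (_ * _); exact: mulrC.
have E j : th (b%:Z - 1) j = seqc (fun c => Q ^ (- c%:Z) * qbin b c) (th (- b.+1%:Z)) j.
  rewrite (S b%:Z (- 1)) IH /seqc big_distrr; apply: eq_bigr => i _ /=.
  have -> : - b.+1%:Z = - b%:Z + (- 1) by lia.
  rewrite S; have hi := ltn_ord i.
  have -> : -1 * j%:Z = - i%:Z + -1 * (j - i)%N%:Z by lia.
  by rewrite expfzDr //; move: (Q ^ _) (Q ^ _) (qbin _ _) (th _ _) => x y z t; ring.
have -> : b.+1%:Z = b%:Z + 1 by lia.
rewrite th_shift.
have -> : - (b%:Z + 1) = - b.+1%:Z by lia.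
rewrite E /seqc [RHS](eq_bigr (fun c : 'I_r.+1 => Q ^ (- c%:Z) * qbin b c * th (- b.+1%:Z) (r - c)
  + (if (c : nat) is c'.+1 then Q ^ (b%:Z - c'%:Z) * qbin b c' else 0) * th (- b.+1%:Z) (r - c))).
  2: by move=> i _; rewrite -mulrDl.
rewrite big_split /=; congr (_ + _).
case: r => [|r]; first by rewrite big_ord_recl big_ord0 /= mul0r add0r.
rewrite [RHS]big_ord_recl /= mul0r add0r E /seqc big_distrr; apply: eq_bigr => i _ /=.
by rewrite subSS !mulrA -expfzDr.
Qed.

(** Dividing by theta turns conjugation by an infinite series into multiplication by a polynomial of
    degree b. This finiteness is what later permits the substitution of 1/y_k. *)
Lemma th_conv (b : nat) u w :
  (forall j, w j = seqc (qbin b) u j) <->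
  (forall j, seqc (th b%:Z) u j = seqc (th (- b%:Z)) w j).
Proof.
have H j : seqc (th b%:Z) u j = seqc (th (- b%:Z)) (seqc (qbin b) u) j.
  rewrite seqcA; apply: eq_seqc => // i _; rewrite th_qbin; exact: seqcC.
split=> [h j|h]; first by rewrite H; apply: eq_seqc => // i _; rewrite h.
apply: (@seqc_inj (th (- b%:Z))); first by rewrite /th mulr0 expr0z mulr1.
by move=> j; rewrite -h H.
Qed.
End Dilog.

(** * Multiplication by theta_k along lines parallel to the k-th axis *)

Section Axis.
Variable n : nat.
Implicit Types (a b : 'X_{1..n}) (k : 'I_n).

Definition setk k a (j : nat) : 'X_{1..n} := [multinom (if i == k then j else a i) | i < n].

Lemma setkk k a j : setk k a j k = j. Proof. by rewrite mnmE eqxx. Qed.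
Lemma setkN k a j i : i != k -> setk k a j i = a i.
Proof. by move=> h; rewrite mnmE (negbTE h). Qed.
Lemma setk_id k a : setk k a (a k) = a.
Proof. by apply/mnmP => i; rewrite mnmE; case: eqP => [->|]. Qed.
Lemma setk_setk k a i j : setk k (setk k a i) j = setk k a j.
Proof. by apply/mnmP => l; rewrite !mnmE; case: eqP. Qed.
Lemma axisE k r i : (U_(k) *+ r)%MM i = if i == k then r else 0%N.
Proof. by rewrite mulmnE mnm1E eq_sym; case: eqP => _; rewrite ?mul1n ?mul0n. Qed.
Lemma deg_setk k a j : (deg (setk k a j) + a k = deg a + j)%N.
Proof.
rewrite !mdegE (bigD1 k) //= [in RHS](bigD1 k) //= setkk.
rewrite (eq_bigr a); last by move=> i /setkN ->.
by lia.
Qed.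

Lemma sub_axis k a r : (r <= a k)%N -> (a - U_(k) *+ r)%MM = setk k a (a k - r).
Proof.
move=> h; apply/mnmP => i; rewrite mnmBE axisE mnmE.
by case: eqP => [->|_] //; rewrite subn0.
Qed.

Definition on_axis k a := a == (U_(k) *+ a k)%MM.

Lemma on_axisP k a : reflect (forall i, i != k -> a i = 0%N) (on_axis k a).
Proof.
apply: (iffP eqP) => [-> i ik|h]; first by rewrite axisE (negbTE ik).
by apply/mnmP => i; rewrite axisE; case: (eqVneq i k) => [->|/h ->].
Qed.

Lemma on_axisU k r : on_axis k (U_(k) *+ r)%MM.
Proof. by apply/on_axisP => i ik; rewrite axisE (negbTE ik). Qed.

Lemma on_axisD k a b : on_axis k (a + b)%MM = on_axis k a && on_axis k b.
Proof.
apply/on_axisP/andP => [h|[/on_axisP ha /on_axisP hb] i ik]; last first.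
  by rewrite mnmDE ha // hb.
by split; apply/on_axisP => i /h; rewrite mnmDE; lia.
Qed.

Lemma mnms_axis (V : nmodType) k a (F : 'X_{1..n} -> V) :
  \sum_(b <- mnms a) (if on_axis k b then F b else 0) =
  \sum_(r < (a k).+1) F (U_(k) *+ r)%MM.
Proof.
rewrite -big_mkcond -big_filter -(big_mkord xpredT (fun r => F (U_(k) *+ r)%MM)).
rewrite -[RHS](big_map (fun r => (U_(k) *+ r)%MM) xpredT F); apply: perm_big.
apply: uniq_perm.
- by rewrite filter_uniq ?mnms_uniq.
- rewrite map_inj_uniq ?iota_uniq // => r s /mnmP /(_ k).
  by rewrite !axisE eqxx.
move=> b; rewrite mem_filter mem_mnms; apply/andP/mapP.
  move=> [/eqP hb /mnm_lepP /(_ k) h]; exists (b k) => //.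
  by rewrite mem_index_iota /= ltnS.
move=> [r]; rewrite mem_index_iota ltnS /= => hr ->; split; first exact: on_axisU.
by apply/mnm_lepP => i; rewrite axisE; case: eqP => [->|].
Qed.
End Axis.

Section Theta.
Variables (n : nat) (B : 'M[int]_n) (d : 'I_n -> int).
Hypothesis d_gt0 : forall i, 0 < d i.
Hypothesis skB : forall i j, d i * B i j = - (d j * B j i).

Definition qform : 'M[int]_n := \matrix_(i, j) (d i * B i j).
Notation L := qform.
Implicit Types (f g h : qt L) (a b : 'X_{1..n}) (k : 'I_n).

Lemma qform_skew i j : L i j = - L j i.
Proof. by rewrite !mxE. Qed.
Hint Resolve qform_skew : core.

Definition beta k a : int := \sum_j B k j * (a j)%:Z.

Lemma Bkk k : B k k = 0.
Proof. by apply/eqP; have := skB k k; have := d_gt0 k; nia. Qed.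

Lemma beta_setk k a j : beta k (setk k a j) = beta k a.
Proof.
apply: eq_bigr => i _; have [->|ik] := eqVneq i k; first by rewrite Bkk !mul0r.
by rewrite setkN.
Qed.

Lemma lam_axisl k r a : lam L (U_(k) *+ r)%MM a = d k * beta k a * r%:Z.
Proof.
rewrite /lam (bigD1 k) //= [X in _ + X]big1 ?addr0; last first.
  by move=> i ik; rewrite big1 // => j _; rewrite axisE (negbTE ik) !mul0r.
rewrite /beta mulr_sumr mulr_suml; apply: eq_bigr => j _.
by rewrite axisE eqxx mxE; ring.
Qed.

Lemma lamU k a : lam L U_(k)%MM a = d k * beta k a.
Proof. by rewrite -[U_(k)%MM]mulm1n lam_axisl mulr1. Qed.

Definition Qk k : rat := 2 ^ d k.

Lemma Qk_gt1 k : 1 < Qk k.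
Proof.
rewrite /Qk; have := d_gt0 k; case: (d k) => // [[|m]] // _.
by rewrite -exprnP exprn_egt1.
Qed.

Lemma Qk_exp k (s : int) : Qk k ^ s = 2 ^ (d k * s).
Proof. by rewrite /Qk -exprz_exp. Qed.

Definition theta k : qt L := fun a => if on_axis k a then dl (Qk k) (a k) else 0.

Lemma theta0 k : theta k 0%MM = 1.
Proof. by rewrite /theta mnm0E (introT (on_axisP _ _)) // => i; rewrite mnm0E. Qed.

Lemma thetaN k a : ~~ on_axis k a -> theta k a = 0.
Proof. by rewrite /theta => /negbTE ->. Qed.

Lemma theta_neq0 k a : theta k a != 0 -> on_axis k a.
Proof. by apply: contraNT => /thetaN ->. Qed.

Definition sq k f a (j : nat) : rat := f (setk k a j).

Lemma sq_setk k f a j : sq k f (setk k a j) = sq k f a.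
Proof. by apply/funext => i; rewrite /sq setk_setk. Qed.

(** The twist between y_k^r and the other exponent is Q_k^(r beta), and beta is constant along the
    line because b_kk = 0. So on each line theta_k acts as a rescaled dilogarithm in one
    variable. *)
Lemma theta_mull k f a :
  (theta k * f) a = seqc (th (Qk k) (beta k a)) (sq k f a) (a k).
Proof.
rewrite qtM.
transitivity (\sum_(b <- mnms a) if on_axis k b then
   2 ^ lam L b (a - b)%MM * dl (Qk k) (b k) * f (a - b)%MM else 0).
  by apply: eq_bigr => b _; rewrite /theta; case: ifP; rewrite ?mulr0 ?mul0r.
rewrite mnms_axis; apply: eq_bigr => r _; have hr : (r <= a k)%N by rewrite -ltnS.
rewrite sub_axis // axisE eqxx lam_axisl beta_setk /th Qk_exp mulrA.
by congr (_ * _); rewrite mulrC.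
Qed.

Lemma theta_mulr k f a :
  (f * theta k) a = seqc (th (Qk k) (- beta k a)) (sq k f a) (a k).
Proof.
rewrite qtM -(perm_big _ (mnms_rev a)) big_map.
transitivity (\sum_(b <- mnms a) if on_axis k b then
   2 ^ lam L (a - b)%MM b * f (a - b)%MM * dl (Qk k) (b k) else 0).
  apply: eq_big_seq => b; rewrite mem_mnms => hb.
  have -> : (a - (a - b) = b)%MM by rewrite -{1}(addm_subK hb) addmK.
  by rewrite /theta; case: ifP; rewrite ?mulr0 ?mul0r.
rewrite mnms_axis; apply: eq_bigr => r _; have hr : (r <= a k)%N by rewrite -ltnS.
rewrite sub_axis // axisE eqxx lamC // lam_axisl beta_setk /th Qk_exp.
rewrite mulrAC [X in _ = X * _]mulrC; congr (_ ^ _ * _ * _); lia.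
Qed.

Lemma theta_conjP k h h' : theta k * h = h' * theta k <->
  forall a j, seqc (th (Qk k) (beta k a)) (sq k h a) j =
              seqc (th (Qk k) (- beta k a)) (sq k h' a) j.
Proof.
split=> [e a j|e]; last first.
  by apply/qtP => a; rewrite theta_mull theta_mulr.
have := congr1 (fun f : qt L => f (setk k a j)) e.
by rewrite /= theta_mull theta_mulr !beta_setk !sq_setk setkk.
Qed.

Lemma theta_conj_pos k h h' a (b : nat) : theta k * h = h' * theta k -> beta k a = b%:Z ->
  forall j, sq k h' a j = seqc (qbin (Qk k) b) (sq k h a) j.
Proof.
move=> /theta_conjP e ba; apply: (proj2 (th_conv (Qk_gt1 k) b (sq k h a) (sq k h' a))).
by move=> j; rewrite -ba.
Qed.

Lemma theta_conj_neg k h h' a (b : nat) : theta k * h = h' * theta k -> beta k a = - b%:Z ->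
  forall j, sq k h a j = seqc (qbin (Qk k) b) (sq k h' a) j.
Proof.
move=> /theta_conjP e ba; apply: (proj2 (th_conv (Qk_gt1 k) b (sq k h' a) (sq k h a))).
by move=> j; have := e a j; rewrite ba opprK.
Qed.
End Theta.

(** * The scattering element *)

Section FactMore.
Variables (n : nat) (L : 'M[int]_n).
Implicit Types (f g h p z m : qt L) (a b : 'X_{1..n}).

Lemma fact_top v g g' p z m p' z' m' a :
  fact v g p z m -> fact v g' p' z' m' ->
  (forall b, (deg b < deg a)%N -> g b = g' b) -> a != 0%MM -> pair v a = 0 ->
  z a - z' a = g a - g' a.
Proof.
move=> F F' hg a0 va; have A := fact_agree F F' hg.
have le1 : pair v a <= 0 by rewrite va.
have ge1 : 0 <= pair v a by rewrite va.
rewrite (fact_eq F) (fact_eq F') qtM3_sub ?(fact_p0 F) ?(fact_p0 F') ?(fact_z0 F)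
  ?(fact_z0 F') ?(fact_m0 F) ?(fact_m0 F') //; try by move=> b /A[].
rewrite (fact_pE F a0 le1) (fact_pE F' a0 le1) (fact_mE F a0 ge1) (fact_mE F' a0 ge1).
by rewrite subrr add0r addr0.
Qed.

Definition zpart v g : qt L :=
  if pselect (exists z p m, fact v g p z m) is left e then projT1 (cid e) else 1.

Lemma zpartP v g : g 0%MM = 1 -> exists p m, fact v g p (zpart v g) m.
Proof.
move=> g0; rewrite /zpart; case: pselect => [e|[]]; first exact: (projT2 (cid e)).
by have [p [z [m F]]] := fact_exists v g0; exists z, p, m.
Qed.
End FactMore.

Section Inc.
Variables (n : nat) (B : 'M[int]_n) (d : 'I_n -> int).
Hypothesis d_gt0 : forall i, 0 < d i.
Hypothesis skB : forall i j, d i * B i j = - (d j * B j i).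
Notation L := (qform B d).
Implicit Types (f g h p z m : qt L) (a b : 'X_{1..n}) (k : 'I_n).
Let skL := @qform_skew n B d skB.

Definition vn a : 'I_n -> int := fun i => \sum_j L i j * (a j)%:Z.

Lemma pair_vn a b : pair (vn a) b = lam L b a.
Proof.
apply: eq_bigr => i _; rewrite mulrC mulr_sumr; apply: eq_bigr => j _; exact: mulrA.
Qed.

Definition off a := [forall k, ~~ on_axis k a].

(* The scattering element of B: theta_k on the k-th axis, and no incoming wall
   in the other degrees: for each a the factorization at the point lam(., a) of
   the hyperplane orthogonal to a has no logarithmic term of degree a. *)
Definition inc g := [/\ g 0%MM = 1,
  forall k r, g (U_(k) *+ r)%MM = dl (Qk d k) r &
  forall a, off a -> forall p z m, fact (vn a) g p z m -> lg z a = 0].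

(** The pairing of [vn a] with a is zero, so [g a] enters the factorization at [vn a] through [z a]
    alone, and with coefficient 1, as it does the logarithm. The condition at a is thus solved by
    lower degrees: [g a] is minus the logarithmic term of the truncation. *)
Lemma inc_exists : exists g, inc g.
Proof.
pose Phi g a := if a == 0%MM then 1 else
  if [pick k | on_axis k a] is Some k then dl (Qk d k) (a k)
  else - lg (zpart (vn a) (trunc (deg a) g)) a.
have [g g' a H|g hg] := @deg_fixpoint n rat 0 (Phi : ('X_{1..n} -> rat) -> 'X_{1..n} -> rat).
  rewrite /Phi; suff -> : (trunc (deg a) g : qt L) = trunc (deg a) g' by [].
  by apply/qtP => b; rewrite /trunc; case: ifP => // /H.
have g0 : g 0%MM = 1 by rewrite hg /Phi eqxx.
exists g; split => // [k r|a offa p z m F].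
  rewrite hg /Phi; case: eqP => [/mnmP/(_ k)|/eqP r0].
    by rewrite axisE eqxx mnm0E => ->.
  case: pickP => [l /on_axisP hl|/(_ k)]; last by rewrite on_axisU.
  have -> : l = k.
    apply: contraNeq r0 => lk; have := hl k; rewrite eq_sym axisE eqxx => /(_ lk) ->.
    by rewrite mulm0n.
  by rewrite axisE eqxx.
have [->|a0] := eqVneq a 0%MM; first by rewrite /lg mdeg0 big_ord0.
pose f : qt L := trunc (deg a) g.
have f0 : f 0%MM = 1 by rewrite /f /trunc mdeg0 lt0n mdeg_eq0 a0.
have [p' [m' F']] := zpartP (vn a) f0.
have hgf b : (deg b < deg a)%N -> g b = f b by rewrite /f /trunc => ->.
have va : pair (vn a) a = 0 by rewrite pair_vn lamaa.
have A := fact_agree F F' hgf.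
have := fact_top F F' hgf a0 va.
rewrite -(lg_agree a0 (fact_z0 F) (fact_z0 F')) => [|b /A[]//].
rewrite [f a]/trunc ltnn subr0 hg /Phi (negbTE a0).
case: pickP => [k ka|_]; first by move/forallP/(_ k): offa; rewrite ka.
by move/eqP; rewrite subr_eq addNr => /eqP.
Qed.

(** * Splitting off theta_k from the scattering element *)

Section K.
Variable k : 'I_n.
Notation thk := (theta B d k).

Definition offk a := ~~ on_axis k a.

Definition hr g : qt L := qtinv thk * g.
Definition hl g : qt L := g * qtinv thk.

Lemma hrE g : g = thk * hr g.
Proof. by rewrite /hr mulrA qt_mulV ?mul1r // theta0. Qed.
Lemma hlE g : g = hl g * thk.
Proof. by rewrite /hl -mulrA qt_mulVl ?mulr1 // theta0. Qed.

Lemma hr0 g : g 0%MM = 1 -> hr g 0%MM = 1.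
Proof. by move=> g0; rewrite /hr /hl qtM0 qtinv0 ?theta0 // g0 mulr1. Qed.
Lemma hl0 g : g 0%MM = 1 -> hl g 0%MM = 1.
Proof. by move=> g0; rewrite /hr /hl qtM0 qtinv0 ?theta0 // g0 mulr1. Qed.

Lemma suppd_theta D (S : pred 'X_{1..n}) : (forall a, on_axis k a -> S a) ->
  suppd D S (thk : qt L).
Proof. by move=> h a _ /theta_neq0; apply: h. Qed.

Lemma axis_closed : mclosed (on_axis k : pred 'X_{1..n}).
Proof.
split=> [|a b ha hb]; last by rewrite on_axisD ha.
by apply/on_axisP => i _; rewrite mnm0E.
Qed.

Lemma thinv_supp a : qtinv (thk : qt L) a != 0 -> on_axis k a.
Proof.
apply: (@suppd_inv _ _ (deg a).+1 (on_axis k) _ axis_closed (theta0 _ _ k)) => //.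
exact: suppd_theta.
Qed.

Lemma hr_axis g a : inc g -> on_axis k a -> a != 0%MM -> hr g a = 0.
Proof.
move=> [g0 gax _] ka a0.
have -> : hr g a = (qtinv thk * thk) a.
  rewrite /hr; rewrite !qtM; apply: eq_big_seq => b; rewrite mem_mnms => hb.
  have : on_axis k (a - b)%MM.
    by move: ka; rewrite -{1}(addm_subK hb) on_axisD => /andP[].
  by move=> h; rewrite [thk _]/theta h; move/eqP: h => ->; rewrite gax axisE eqxx.
by rewrite qt_mulVl ?theta0 // qt1 (negbTE a0).
Qed.

Lemma hl_axis g a : inc g -> on_axis k a -> a != 0%MM -> hl g a = 0.
Proof.
move=> [g0 gax _] ka a0.
have -> : hl g a = (thk * qtinv thk) a.
  rewrite /hl; rewrite !qtM; apply: eq_big_seq => b; rewrite mem_mnms => hb.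
  have : on_axis k b.
    by move: ka; rewrite -{1}(addm_subK hb) on_axisD => /andP[].
  by move=> h; rewrite [thk b]/theta h; move/eqP: h => ->; rewrite gax axisE eqxx.
by rewrite qt_mulV ?theta0 // qt1 (negbTE a0).
Qed.

Lemma hr_hl g : thk * hr g = hl g * thk.
Proof. by rewrite -hrE -hlE. Qed.

Lemma pair_axis v a : on_axis k a -> pair v a = v k * (a k)%:Z.
Proof.
move/on_axisP => h; rewrite /pair (bigD1 k) //= big1 ?addr0 // => i /h ->.
by rewrite mulr0.
Qed.

Lemma fact_mul_theta v h p z m : 0 < v k -> fact v h p z m ->
  fact v (thk * h) (thk * p) z m.
Proof.
move=> vk F; split; rewrite ?qtM0 ?(theta0 B d k) ?(fact_p0 F) ?mul1r //.
- by rewrite {1}(fact_eq F) !mulrA.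
- exact: (fact_z0 F).
- exact: (fact_m0 F).
- move=> a a0 /qtM_neq0[b [c [e /theta_neq0 tb pc]]].
  have hb : 0 <= pair v b by rewrite pair_axis //; apply: mulr_ge0 => //; exact: ltW.
  rewrite -e pairD; have [c0|c0] := eqVneq c 0%MM; last first.
    by rewrite ltr_wpDl // (fact_p F).
  rewrite c0 pair0 addr0 lt_neqAle hb andbT eq_sym pair_axis //.
  apply: mulf_neq0; first by rewrite gt_eqF.
  apply: contra a0 => /eqP bk; rewrite -e c0 addm0 (eqP tb).
  have -> : b k = 0%N by lia.
  by rewrite mulm0n.
- exact: (fact_z F).
- exact: (fact_m F).
Qed.

Lemma fact_theta_mul v h p z m : v k < 0 -> fact v h p z m ->
  fact v (h * thk) p z (m * thk).
Proof.
move=> vk F; split; rewrite ?qtM0 ?(theta0 B d k) ?(fact_m0 F) ?mul1r //.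
- by rewrite {1}(fact_eq F) !mulrA.
- exact: (fact_p0 F).
- exact: (fact_z0 F).
- exact: (fact_p F).
- exact: (fact_z F).
- move=> a a0 /qtM_neq0[c [b [e pc /theta_neq0 tb]]].
  have hb : pair v b <= 0 by rewrite pair_axis //; apply: mulr_le0_ge0 => //; exact: ltW.
  rewrite -e pairD; have [c0|c0] := eqVneq c 0%MM; last first.
    by rewrite ltr_wnDr // (fact_m F).
  rewrite c0 pair0 add0r lt_neqAle hb andbT pair_axis //.
  apply: mulf_neq0; first by rewrite lt_eqF.
  apply: contra a0 => /eqP bk; rewrite -e c0 add0m (eqP tb).
  have -> : b k = 0%N by lia.
  by rewrite mulm0n.
Qed.

(** On v_k = 0 the exponents of theta_k pair to zero, so it belongs to the wall function; moving it
    past p conjugates p without changing pairings. *)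
Lemma fact_mul_theta0 v h p z m : v k = 0 -> fact v h p z m ->
  fact v (thk * h) (thk * p * qtinv thk) (thk * z) m.
Proof.
move=> vk F; have t0 := theta0 B d k; have ti0 := qtinv0 t0.
have ax0 b : on_axis k b -> pair v b = 0 by move=> hb; rewrite pair_axis // vk mul0r.
split; rewrite ?qtM0 ?t0 ?ti0 ?(fact_p0 F) ?(fact_z0 F) ?(fact_m0 F) ?mul1r //.
- rewrite {1}(fact_eq F) -!mulrA; congr (_ * (_ * _)).
  by rewrite [RHS]mulrA qt_mulVl // mul1r.
- move=> a a0 na.
  (* Conjugation fixes the constant term 1; removing it leaves only exponents of positive
     pairing. *)
  have {na} : (thk * (p - 1) * qtinv thk) a != 0.
    by move: na; rewrite mulrBr mulr1 mulrBl qt_mulV // qtB qt1 (negbTE a0) subr0.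
  move=> /qtM_neq0[b [c [<- /qtM_neq0[x [y [<- /theta_neq0 tx py]]] /thinv_supp tc]]].
  rewrite !pairD (ax0 x) // (ax0 c) // add0r addr0.
  move: py; rewrite qtB qt1; have [->|y0] := eqVneq y 0%MM.
    by rewrite (fact_p0 F) subrr eqxx.
  by rewrite subr0; apply: (fact_p F).
- move=> a a0 /qtM_neq0[b [c [<- /theta_neq0 tb zc]]].
  rewrite pairD (ax0 b) // add0r; have [->|c0] := eqVneq c 0%MM; first exact: pair0.
  exact: (fact_z F).
- exact: (fact_m F).
Qed.

Lemma fact_theta0_mul v h p z m : v k = 0 -> fact v h p z m ->
  fact v (h * thk) p (z * thk) (qtinv thk * m * thk).
Proof.
move=> vk F; have t0 := theta0 B d k; have ti0 := qtinv0 t0.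
have ax0 b : on_axis k b -> pair v b = 0 by move=> hb; rewrite pair_axis // vk mul0r.
split; rewrite ?qtM0 ?t0 ?ti0 ?(fact_p0 F) ?(fact_z0 F) ?(fact_m0 F) ?mul1r //.
- rewrite {1}(fact_eq F) -!mulrA; congr (_ * (_ * _)).
  by rewrite [RHS]mulrA qt_mulV // mul1r.
- exact: (fact_p F).
- move=> a a0 /qtM_neq0[c [b [<- zc /theta_neq0 tb]]].
  rewrite pairD (ax0 b) // addr0; have [->|c0] := eqVneq c 0%MM; first exact: pair0.
  exact: (fact_z F).
move=> a a0 na.
have {na} : (qtinv thk * (m - 1) * thk) a != 0.
  by move: na; rewrite mulrBr mulr1 mulrBl qt_mulVl // qtB qt1 (negbTE a0) subr0.
move=> /qtM_neq0[b [c [<- /qtM_neq0[x [y [<- /thinv_supp tx py]]] /theta_neq0 tc]]].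
rewrite !pairD (ax0 x) // (ax0 c) // add0r addr0.
move: py; rewrite qtB qt1; have [->|y0] := eqVneq y 0%MM.
  by rewrite (fact_m0 F) subrr eqxx.
by rewrite subr0; apply: (fact_m F).
Qed.

Lemma lg_theta a : offk a -> lg (thk : qt L) a = 0.
Proof. by move=> ka; apply: (lg_supp axis_closed ka); apply: suppd_theta. Qed.

Lemma vnk a : vn a k = d k * beta B k a.
Proof. by rewrite -(pairU (vn a)) pair_vn lamU. Qed.

Lemma fact_par a h p z m : fact (vn a) h p z m -> par a z.
Proof.
move=> F b zb; have [->|b0] := eqVneq b 0%MM; first exact: lam0l.
by rewrite -pair_vn (fact_z F).
Qed.

Lemma theta_par a : beta B k a = 0 -> par a (thk : qt L).
Proof.
move=> ba b /theta_neq0 /eqP ->; rewrite (lam_axisl B d) ba mulr0 mul0r //.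
Qed.

(* If v_k = 0 the middle factor becomes theta_k z, and lg is additive there. *)
Lemma fact_lg_l a h p z m : offk a -> 0 <= beta B k a -> fact (vn a) h p z m ->
  exists p' z' m', fact (vn a) (thk * h) p' z' m' /\ lg z' a = lg z a.
Proof.
move=> ka; rewrite le_eqVlt => /orP[/eqP ba|ba] F.
  exists (thk * p * qtinv thk), (thk * z), m; split.
    by apply: fact_mul_theta0 => //; rewrite vnk -ba mulr0.
  rewrite lgM ?(fact_z0 F) ?theta0 ?lg_theta ?add0r //.
  - by apply: contra ka => /eqP ->; case: axis_closed.
  - exact: theta_par.
  - exact: fact_par F.
exists (thk * p), z, m; split => //.
by apply: fact_mul_theta => //; rewrite vnk mulr_gt0.
Qed.

Lemma fact_lg_r a h p z m : offk a -> beta B k a <= 0 -> fact (vn a) h p z m ->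
  exists p' z' m', fact (vn a) (h * thk) p' z' m' /\ lg z' a = lg z a.
Proof.
move=> ka; rewrite le_eqVlt => /orP[/eqP ba|ba] F.
  exists p, (z * thk), (qtinv thk * m * thk); split.
    by apply: fact_theta0_mul => //; rewrite vnk ba mulr0.
  rewrite lgM ?(fact_z0 F) ?theta0 ?lg_theta ?addr0 //.
  - by apply: contra ka => /eqP ->; case: axis_closed.
  - exact: fact_par F.
  - exact: theta_par.
exists p, z, (m * thk); split => //.
by apply: fact_theta_mul => //; rewrite vnk pmulr_rlt0.
Qed.

(** One half of the incoming condition: where beta > 0 the left factor theta_k is absorbed by the
    positive part, and where beta = 0 it adds no logarithmic term, so the condition can be read on
    [hr]. The other half is read on [hl]. *)
Definition incr g := forall a, off a -> 0 <= beta B k a ->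
  forall p z m, fact (vn a) (hr g) p z m -> lg z a = 0.
Definition incl g := forall a, off a -> beta B k a <= 0 ->
  forall p z m, fact (vn a) (hl g) p z m -> lg z a = 0.

Lemma off_offk a : off a -> offk a. Proof. by move/forallP/(_ k). Qed.

Lemma inc_incr g : inc g -> incr g.
Proof.
move=> [g0 gax gi] a oa ba p z m F.
have [p' [z' [m' [F' <-]]]] := fact_lg_l (off_offk oa) ba F.
by apply: (gi a oa p' z' m'); rewrite -hrE in F'.
Qed.

Lemma inc_incl g : inc g -> incl g.
Proof.
move=> [g0 gax gi] a oa ba p z m F.
have [p' [z' [m' [F' <-]]]] := fact_lg_r (off_offk oa) ba F.
by apply: (gi a oa p' z' m'); rewrite -hlE in F'.
Qed.

Lemma inc_of g h h' : thk * h = g -> h' * thk = g -> g 0%MM = 1 ->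
  (forall l r, g (U_(l) *+ r)%MM = dl (Qk d l) r) ->
  (forall a, off a -> 0 <= beta B k a -> exists p z m, fact (vn a) h p z m /\ lg z a = 0) ->
  (forall a, off a -> beta B k a <= 0 -> exists p z m, fact (vn a) h' p z m /\ lg z a = 0) ->
  inc g.
Proof.
move=> eh eh' g0 gax H H'; split=> // a oa p z m F.
have [ba|/ltW ba] := leP 0 (beta B k a).
  have [q [y [l [G y0]]]] := H a oa ba.
  have [p' [z' [m' [F' e]]]] := fact_lg_l (off_offk oa) ba G.
  by rewrite eh in F'; have [_ -> _] := fact_uniq F F'; rewrite e.
have [q [y [l [G y0]]]] := H' a oa ba.
have [p' [z' [m' [F' e]]]] := fact_lg_r (off_offk oa) ba G.
by rewrite eh' in F'; have [_ -> _] := fact_uniq F F'; rewrite e.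
Qed.
End K.
End Inc.

Lemma pospart_sub (x : int) : x = (pospart x)%:Z - (pospart (- x))%:Z.
Proof. rewrite /pospart; do 2 case: ifP; lia. Qed.

Lemma fact_out n (L : 'M[int]_n) S v (h p z m : qt L) a : mclosed S -> ~~ S a ->
  suppd (deg a) S h -> fact v h p z m -> pair v a = 0 -> h a = z a.
Proof.
move=> SM Sa hS F va; have a0 : a != 0%MM by apply: contra Sa => /eqP ->; case: SM.
have [sp sz sm] := fact_suppd SM F hS.
have p0 : p a = 0 by rewrite (fact_pE F) // va.
have m0 : m a = 0 by rewrite (fact_mE F) // va.
rewrite (fact_eq F) (qtM_out (S := S)) ?qtM0 ?(fact_p0 F) ?(fact_z0 F) ?(fact_m0 F) ?mulr1 //.
  by rewrite (qtM_out (S := S)) ?(fact_p0 F) ?(fact_z0 F) // p0 m0 add0r addr0.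
exact: suppdM.
Qed.

(** * Bounds on the y_k-degree *)

Section Support.
Variables (n : nat) (B : 'M[int]_n) (d : 'I_n -> int).
Hypothesis d_gt0 : forall i, 0 < d i.
Hypothesis skB : forall i j, d i * B i j = - (d j * B j i).
Notation L := (qform B d).
Variable k : 'I_n.
Implicit Types (f g h p z m : qt L) (a b : 'X_{1..n}) (w : 'I_n -> nat).

Definition wt w a : nat := \sum_i w i * a i.
Definition wpos (i : 'I_n) : nat := pospart (B k i).
Definition wneg (i : 'I_n) : nat := pospart (- B k i).
Definition belowk w : pred 'X_{1..n} := fun a => (a k <= wt w a)%N.

Lemma wtD w a b : wt w (a + b)%MM = (wt w a + wt w b)%N.
Proof. by rewrite /wt -big_split; apply: eq_bigr => i _; rewrite mnmDE mulnDr. Qed.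

Lemma wt_setk w a j : w k = 0%N -> wt w (setk k a j) = wt w a.
Proof.
move=> wk; apply: eq_bigr => i _; have [->|ik] := eqVneq i k; first by rewrite wk.
by rewrite setkN.
Qed.

Lemma wpos_k : wpos k = 0%N. Proof. by rewrite /wpos (Bkk d_gt0 skB). Qed.
Lemma wneg_k : wneg k = 0%N. Proof. by rewrite /wneg (Bkk d_gt0 skB). Qed.

Lemma beta_wt a : beta B k a = (wt wpos a)%:Z - (wt wneg a)%:Z.
Proof.
rewrite /wt !(big_morph _ PoszD (erefl 0%:Z)) -sumrB; apply: eq_bigr => i _.
by rewrite !PoszM -mulrBl -pospart_sub.
Qed.

Lemma below_closed w : mclosed (belowk w).
Proof.
split=> [|a b]; first by rewrite /belowk mnm0E.
by rewrite /belowk wtD mnmDE; exact: leq_add.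
Qed.

Lemma qbin_bound (b u : nat) f h a :
  (forall j, sq k f a j = seqc (qbin (Qk d k) b) (sq k h a) j) ->
  (forall j, (j <= a k)%N -> h (setk k a j) != 0 -> (j <= u)%N) ->
  f a != 0 -> (a k <= u + b)%N.
Proof.
move=> e H; apply: contraNT; rewrite -ltnNge => lt; apply/eqP.
have := e (a k); rewrite {1}/sq setk_id => ->; rewrite /seqc big1 // => c _.
have [bc|cb] := ltnP b c; first by rewrite qbin_out ?mul0r.
have -> : sq k h a (a k - c) = 0; last by rewrite mulr0.
apply/eqP; apply: contraTT isT => /(H _ (leq_subr _ _)); lia.
Qed.

(* For beta >= 0, a degree a out of bounds is no sum of smaller degrees of the
   support, so hr g a is the logarithmic term which inc requires to vanish; then
   hl g is obtained from hr g by a Gaussian polynomial of degree beta. *)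
Lemma hr_hl_support g : inc g -> forall a,
  (hr k g a != 0 -> belowk wneg a) /\ (hl k g a != 0 -> belowk wpos a).
Proof.
move=> gi; have [g0 _ _] := gi; elim/deg_ind => a IH.
have [ka|ka] := boolP (on_axis k a).
  have [->|a0] := eqVneq a 0%MM; first by rewrite /belowk mnm0E.
  by rewrite hr_axis ?hl_axis // eqxx.
have [oa|] := boolP (off a); last first.
  rewrite /off negb_forall => /existsP[l]; rewrite negbK => la.
  have kl : k != l by apply: contra ka => /eqP ->.
  by rewrite /belowk ((on_axisP _ _ la) k kl).
have IHr : suppd (deg a) (belowk wneg) (hr k g) by move=> b /IH[].
have IHl : suppd (deg a) (belowk wpos) (hl k g) by move=> b /IH[].
have va : pair (vn B d a) a = 0 by rewrite pair_vn lamaa //; apply: qform_skew.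
have e := hr_hl k g.
have lt_setk j : (j < a k)%N -> (deg (setk k a j) < deg a)%N.
  by have := deg_setk k a j; lia.
have bw := beta_wt a.
have [ba|/ltW ba] := leP 0 (beta B k a).
- have Hr : hr k g a != 0 -> belowk wneg a.
    apply: contraNT => na; have [p [z [m F]]] := fact_exists (vn B d a) (hr0 k g0).
    have zl := inc_incr d_gt0 skB gi oa ba F.
    have [_ sz _] := fact_suppd (below_closed wneg) F IHr.
    rewrite (fact_out (below_closed wneg) na IHr F va).
    by rewrite -(lg_out (below_closed wneg) na (fact_z0 F) sz) zl.
  split=> // la.
  have [b be] : exists b : nat, beta B k a = b%:Z by exists `|beta B k a|%N; lia.
  have := qbin_bound (u := wt wneg a) (theta_conj_pos d_gt0 skB e be) _ la.
  rewrite /belowk; have -> : wt wpos a = (wt wneg a + b)%N by lia.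
  apply=> j; rewrite leq_eqVlt => /orP[/eqP ->|ja]; first by rewrite setk_id => /Hr.
  by move/(IHr _ (lt_setk _ ja)); rewrite /belowk setkk wt_setk ?wneg_k.
have Hl : hl k g a != 0 -> belowk wpos a.
  apply: contraNT => na; have [p [z [m F]]] := fact_exists (vn B d a) (hl0 k g0).
  have zl := inc_incl d_gt0 skB gi oa ba F.
  have [_ sz _] := fact_suppd (below_closed wpos) F IHl.
  rewrite (fact_out (below_closed wpos) na IHl F va).
  by rewrite -(lg_out (below_closed wpos) na (fact_z0 F) sz) zl.
split=> // ra.
have [b be] : exists b : nat, beta B k a = - b%:Z by exists `|beta B k a|%N; lia.
have := qbin_bound (u := wt wpos a) (theta_conj_neg d_gt0 skB e be) _ ra.
rewrite /belowk; have -> : wt wneg a = (wt wpos a + b)%N by lia.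
apply=> j; rewrite leq_eqVlt => /orP[/eqP ->|ja]; first by rewrite setk_id => /Hl.
by move/(IHl _ (lt_setk _ ja)); rewrite /belowk setkk wt_setk ?wpos_k.
Qed.
End Support.

(** * Mutation of the scattering element *)

Lemma seqc_widen q x N j : (forall c, (N <= c)%N -> q c = 0) ->
  seqc q x j = \sum_(c < N) (if (c <= j)%N then q c * x (j - c)%N else 0).
Proof.
move=> q0; pose F c := if (c <= j)%N then q c * x (j - c)%N else 0.
have E M : (N <= M)%N -> \sum_(c < M) F c = \sum_(c < N) F c.
  move=> /subnKC <-; rewrite big_split_ord /= [X in _ + X]big1 ?addr0 // => i _.
  by rewrite /F q0 ?mul0r ?leq_addr //; case: ifP.
rewrite -(E (j.+1 + N)%N (leq_addl _ _)) big_split_ord /= [X in _ = _ + X]big1 ?addr0.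
  by apply: eq_bigr => i _; rewrite /F -ltnS ltn_ord.
by move=> i _; rewrite /F ifF //; lia.
Qed.

(* Reversal of the coefficients, using the symmetry of the Gaussian binomials. *)
Lemma seqc_flip Q (b s : nat) u w : 1 < Q ->
  (forall j, u j = seqc (qbin Q b) w j) ->
  (forall j, (s < j)%N -> w j = 0) ->
  forall j, (if (j <= s + b)%N then u (s + b - j)%N else 0) =
    seqc (qbin Q b) (fun i => if (i <= s)%N then w (s - i)%N else 0) j.
Proof.
move=> Q1 e w0 j.
have qo c : (b.+1 <= c)%N -> qbin Q b c = 0 by apply: qbin_out.
rewrite e !(seqc_widen _ _ qo) (reindex_inj rev_ord_inj) /=.
case: leqP => hj; last first.
  rewrite big1 // => c _; case: ifP => // _; rewrite ifF ?mulr0 //.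
  by have := ltn_ord c; lia.
apply: eq_bigr => c _; have hc := ltn_ord c; rewrite subSS qbin_sym //.
case: leqP => h1; case: leqP => h2 //.
- rewrite ifT; last by lia.
  by congr (_ * w _); lia.
- by rewrite w0 ?mulr0 //; lia.
- by rewrite ifF ?mulr0 //; lia.
Qed.

Lemma pospart_scale (d e x y : int) : 0 < d -> 0 < e -> d * x = e * y ->
  d * (pospart x)%:Z = e * (pospart y)%:Z.
Proof.
move=> d0 e0 h; rewrite /pospart.
have -> : (0 < x) = (0 < y) by rewrite -(pmulr_rgt0 x d0) h pmulr_rgt0.
by case: ifP => hy; rewrite ?mulr0 // !gtz0_abs // -(pmulr_rgt0 _ d0) h pmulr_rgt0.
Qed.

Section Reflect.
Variables (n : nat) (B : 'M[int]_n) (d : 'I_n -> int).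
Hypothesis d_gt0 : forall i, 0 < d i.
Hypothesis skB : forall i j, d i * B i j = - (d j * B j i).
Variable k : 'I_n.
Notation L := (qform B d).
Notation L' := (qform (mutmx k B) d).
Implicit Types (a b : 'X_{1..n}).

(** The mutated form is the old one in the basis e_i + W_i e_k, where W_k = -2 encodes e_k - 2 e_k =
    - e_k. Positive and negative parts of row k serve equally well, which lets h and h' be carried
    into the same ring by different substitutions. *)
Lemma mut_entry_pos i j : L' i j = L i j
  + (if i == k then -2 else (wpos B k i)%:Z) * L k j
  + L i k * (if j == k then -2 else (wpos B k j)%:Z).
Proof.
have Bkk := Bkk d_gt0 skB k.
rewrite !mxE; case: (eqVneq i k) => [->|ik] /=; first by rewrite Bkk; ring.
case: (eqVneq j k) => [->|jk] /=; first by rewrite Bkk; ring.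
have e : d i * (pospart (- B i k))%:Z = d k * (pospart (B k i))%:Z.
  by apply: pospart_scale => //; have := skB i k; lia.
by rewrite mulrDr mulrDr [d i * (_ * B k j)]mulrA e /wpos; ring.
Qed.

Lemma mut_entry_neg i j : L' i j = L i j
  + (if i == k then -2 else (wneg B k i)%:Z) * L k j
  + L i k * (if j == k then -2 else (wneg B k j)%:Z).
Proof.
rewrite mut_entry_pos; case: (eqVneq i k) => [->|ik].
  case: (eqVneq j k) => [//|jk]; by rewrite !mxE (Bkk d_gt0 skB); ring.
case: (eqVneq j k) => [->|jk].
  by rewrite !mxE (Bkk d_gt0 skB); ring.
have := pospart_sub (B k i); have := pospart_sub (B k j).
rewrite /wpos /wneg !mxE.
move: (pospart (B k i))%:Z (pospart (- B k i))%:Z => x x'.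
move: (pospart (B k j))%:Z (pospart (- B k j))%:Z => y y' ej ei.
have s := skB i k.
have -> : x = B k i + x' by rewrite ei; ring.
have -> : y = B k j + y' by rewrite ej; ring.
rewrite !mulrDl !mulrDr s; ring.
Qed.

Variable w : 'I_n -> nat.
Hypothesis wk : w k = 0%N.
Notation W i := (if i == k then -2 else (w i)%:Z).
Hypothesis Lw : forall i j, L' i j = L i j + W i * L k j + L i k * W j.

Notation S := (belowk k w).

(* The change of basis e'_k = - e_k, e'_j = e_j + w_j e_k of the lattice of
   exponents; the truncated subtraction is exact on S. *)
Definition refl a : 'X_{1..n} := setk k a (wt w a - a k).

Lemma wt_refl a : wt w (refl a) = wt w a. Proof. exact: wt_setk. Qed.

Lemma below_refl a : S (refl a).
Proof. by rewrite /belowk wt_refl setkk leq_subr. Qed.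

Lemma reflK a : S a -> refl (refl a) = a.
Proof.
move=> h; rewrite {1}/refl wt_refl /refl setkk setk_setk.
by rewrite subKn // setk_id.
Qed.

Lemma reflD a b : S a -> S b -> refl (a + b)%MM = (refl a + refl b)%MM.
Proof.
rewrite /belowk => ha hb; apply/mnmP => i; rewrite mnmDE.
have [->|ik] := eqVneq i k; last by rewrite !setkN // mnmDE.
rewrite !setkk wtD mnmDE; lia.
Qed.

Lemma refl0 : refl 0%MM = 0%MM.
Proof.
apply/mnmP => i; rewrite mnmE; case: eqP => // _.
by rewrite /wt big1 ?mnm0E // => j _; rewrite mnm0E muln0.
Qed.

Lemma refl_eq0 a : S a -> (refl a == 0%MM) = (a == 0%MM).
Proof. by move=> h; apply/eqP/eqP => [e|->]; rewrite ?refl0 // -(reflK h) e refl0. Qed.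

Lemma refl_coord a i : S a ->
  (refl a i)%:Z = (a i)%:Z + (if i == k then \sum_j W j * (a j)%:Z else 0).
Proof.
move=> h; have [->|ik] := eqVneq i k; last by rewrite setkN // addr0.
rewrite setkk -subzn // /wt (big_morph _ PoszD (erefl 0%:Z)).
rewrite [in LHS](bigD1 k) //= [in RHS](bigD1 k) //= wk mul0n eqxx.
rewrite (eq_bigr (fun j => W j * (a j)%:Z)); first by ring.
by move=> j /negbTE ->; rewrite PoszM.
Qed.

Lemma pair_refl v v' a : S a ->
  (forall i, v' i = if i == k then - v k else v i + (w i)%:Z * v k) ->
  pair v' a = pair v (refl a).
Proof.
move=> h e; rewrite /pair.
rewrite [RHS](eq_bigr (fun i => v i * (a i)%:Z + (if i == k then v i * \sum_j W j * (a j)%:Z else 0))).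
  rewrite big_split /= -big_mkcond big_pred1_eq mulr_sumr -big_split /=.
  apply: eq_bigr => i _; rewrite e; case: eqP => [->|_]; ring.
by move=> i _; rewrite refl_coord // mulrDr; case: eqP; rewrite ?mulr0.
Qed.

Lemma lam_reflect a b : S a -> S b -> lam L' a b = lam L (refl a) (refl b).
Proof.
move=> ha hb; have skL := @qform_skew n B d skB.
pose T c : int := \sum_j W j * (c j)%:Z.
pose La c : int := \sum_j L k j * (c j)%:Z.
have Lar c : La (refl c) = La c.
  apply: eq_bigr => j _; have [->|jk] := eqVneq j k; last by rewrite setkN.
  by rewrite mxE (Bkk d_gt0 skB) mulr0 !mul0r.
have el c : lam L (refl a) c = lam L a c + T a * La c.
  rewrite /lam /La mulr_sumr.
  rewrite (eq_bigr (fun i => (\sum_j (a i)%:Z * L i j * (c j)%:Z) +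
     (if i == k then \sum_j T a * (L i j * (c j)%:Z) else 0))).
    by rewrite big_split /= -big_mkcond big_pred1_eq.
  move=> i _; case: (eqVneq i k) => [ik|ik]; last first.
    by rewrite addr0; apply: eq_bigr => j _; rewrite setkN.
  rewrite -big_split; apply: eq_bigr => j _ /=; rewrite refl_coord // ik eqxx -/(T a); ring.
have -> : lam L (refl a) (refl b) = lam L a b - La a * T b + T a * La b.
  rewrite el Lar; congr (_ + _); rewrite (lamC skL a) (lamC skL a b).
  have -> : lam L (refl b) a = lam L b a + T b * La a; last by ring.
  rewrite /lam /La mulr_sumr.
  rewrite (eq_bigr (fun i => (\sum_j (b i)%:Z * L i j * (a j)%:Z) +
     (if i == k then \sum_j T b * (L i j * (a j)%:Z) else 0))).
    by rewrite big_split /= -big_mkcond big_pred1_eq.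
  move=> i _; case: (eqVneq i k) => [ik|ik]; last first.
    by rewrite addr0; apply: eq_bigr => j _; rewrite setkN.
  rewrite -big_split; apply: eq_bigr => j _ /=; rewrite refl_coord // ik eqxx -/(T b); ring.
have -> : La a = - \sum_i (a i)%:Z * L i k.
  rewrite /La -sumrN; apply: eq_bigr => j _; rewrite (skL j k); ring.
rewrite /T mulNr opprK !mulr_suml /lam -!big_split; apply: eq_bigr => i _ /=.
rewrite /La !mulr_sumr -!big_split; apply: eq_bigr => j _ /=.
rewrite Lw; ring.
Qed.
End Reflect.

Lemma lg_widen n (L : 'M[int]_n) (f : qt L) a N : f 0%MM = 1 -> (deg a <= N)%N ->
  lg f a = \sum_(r < N) (-1) ^+ r / r.+1%:R * ((f - 1) ^+ r.+1) a.
Proof.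
move=> f0 /subnKC <-; rewrite big_split_ord /= [X in _ = _ + X]big1 ?addr0 // => i _.
have v1 : van 1 (f - 1).
  move=> b; rewrite ltnS leqn0 mdeg_eq0 => /eqP ->.
  by rewrite qtB qt1 eqxx f0 subrr.
by rewrite (vanX v1) ?mulr0 // ltnS leq_addr.
Qed.

Section Iota.
Variables (n : nat) (L L' : 'M[int]_n) (k : 'I_n) (w : 'I_n -> nat).
Notation S := (belowk k w).
Notation r := (refl k w).
Hypothesis wk : w k = 0%N.
Hypothesis Hlam : forall a b, S a -> S b -> lam L' a b = lam L (r a) (r b).
Implicit Types (f g h p z m : qt L) (a b : 'X_{1..n}).

Definition iota f : qt L' := fun a => if S a then f (r a) else 0.

Definition ssupp f := forall a, f a != 0 -> S a.

Lemma ssuppP f : ssupp f <-> forall D, suppd D S f.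
Proof. by split=> [h D a _ /h|h a]; last exact: (h (deg a).+1 a (ltnSn _)). Qed.

Lemma iota_supp f a : iota f a != 0 -> S a.
Proof. by rewrite /iota; case: ifP; rewrite ?eqxx. Qed.

Lemma belowk0 : S 0%MM. Proof. by case: (below_closed k w). Qed.
Lemma belowkD a b : S a -> S b -> S (a + b)%MM. Proof. by case: (below_closed k w) => _; apply. Qed.

Lemma refl_sub a b : (b <= a)%MM -> S b -> S (a - b)%MM ->
  (r b <= r a)%MM /\ (r a - r b)%MM = r (a - b)%MM.
Proof.
move=> hb sb sab; have e : r a = (r b + r (a - b))%MM.
  by rewrite -reflD // addm_subK.
by rewrite e lem_addr subm_add.
Qed.

(** On S the reflection is an additive involution and an isometry from [L'] to [L], so it matches
    the decompositions of a inside S with those of its image; the others contribute nothing because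
    of the supports. *)
Lemma iotaM f g : ssupp f -> ssupp g -> iota (f * g) = iota f * iota g.
Proof.
move=> hf hg; apply/qtP => a; have [Sa|Sa] := boolP (S a); last first.
  rewrite /iota (negbTE Sa) qtM_eq0 // => b c bc.
  case: ifP => Sb; last by left.
  case: ifP => Sc; last by right.
  by case/negP: Sa; rewrite -bc belowkD.
rewrite {1}/iota Sa.
pose P c b := S b && S (c - b)%MM.
have E h1 h2 c : ssupp h1 -> ssupp h2 -> (h1 * h2) c = \sum_(b <- mnms c | P c b)
    2 ^ lam L b (c - b)%MM * h1 b * h2 (c - b)%MM.
  move=> s1 s2; rewrite qtM [RHS]big_mkcond; apply: eq_bigr => b _.
  rewrite /P; case: ifP => //; have [->|/s1 ->] := eqVneq (h1 b) 0; first by rewrite mulr0 mul0r.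
  have [->|/s2 -> //] := eqVneq (h2 (c - b)%MM) 0; by rewrite mulr0.
rewrite E // qtM.
transitivity (\sum_(b <- mnms a | P a b) 2 ^ lam L' b (a - b)%MM * iota f b * iota g (a - b)%MM);
  last first.
  rewrite big_mkcond; apply: eq_bigr => b _; rewrite /P /iota.
  by case: (S b); case: (S (a - b)%MM); rewrite /= ?mulr0 ?mul0r.
rewrite -[LHS]big_filter -[RHS]big_filter.
have hp : perm_eq [seq r b | b <- mnms a & P a b] [seq b <- mnms (r a) | P (r a) b].
  apply: uniq_perm.
  - rewrite map_inj_in_uniq ?filter_uniq ?mnms_uniq // => x y.
    rewrite !mem_filter /P => /andP[/andP[sx _] _] /andP[/andP[sy _] _] e.
    by rewrite -(reflK wk sx) e (reflK wk sy).
  - by rewrite filter_uniq ?mnms_uniq.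
  move=> c; rewrite mem_filter mem_mnms; apply/mapP/andP.
    move=> [b]; rewrite mem_filter mem_mnms /P => /andP[/andP[sb sab] hb] ->.
    by have [h1 h2] := refl_sub hb sb sab; rewrite h1 h2 !below_refl.
  move=> [/andP[sc sac] hc]; exists (r c); last by rewrite reflK.
  have [h1 h2] := refl_sub hc sc sac; rewrite reflK // in h1 h2.
  by rewrite mem_filter mem_mnms /P h1 h2 !below_refl.
rewrite -(perm_big _ hp) big_map /=.
apply: eq_big_seq => b; rewrite mem_filter mem_mnms /P => /andP[/andP[sb sab] hb].
have [_ ->] := refl_sub hb sb sab.
by rewrite Hlam // /iota sb sab.
Qed.

Lemma iota1 : iota 1 = 1.
Proof.
apply/qtP => a; rewrite /iota !qt1; have [Sa|Sa] := boolP (S a).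
  by rewrite refl_eq0.
by case: eqP Sa => // ->; rewrite belowk0.
Qed.

Lemma iotaB f g : iota (f - g) = iota f - iota g.
Proof. by apply/qtP => a; rewrite qtB /iota qtB; case: ifP; rewrite ?subrr. Qed.

Lemma ssuppM f g : ssupp f -> ssupp g -> ssupp (f * g).
Proof. by rewrite !ssuppP => hf hg D; apply: suppdM => //; apply: below_closed. Qed.

Lemma ssuppB1 f : ssupp f -> ssupp (f - 1).
Proof. by rewrite !ssuppP => hf D; apply: suppdD => //; apply: suppdN; apply: suppd1; apply: below_closed. Qed.

Lemma ssuppX f i : ssupp f -> ssupp (f ^+ i).
Proof. by rewrite !ssuppP => hf D; apply: suppdX => //; apply: below_closed. Qed.

Lemma iotaX f i : ssupp f -> iota (f ^+ i) = iota f ^+ i.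
Proof.
by move=> hf; elim: i => [|i IH]; rewrite ?expr0 ?iota1 // !exprS iotaM ?IH //; apply: ssuppX.
Qed.

Lemma iota_0 f : iota f 0%MM = f 0%MM.
Proof. by rewrite /iota belowk0 refl0. Qed.

Lemma lg_iota f a : ssupp f -> f 0%MM = 1 -> S a -> lg (iota f) a = lg f (r a).
Proof.
(* The reflection changes the total degree, hence the number of terms of [lg]; both sums are
   extended to a common length. *)
move=> hf f0 Sa; rewrite (@lg_widen _ _ _ _ (deg a + deg (r a))) ?iota_0 ?leq_addr //.
rewrite (@lg_widen _ _ f _ (deg a + deg (r a))) ?leq_addl //.
apply: eq_bigr => i _; congr (_ * _).
have -> : (iota f - 1) ^+ i.+1 = iota ((f - 1) ^+ i.+1).
  by rewrite iotaX ?iotaB ?iota1 //; apply: ssuppB1.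
by rewrite /iota Sa.
Qed.

Lemma fact_ssupp v h p z m : ssupp h -> fact v h p z m ->
  [/\ ssupp p, ssupp z & ssupp m].
Proof.
move=> /ssuppP hh F; have H D := fact_suppd (below_closed k w) F (hh D).
by split; apply/ssuppP => D; case: (H D).
Qed.

Lemma fact_iota v v' h p z m : ssupp h -> fact v h p z m ->
  (forall a, S a -> pair v' a = pair v (r a)) ->
  fact v' (iota h) (iota p) (iota z) (iota m).
Proof.
move=> sh F e; have [sp sz sm] := fact_ssupp sh F.
have nz f a : a != 0%MM -> iota f a != 0 -> [/\ S a, r a != 0%MM & f (r a) != 0].
  move=> a0; rewrite /iota; case: ifP => Sa; last by rewrite eqxx.
  by move=> fa; split; rewrite ?refl_eq0.
split; rewrite ?iota_0 ?(fact_p0 F) ?(fact_z0 F) ?(fact_m0 F) //.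
- by rewrite (fact_eq F) !iotaM //; apply: ssuppM.
- by move=> a a0 /(nz _ _ a0)[Sa ra fa]; rewrite e // (fact_p F).
- by move=> a a0 /(nz _ _ a0)[Sa ra fa]; rewrite e // (fact_z F).
- by move=> a a0 /(nz _ _ a0)[Sa ra fa]; rewrite e // (fact_m F).
Qed.
End Iota.

Section Mutation.
Variables (n : nat) (B : 'M[int]_n) (d : 'I_n -> int).
Hypothesis d_gt0 : forall i, 0 < d i.
Hypothesis skB : forall i j, d i * B i j = - (d j * B j i).
Variable k : 'I_n.
Notation B' := (mutmx k B).
Notation L := (qform B d).
Notation L' := (qform B' d).
Implicit Types (a b : 'X_{1..n}) (w : 'I_n -> nat).

Lemma mutmx_skew i j : d i * B' i j = - (d j * B' j i).
Proof.
have := mut_entry_pos d_gt0 skB k i j; have := mut_entry_pos d_gt0 skB k j i.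
rewrite ![qform _ _ _ _]mxE => -> ->; have := skB i j; have := skB i k; have := skB j k.
move=> -> -> ->; case: eqP => _; case: eqP => _; ring.
Qed.

Lemma beta_mut a : beta B' k a = - beta B k a.
Proof. by rewrite /beta -sumrN; apply: eq_bigr => j _; rewrite mxE eqxx /= mulNr. Qed.

Notation wn := (wneg B k).
Notation wp := (wpos B k).
Let wnk : wn k = 0%N. Proof. exact: (wneg_k d_gt0 skB). Qed.
Let wpk : wp k = 0%N. Proof. exact: (wpos_k d_gt0 skB). Qed.
Let Hn a b := lam_reflect d_gt0 skB wnk (mut_entry_neg d_gt0 skB k) (a := a) (b := b).
Let Hp a b := lam_reflect d_gt0 skB wpk (mut_entry_pos d_gt0 skB k) (a := a) (b := b).

Variable g : qt L.
Hypothesis gi : inc g.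

Let h := hr k g.
Let h' := hl k g.
Let X : qt L' := iota L' k wp h'.
Let Y : qt L' := iota L' k wn h.
Let th' : qt L' := theta B' d k.

Let hS : ssupp k wn h. Proof. by move=> a; case: (hr_hl_support d_gt0 skB k gi a). Qed.
Let h'S : ssupp k wp h'. Proof. by move=> a; case: (hr_hl_support d_gt0 skB k gi a). Qed.

(** [Y] is h in the mutated variables, and [th'] is theta_k (1/y_k), the new y_k being the inverse
    of the old one. *)
Definition mut_inc : qt L' := Y * th'.

(** On each line h and h' differ by a palindromic Gaussian polynomial. Inverting y_k reverses the
    line and preserves this relation, while beta changes sign; hence h and h' trade places. *)
Lemma mut_inc_sym : th' * X = Y * th'.
Proof.
have e := hr_hl k g; apply/(theta_conjP d_gt0 mutmx_skew) => a j.
rewrite beta_mut opprK; have bw := beta_wt B k a.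
have sX : sq k X a = fun i => if (i <= wt wp a)%N then sq k h' a (wt wp a - i)%N else 0.
  apply/funext => i; rewrite /sq /X /iota /belowk setkk wt_setk //.
  by case: ifP => // _; rewrite /refl wt_setk // setkk setk_setk.
have sY : sq k Y a = fun i => if (i <= wt wn a)%N then sq k h a (wt wn a - i)%N else 0.
  apply/funext => i; rewrite /sq /Y /iota /belowk setkk wt_setk //.
  by case: ifP => // _; rewrite /refl wt_setk // setkk setk_setk.
have oh i : (wt wn a < i)%N -> sq k h a i = 0.
  move=> hi; apply/eqP; apply: contraTT hi => /hS.
  by rewrite /belowk setkk wt_setk // leqNgt.
have oh' i : (wt wp a < i)%N -> sq k h' a i = 0.
  move=> hi; apply/eqP; apply: contraTT hi => /h'S.
  by rewrite /belowk setkk wt_setk // leqNgt.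
have [ba|/ltW ba] := leP 0 (beta B k a).
  have [b be] : exists b : nat, beta B k a = b%:Z by exists `|beta B k a|%N; lia.
  have E := seqc_flip (Qk_gt1 d_gt0 k) (theta_conj_pos d_gt0 skB e be) oh.
  rewrite be; apply/esym; move: j.
  apply: (proj1 (th_conv (Qk_gt1 d_gt0 k) b _ _)) => j; rewrite sX sY -E.
  by have -> : wt wp a = (wt wn a + b)%N by lia.
have [b be] : exists b : nat, beta B k a = - b%:Z by exists `|beta B k a|%N; lia.
have E := seqc_flip (Qk_gt1 d_gt0 k) (theta_conj_neg d_gt0 skB e be) oh'.
rewrite be opprK; move: j.
apply: (proj1 (th_conv (Qk_gt1 d_gt0 k) b _ _)) => j; rewrite sX sY -E.
by have -> : wt wn a = (wt wp a + b)%N by lia.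
Qed.

Let g0 : g 0%MM = 1. Proof. by case: gi. Qed.
Let X0 : X 0%MM = 1. Proof. by rewrite /X iota_0 /h' hl0. Qed.
Let Y0 : Y 0%MM = 1. Proof. by rewrite /Y iota_0 /h hr0. Qed.

Lemma theta_mull_axis (C : 'M[int]_n) (f : qt (qform C d)) l i :
  (forall i j, d i * C i j = - (d j * C j i)) -> l != k ->
  (theta C d k * f) (U_(l) *+ i)%MM = f (U_(l) *+ i)%MM.
Proof.
move=> skC lk; rewrite theta_mull // axisE eq_sym (negbTE lk) /seqc big_ord_recl big_ord0.
rewrite /th /= mulr0 expr0z !mul1r addr0 /sq subn0.
have e : (U_(l) *+ i)%MM k = 0%N by rewrite axisE eq_sym (negbTE lk).
by rewrite -[X in setk _ _ X]e setk_id.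
Qed.

Lemma theta_mulr_axis (C : 'M[int]_n) (f : qt (qform C d)) l i :
  (forall i j, d i * C i j = - (d j * C j i)) -> l != k ->
  (f * theta C d k) (U_(l) *+ i)%MM = f (U_(l) *+ i)%MM.
Proof.
move=> skC lk; rewrite theta_mulr // axisE eq_sym (negbTE lk) /seqc big_ord_recl big_ord0.
rewrite /th /= mulr0 expr0z !mul1r addr0 /sq subn0.
have e : (U_(l) *+ i)%MM k = 0%N by rewrite axisE eq_sym (negbTE lk).
by rewrite -[X in setk _ _ X]e setk_id.
Qed.

Lemma belowk_axis w i : w k = 0%N -> belowk k w (U_(k) *+ i)%MM -> i = 0%N.
Proof.
move=> wk; rewrite /belowk axisE eqxx /wt big1; first by lia.
by move=> j _; rewrite axisE; case: eqP => [->|]; rewrite ?wk ?muln0.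
Qed.

Lemma wt_axis w l i : wt w (U_(l) *+ i)%MM = (w l * i)%N.
Proof.
rewrite /wt (bigD1 l) //= axisE eqxx big1 ?addn0 // => j jl.
by rewrite axisE (negbTE jl) muln0.
Qed.

Lemma refl_axis w l i : l != k -> w l = 0%N ->
  belowk k w (U_(l) *+ i)%MM /\ refl k w (U_(l) *+ i)%MM = (U_(l) *+ i)%MM.
Proof.
move=> lk wl; have e : (U_(l) *+ i)%MM k = 0%N by rewrite axisE eq_sym (negbTE lk).
split; first by rewrite /belowk e.
by rewrite /refl wt_axis wl mul0n e -[X in setk _ _ X]e setk_id.
Qed.

(** An exponent off the axes can be reflected onto an axis l only if w_l a_l is nonzero and its k-th
    coordinate becomes 0. When the lemma is applied, the sign of beta rules this out. *)
Lemma off_refl w a : w k = 0%N -> belowk k w a ->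
  (forall l, l != k -> (w l * a l = 0)%N \/ ~ on_axis l (refl k w a)) ->
  off a -> off (refl k w a).
Proof.
move=> wk Sa H oa; apply/forallP => l; apply/negP => la.
have [lk|lk] := eqVneq l k.
  move/forallP/(_ k)/negP: oa; apply; apply/on_axisP => i ik.
  by have := on_axisP _ _ la i; rewrite lk => /(_ ik); rewrite setkN.
case: (H l lk) => // wl; move/forallP/(_ l)/negP: oa; apply.
apply/on_axisP => i il; have [ik|ik] := eqVneq i k; last first.
  by have := on_axisP _ _ la i il; rewrite setkN.
rewrite ik.
suff wa : wt w a = 0%N by move: Sa; rewrite /belowk wa leqn0 => /eqP.
rewrite /wt (bigD1 l) //= wl big1 // => j jl.
have [->|jk] := eqVneq j k; first by rewrite wk.
by have := on_axisP _ _ la j jl; rewrite setkN // => ->; rewrite muln0.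
Qed.

Lemma vn_iota w a b : w k = 0%N ->
  (forall a b, belowk k w a -> belowk k w b -> lam L' a b = lam L (refl k w a) (refl k w b)) ->
  belowk k w a -> belowk k w b ->
  pair (vn B' d a) b = pair (vn B d (refl k w a)) (refl k w b).
Proof. by move=> wk H Sa Sb; rewrite !pair_vn H. Qed.

Lemma mut_inc_inc : inc mut_inc.
Proof.
have gax : forall l r, g (U_(l) *+ r)%MM = dl (Qk d l) r by case: gi.
apply: (@inc_of n B' d d_gt0 mutmx_skew k mut_inc X Y) => //.
- exact: mut_inc_sym.
- by rewrite /mut_inc qtM0 Y0 /th' theta0 mulr1.
- move=> l i; have [->|lk] := eqVneq l k.
    rewrite /mut_inc -[in RHS](mul1r (dl _ _)).
    have -> : (Y * th') (U_(k) *+ i)%MM = (1 * th') (U_(k) *+ i)%MM.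
      apply: qtM_eq => // b hb; rewrite qt1.
      have kb : on_axis k b.
        by have := on_axisU k i; rewrite -{1}(addm_subK hb) on_axisD => /andP[].
      have [->|b0] := eqVneq b 0%MM; first exact: Y0.
      apply/eqP; apply: contraNT b0 => /iota_supp.
      by rewrite (eqP kb) => /(belowk_axis wnk) ->.
    by rewrite mul1r /th' /theta on_axisU axisE eqxx mul1r.
  (* One of the two weights of l is zero, so in one of the two presentations the l-th axis is fixed
     and its coefficients are those of g. *)
  have [bl|bl] := leP 0 (B k l).
    have wl : wn l = 0%N by rewrite /wneg /pospart ifF //; lia.
    rewrite /mut_inc theta_mulr_axis //; last exact: mutmx_skew.
    have [Sl rl] := refl_axis i lk wl.
    rewrite /Y /iota Sl rl -gax [in RHS](hrE k g) theta_mull_axis //.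
  have wl : wp l = 0%N by rewrite /wpos /pospart ifF //; lia.
  rewrite /mut_inc -mut_inc_sym theta_mull_axis //; last exact: mutmx_skew.
  have [Sl rl] := refl_axis i lk wl.
  by rewrite /X /iota Sl rl -gax [in RHS](hlE k g) theta_mulr_axis.
- move=> a oa; rewrite beta_mut oppr_ge0 => ba.
  have [Sa|Sa] := boolP (belowk k wp a); last first.
    have [p [z [m F]]] := fact_exists (vn B' d a) X0.
    exists p, z, m; split => //.
    apply: (lg_supp (below_closed k wp) Sa).
    have Xs : ssupp k wp X by move=> b; apply: iota_supp.
    by case: (fact_ssupp Xs F) => _ /ssuppP zs _.
  have [p [z [m F]]] := fact_exists (vn B d (refl k wp a)) (hl0 k g0).
  exists (iota L' k wp p), (iota L' k wp z), (iota L' k wp m); split.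
    by apply: (fact_iota wpk Hp h'S F) => b Sb; apply: vn_iota.
  have [_ zs _] := fact_ssupp h'S F.
  rewrite lg_iota ?(fact_z0 F) //; apply: (inc_incl d_gt0 skB gi _ _ F).
    apply: off_refl => // l lk; have [->|al] := eqVneq (a l) 0%N; first by left; rewrite muln0.
    have [bl|bl] := leP (B k l) 0; first by left; rewrite /wpos /pospart ifF //; lia.
    right=> la; move: ba; rewrite -(beta_setk d_gt0 skB k a (wt wp a - a k)) -/(refl k wp a).
    rewrite (eqP la) /beta (bigD1 l) //= big1 => [|j jl]; last by rewrite axisE (negbTE jl) mulr0.
    by rewrite axisE eqxx setkN //; nia.
  by rewrite /refl (beta_setk d_gt0 skB).
move=> a oa; rewrite beta_mut oppr_le0 => ba.
have [Sa|Sa] := boolP (belowk k wn a); last first.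
  have [p [z [m F]]] := fact_exists (vn B' d a) Y0.
  exists p, z, m; split => //.
  apply: (lg_supp (below_closed k wn) Sa).
  have Ys : ssupp k wn Y by move=> b; apply: iota_supp.
  by case: (fact_ssupp Ys F) => _ /ssuppP zs _.
have [p [z [m F]]] := fact_exists (vn B d (refl k wn a)) (hr0 k g0).
exists (iota L' k wn p), (iota L' k wn z), (iota L' k wn m); split.
  by apply: (fact_iota wnk Hn hS F) => b Sb; apply: vn_iota.
have [_ zs _] := fact_ssupp hS F.
rewrite lg_iota ?(fact_z0 F) //; apply: (inc_incr d_gt0 skB gi _ _ F).
  apply: off_refl => // l lk; have [->|al] := eqVneq (a l) 0%N; first by left; rewrite muln0.
  have [bl|bl] := leP 0 (B k l); first by left; rewrite /wneg /pospart ifF //; lia.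
  right=> la; move: ba; rewrite -(beta_setk d_gt0 skB k a (wt wn a - a k)) -/(refl k wn a).
  rewrite (eqP la) /beta (bigD1 l) //= big1 => [|j jl]; last by rewrite axisE (negbTE jl) mulr0.
  by rewrite axisE eqxx setkN //; nia.
by rewrite /refl (beta_setk d_gt0 skB).
Qed.

(* The change of g-vectors under mutation of the initial seed at k, in the
   coordinates v_i = d_i g_i. *)
Definition vmut (v : 'I_n -> int) : 'I_n -> int := fun i =>
  if i == k then - v k
  else v i + (if 0 < v k then wn i else wp i)%:Z * v k.

Definition vflip (v : 'I_n -> int) a := if 0 < v k then refl k wn a else refl k wp a.
Definition vbelow (v : 'I_n -> int) a := if 0 < v k then belowk k wn a else belowk k wp a.

(** For v_k > 0, theta_k is absorbed by the positive part, so the wall function at v is that of h.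
    Its image is the wall function at [vmut v], where the new dilogarithm is absorbed on the
    negative side. For v_k < 0, h' takes the place of h. *)
Lemma mut_fact (v : 'I_n -> int) (p z m : qt L) : v k != 0 -> fact v g p z m ->
  (forall a, z a != 0 -> vbelow v a) /\
  (exists p' z' m' : qt L', fact (vmut v) mut_inc p' z' m' /\
    (forall a, vbelow v a -> z' (vflip v a) = z a) /\
    (forall a, z' a != 0 -> vbelow v a)).
Proof.
move=> vk F; rewrite /vbelow /vflip /vmut; case: ltrgtP vk => // vk _.
- have [p1 [z1 [m1 F1]]] := fact_exists v (hr0 k g0).
  have F2 := fact_mul_theta vk F1; rewrite -hrE in F2.
  have [_ -> _] := fact_uniq F F2; have [_ zs _] := fact_ssupp hS F1.
  split => //.
  pose v' : 'I_n -> int := fun i => if i == k then - v k else v i + (wn i)%:Z * v k.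
  have F3 : fact v' Y (iota L' k wn p1) (iota L' k wn z1) (iota L' k wn m1).
    apply: (fact_iota wnk Hn hS F1) => a Sa; exact: pair_refl.
  have v'k : v' k < 0 by rewrite /v' eqxx oppr_lt0.
  exists (iota L' k wn p1), (iota L' k wn z1), (iota L' k wn m1 * th'); split.
    exact: fact_theta_mul.
  by split=> [a Sa|a]; [rewrite /iota below_refl // reflK | apply: iota_supp].
- have [p1 [z1 [m1 F1]]] := fact_exists v (hl0 k g0).
  have F2 := fact_theta_mul vk F1; rewrite -hlE in F2.
  have [_ -> _] := fact_uniq F F2; have [_ zs _] := fact_ssupp h'S F1.
  split => //.
  pose v' : 'I_n -> int := fun i => if i == k then - v k else v i + (wp i)%:Z * v k.
  have F3 : fact v' X (iota L' k wp p1) (iota L' k wp z1) (iota L' k wp m1).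
    apply: (fact_iota wpk Hp h'S F1) => a Sa; exact: pair_refl.
  have v'k : 0 < v' k by rewrite /v' eqxx oppr_gt0.
  exists (th' * iota L' k wp p1), (iota L' k wp z1), (iota L' k wp m1); split.
    by rewrite /mut_inc -mut_inc_sym; apply: fact_mul_theta.
  by split=> [a Sa|a]; [rewrite /iota below_refl // reflK | apply: iota_supp].
Qed.
End Mutation.

(** * Sign-coherence *)

Section Pattern.
Variable n : nat.
Implicit Types (B T C G : 'M[int]_n) (k l i j : 'I_n) (ks : seq 'I_n).

(* Mutation at k of the matrix of degrees: the degree of y_l is minus the l-th
   column of the initial exchange matrix B. *)
Definition mutg B k T C G : 'M[int]_n :=
  \matrix_(i, j) if j == k then
      - G i k + \sum_l G i l * (pospart (T l k))%:Z - \sum_l B i l * (pospart (C l k))%:Z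
    else G i j.

Definition cmat B ks : 'M[int]_n := sbot (seed_at B ks).

Definition gstate B ks : seed n * 'M[int]_n :=
  foldl (fun s k => (mutseed k s.1, mutg B k (stop s.1) (sbot s.1) s.2))
    (init_seed B, 1%:M) ks.

Definition gmat B ks : 'M[int]_n := (gstate B ks).2.

Lemma gstate_seed B ks : (gstate B ks).1 = seed_at B ks.
Proof.
rewrite /gstate /seed_at; elim/last_ind: ks => // ks k IH.
by rewrite !foldl_rcons /= IH.
Qed.

Lemma stop_seed B ks : stop (seed_at B ks) = mutseq B ks.
Proof.
rewrite /seed_at /mutseq; elim/last_ind: ks => // ks k IH.
by rewrite !foldl_rcons /= IH.
Qed.

Lemma mutseq_rcons B ks k : mutseq B (rcons ks k) = mutmx k (mutseq B ks).
Proof. by rewrite /mutseq foldl_rcons. Qed.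

Lemma cmat_rcons B ks k : cmat B (rcons ks k) = mutbot k (mutseq B ks) (cmat B ks).
Proof. by rewrite /cmat /seed_at foldl_rcons /= -/(seed_at B ks) stop_seed. Qed.

Lemma gmat_rcons B ks k :
  gmat B (rcons ks k) = mutg B k (mutseq B ks) (cmat B ks) (gmat B ks).
Proof.
by rewrite /gmat /gstate foldl_rcons /= -/(gstate B ks) gstate_seed stop_seed.
Qed.

(** * One mutation as multiplication by involutions *)

Section Step.
Variables (d : 'I_n -> int) (k : 'I_n) (T C G B : 'M[int]_n) (eps : bool).
Hypothesis d_gt0 : forall i, 0 < d i.
Hypothesis skT : forall i j, d i * T i j = - (d j * T j i).

Definition sgnb (x : int) : int := if eps then x else - x.
Definition ecol i : int := (pospart (sgnb (- T i k)))%:Z.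
Definition frow j : int := (pospart (sgnb (T k j)))%:Z.

(** With [fmx], the signed involutions E and F of Berenstein, Fomin and Zelevinsky: mu_k T = E T F
    for either sign, and if the sign is that of column k of C and G T = B C, then G becomes G E and
    C becomes C F. *)
Definition emx : 'M[int]_n :=
  \matrix_(i, j) ((i == j)%:Z + (j == k)%:Z * (ecol i - 2 * (i == k)%:Z)).
Definition fmx : 'M[int]_n :=
  \matrix_(i, j) ((i == j)%:Z + (i == k)%:Z * (frow j - 2 * (j == k)%:Z)).

Let Tkk : T k k = 0. Proof. exact: (Bkk d_gt0 skT). Qed.

Lemma ecol_k : ecol k = 0. Proof. by rewrite /ecol /sgnb Tkk oppr0; case: eps. Qed.
Lemma frow_k : frow k = 0. Proof. by rewrite /frow /sgnb Tkk; case: eps. Qed.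

Lemma ecol_frow i : d i * ecol i = d k * frow i.
Proof.
by apply: pospart_scale => //; rewrite /sgnb; have := skT i k; case: eps; lia.
Qed.

Lemma sum_delta (F : 'I_n -> int) j : \sum_i F i * (i == j)%:Z = F j.
Proof.
rewrite (bigD1 j) //= eqxx mulr1 big1 ?addr0 // => i /negbTE ->; exact: mulr0.
Qed.

Lemma mul_emx (M : 'M[int]_n) i j : (M *m emx) i j =
  M i j + (j == k)%:Z * (\sum_l M i l * ecol l - 2 * M i k).
Proof.
rewrite mxE (eq_bigr (fun l => M i l * (l == j)%:Z + (j == k)%:Z * (M i l * ecol l)
   - (j == k)%:Z * 2 * (M i l * (l == k)%:Z))); last by move=> l _; rewrite mxE; ring.
rewrite sumrB big_split /= sum_delta -!mulr_sumr sum_delta; ring.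
Qed.

Lemma mul_fmx (M : 'M[int]_n) i j : (M *m fmx) i j =
  M i j + M i k * (frow j - 2 * (j == k)%:Z).
Proof.
rewrite mxE (eq_bigr (fun l => M i l * (l == j)%:Z +
   (M i l * (frow j - 2 * (j == k)%:Z)) * (l == k)%:Z)); last by move=> l _; rewrite mxE; ring.
by rewrite big_split /= sum_delta sum_delta.
Qed.

Lemma emx_inv : emx *m emx = 1%:M.
Proof.
apply/matrixP => i j; rewrite mul_emx mxE.
have -> : \sum_l emx i l * ecol l = ecol i.
  rewrite (eq_bigr (fun l => ecol l * (l == i)%:Z + (ecol i - 2 * (i == k)%:Z) * ecol l * (l == k)%:Z)).
    by rewrite big_split /= !sum_delta ecol_k mulr0 addr0.
  by move=> l _; rewrite !mxE [l == i]eq_sym; ring.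
rewrite !mxE eqxx; case: (eqVneq j k) => [->|_]; last by rewrite !mul0r !addr0; case: eqP.
by case: (eqVneq i k) => [->|_]; rewrite ?ecol_k /=; ring.
Qed.

Lemma fmx_inv : fmx *m fmx = 1%:M.
Proof.
apply/matrixP => i j; rewrite mul_fmx !mxE eqxx frow_k.
case: (eqVneq i k) => [->|ik]; case: (eqVneq j k) => [->|jk]; rewrite ?eqxx ?frow_k /=; try ring.
Qed.

Lemma mutmx_emx : mutmx k T = emx *m T *m fmx.
Proof.
apply/matrixP => i j; rewrite mul_fmx.
have E l : (emx *m T) i l = T i l + (ecol i - 2 * (i == k)%:Z) * T k l.
  rewrite mxE (eq_bigr (fun m => T m l * (m == i)%:Z + (ecol i - 2 * (i == k)%:Z) * T m l * (m == k)%:Z)).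
    by rewrite big_split /= !sum_delta.
  by move=> m _; rewrite mxE [m == i]eq_sym; ring.
rewrite !E !mxE Tkk; case: (eqVneq i k) => [->|ik] /=.
  by rewrite ecol_k Tkk; ring.
case: (eqVneq j k) => [->|jk] /=; first by rewrite frow_k Tkk; ring.
rewrite /ecol /frow /sgnb; case: eps; first by ring.
rewrite opprK; have := pospart_sub (T k j); have := pospart_sub (T i k).
move: (pospart (T k j))%:Z (pospart (- T k j))%:Z (pospart (T i k))%:Z (pospart (- T i k))%:Z.
by move=> a a' b b' -> ->; ring.
Qed.

Definition coh : Prop := forall l, 0 <= sgnb (C l k).

Lemma mutbot_fmx : coh -> mutbot k T C = C *m fmx.
Proof.
move=> cC; apply/matrixP => i j; rewrite mul_fmx !mxE.
case: (eqVneq j k) => [->|jk] /=; first by rewrite frow_k; ring.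
have := cC i; rewrite /frow /sgnb; case: eps => h.
  have -> : pospart (- C i k) = 0%N by rewrite /pospart ifF //; lia.
  by ring.
have e : (pospart (- C i k))%:Z = - C i k by rewrite /pospart; case: ifP; lia.
rewrite e; have := pospart_sub (T k j).
by move: (pospart _)%:Z (pospart _)%:Z => a a' ->; ring.
Qed.

Lemma mutg_emx : coh -> (forall i, \sum_l G i l * T l k = \sum_l B i l * C l k) ->
  mutg B k T C G = G *m emx.
Proof.
move=> cC e; apply/matrixP => i j; rewrite mul_emx !mxE.
case: (eqVneq j k) => [->|jk] /=; last by rewrite mul0r addr0.
rewrite mul1r; have := cC; rewrite /coh /ecol /sgnb; case: eps => h.
  rewrite [X in _ + _ - X](eq_bigr (fun l => B i l * C l k)); last first.
    move=> l _; have -> // : (pospart (C l k))%:Z = C l k.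
    by rewrite /pospart; have /= := h l; case: ifP; lia.
  rewrite -e -addrA -sumrB (eq_bigr (fun l => G i l * (pospart (- T l k))%:Z)); first by ring.
  move=> l _; have := pospart_sub (T l k).
  by move: (pospart _)%:Z (pospart _)%:Z => a a' ->; ring.
rewrite [X in _ - X]big1 ?subr0; last first.
  by move=> l _; rewrite /pospart ifF ?mulr0 //; have /= := h l; lia.
rewrite [in RHS](eq_bigr (fun l => G i l * (pospart (T l k))%:Z)); first by ring.
by move=> l _; rewrite opprK.
Qed.

Definition dmx : 'M[int]_n := diag_mx (\row_i d i).

Lemma dmxE i j : dmx i j = d i * (i == j)%:Z.
Proof. by rewrite !mxE; case: eqP => [->|]; rewrite ?mulr1n ?mulr0n ?mulr1 ?mulr0. Qed.

Lemma fmx_dual : fmx^T *m dmx *m emx = dmx.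
Proof.
have D (M : 'M[int]_n) i j : (M *m dmx) i j = M i j * d j.
  rewrite mxE (eq_bigr (fun l => M i l * d l * (l == j)%:Z)) ?sum_delta //.
  by move=> l _; rewrite dmxE mulrA.
apply/matrixP => i j; rewrite mul_emx D.
have -> : \sum_l (fmx^T *m dmx) i l * ecol l = d i * ecol i.
  rewrite (eq_bigr (fun l => (d l * ecol l) * (l == i)%:Z
     + (frow i - 2 * (i == k)%:Z) * d l * ecol l * (l == k)%:Z)).
    by rewrite big_split /= !sum_delta ecol_k mulr0 addr0.
  by move=> l _; rewrite D !mxE [l == i]eq_sym; ring.
rewrite D ecol_frow dmxE !mxE.
case: (eqVneq j k) => [->|jk]; last first.
  case: (eqVneq i j) => [->|ij]; first by rewrite (negbTE jk) /=; ring.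
  by rewrite /= ; ring.
case: (eqVneq i k) => [->|ik]; rewrite ?eqxx ?frow_k /=; first by ring.
ring.
Qed.
End Step.

Section Good.
Variable d : 'I_n -> int.
Hypothesis d_gt0 : forall i, 0 < d i.
Notation D := (dmx d).
Notation skew B := (forall i j, d i * B i j = - (d j * B j i)).

(* The tropical dualities of Nakanishi and Zelevinsky. *)
Definition dual B T C G :=
  [/\ C^T *m D *m G = D, G *m T = B *m C, G \in unitmx & C \in unitmx].

Lemma dual_step B T C G k eps : skew T -> coh k C eps -> dual B T C G ->
  dual B (mutmx k T) (mutbot k T C) (mutg B k T C G).
Proof.
move=> skT cC [h1 h2 h3 h4].
have h2' i : \sum_l G i l * T l k = \sum_l B i l * C l k.
  by have := congr1 (fun M : 'M_n => M i k) h2; rewrite !mxE.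
rewrite (mutg_emx d_gt0 skT cC h2') (mutbot_fmx d_gt0 skT cC) (mutmx_emx k eps d_gt0 skT).
set E := emx _ _ _; set F := fmx _ _ _.
have EE : E *m E = 1%:M by exact: (emx_inv k eps d_gt0 skT).
have FF : F *m F = 1%:M by exact: (fmx_inv k eps d_gt0 skT).
split.
- rewrite trmx_mul -!mulmxA (mulmxA D) (mulmxA C^T) (mulmxA C^T) h1 mulmxA.
  exact: fmx_dual.
- by rewrite -!mulmxA (mulmxA E) EE mul1mx mulmxA h2 -mulmxA.
- by rewrite unitmx_mul h3 /=; case/mulmx1_unit: EE.
- by rewrite unitmx_mul h4 /=; case/mulmx1_unit: FF.
Qed.

Lemma dual_init B : dual B B 1%:M 1%:M.
Proof. by split; rewrite ?trmx1 ?mul1mx ?mulmx1 ?unitmx1. Qed.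
End Good.
End Pattern.

(* The change of g-vectors under mutation of the initial seed at k (Fomin and
   Zelevinsky's Conjecture 7.12); b is the k-th column of the exchange matrix. *)
Definition tmap (R : realDomainType) n (b : 'I_n -> int) (k : 'I_n) (v : 'I_n -> R) : 'I_n -> R :=
  fun i => if i == k then - v k
    else v i + (pospart (if 0 <= v k then b i else - b i))%:R * v k.

Lemma tmap_lin (R : realDomainType) n (b : 'I_n -> int) (k : 'I_n) (v : 'I_n -> R) (s : bool) i :
  (if s then 0 <= v k else v k <= 0) ->
  tmap b k v i = if i == k then - v k
    else v i + (pospart (if s then b i else - b i))%:R * v k.
Proof.
rewrite /tmap; case: eqP => // _; case: s => [->//|h].
case: ifP => // h'; have -> : v k = 0 by apply: le_anti; rewrite h h'.
by rewrite !mulr0.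
Qed.

(** * Chambers, walls and signs of rows *)

Section Coherence.
Variables (n : nat) (d : 'I_n -> int).
Hypothesis d_gt0 : forall i, 0 < d i.
Notation D := (dmx d).
Notation skew B := (forall i j, d i * B i j = - (d j * B j i)).
Implicit Types (B T C G : 'M[int]_n) (k l i j : 'I_n) (ks : seq 'I_n) (c : 'I_n -> int).

(** All of the hyperplane v_k = 0 is a wall: y_k has degree one, so its nonzero coefficient in g
    passes unchanged to the only factor that may contain it. *)
Lemma fact_unit B (g p z m : qt (qform B d)) v k :
  inc g -> fact v g p z m -> v k = 0 -> z U_(k)%MM != 0.
Proof.
move=> [_ gax _] F vk.
have F1 : fact v (1 : qt (qform B d)) 1 1 1.
  by split; rewrite ?qt1 ?eqxx ?mulr1 // => a /negbTE a0; rewrite qt1 a0 eqxx.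
have U0 : U_(k)%MM != 0%MM :> 'X_{1..n} by rewrite mnm1_eq0.
have := fact_top F F1 _ U0; rewrite pairU vk !qt1 (negbTE U0) !subr0 => -> //.
  have := gax k 1%N; rewrite mulm1n => ->.
  rewrite /= mulr1 mulf_neq0 ?invr_neq0 ?Qpow_neq1 ?Qk_gt1 //.
  by rewrite gt_eqF // (lt_trans ltr01) ?Qk_gt1.
move=> b; rewrite mdeg1 ltnS leqn0 mdeg_eq0 => /eqP ->.
by rewrite qt1 eqxx; have := fact_eq F; move/(congr1 (fun f : qt _ => f 0%MM));
  rewrite !qtM0 (fact_p0 F) (fact_z0 F) (fact_m0 F) !mulr1.
Qed.

Definition dcomb G c : 'I_n -> int := fun i => d i * \sum_j c j * G i j.

(* The open cone spanned by the columns of D G is a chamber of the scattering diagram. *)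
Definition chamber B G := forall g : qt (qform B d), inc g -> forall c, (forall j, 0 < c j) ->
  forall p z m, fact (dcomb G c) g p z m -> z = 1.

(* Each facet of this cone lies on a wall, orthogonal to a nonnegative vector. *)
Definition wall B G := forall g : qt (qform B d), inc g -> forall k, exists a : 'X_{1..n},
  [/\ a != 0%MM, forall j, j != k -> pair (fun i => d i * G i j) a = 0 &
  forall p z m, fact (dcomb G (fun j => (j != k)%:Z)) g p z m -> z a != 0].

(** Entries of both signs in row r would place a point of the open cone on v_r = 0, which is a
    wall. *)
Lemma chamber_rowcoh B G r : skew B -> chamber B G ->
  exists s : bool, forall j, if s then 0 <= G r j else G r j <= 0.
Proof.
move=> skB ch; have [h|] := boolP [forall j, 0 <= G r j].
  by exists true => j; apply: (forallP h).
rewrite negb_forall => /existsP[j2]; rewrite -ltNge => g2.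
have [h|] := boolP [forall j, G r j <= 0]; first by exists false => j; apply: (forallP h).
rewrite negb_forall => /existsP[j1]; rewrite -ltNge => g1.
have j12 : j1 != j2 by apply: contraTneq g1 => ->; rewrite -leNgt ltW.
pose s := \sum_(j | (j != j1) && (j != j2)) G r j.
(* Positive weights annihilating row r: the columns other than j1 and j2 contribute G_rj1 s, the
   term - s cancels this, and the multiple |s| + 1 keeps the weight of j1 positive. *)
pose c j := if j == j1 then - G r j2 * (`|s| + 1) - s
            else if j == j2 then G r j1 * (`|s| + 1) else G r j1.
have c0 j : 0 < c j.
  rewrite /c; case: eqP => _; first by nia.
  by case: eqP => _ //; nia.
have [g gi] := inc_exists skB.
have g0 : g 0%MM = 1 by case: gi.
have [p [z [m F]]] := fact_exists (dcomb G c) g0.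
have z1 := ch g gi c c0 p z m F.
have : z U_(r)%MM != 0.
  apply: (fact_unit gi F); rewrite /dcomb (bigD1 j1) //= (bigD1 j2) 1?eq_sym //=.
  rewrite (eq_bigr (fun j => G r j1 * G r j)); last first.
    by move=> j /andP[/negbTE h1 /negbTE h2]; rewrite /c h1 h2.
  by rewrite -mulr_sumr -/s /c !eqxx eq_sym (negbTE j12); ring.
by rewrite z1 qt1 mnm1_eq0 eqxx.
Qed.

Lemma dmx_mul (M : 'M[int]_n) i j : (M *m D) i j = M i j * d j.
Proof. by rewrite mul_mx_diag !mxE. Qed.

Lemma dual_ker B T C G (x : 'I_n -> int) : dual d B T C G ->
  (forall j, \sum_i x i * d i * G i j = 0) -> forall i, x i = 0.
Proof.
move=> [_ _ uG _] H i.
have e : (\row_i (x i * d i)) *m G = 0.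
  by apply/rowP => j; rewrite !mxE -[RHS](H j); apply: eq_bigr => l _; rewrite mxE.
have := congr1 (fun M => (M *m invmx G) 0 i) e; rewrite mulmxK // mul0mx !mxE.
by have := d_gt0 i; nia.
Qed.

Lemma dual_pair B T C G i j : dual d B T C G ->
  \sum_l C l i * d l * G l j = d i * (i == j)%:Z.
Proof.
move=> [h _ _ _]; rewrite -(dmxE d) -h mxE; apply: eq_bigr => l _.
by rewrite dmx_mul mxE.
Qed.

(** The normal a of facet k and column k of C are both orthogonal to the other columns of D G, hence
    proportional; and a is nonnegative. *)
Lemma wall_coh B T C G k : skew B -> dual d B T C G -> wall B G ->
  exists eps, coh k C eps.
Proof.
move=> skB du wa; have [g gi] := inc_exists skB.
have [a [a0 ao _]] := wa g gi k.
pose t := pair (fun i => d i * G i k) a.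
have E i : d k * (a i)%:Z = t * C i k.
  suff : d k * (a i)%:Z - t * C i k = 0 by move/eqP; rewrite subr_eq0 => /eqP.
  move: i; apply: (dual_ker du) => j.
  rewrite (eq_bigr (fun i => d k * ((d i * G i j) * (a i)%:Z) - t * (C i k * d i * G i j))).
    2: by move=> i _; ring.
  rewrite sumrB -!mulr_sumr (dual_pair _ _ du) -/(pair (fun i => d i * G i j) a).
  case: (eqVneq k j) => [<-|kj] /=; first by rewrite -/t; ring.
  by rewrite ao 1?eq_sym // !mulr0 subrr.
have [t0|t0] := leP 0 t.
  exists true => i; rewrite /sgnb; have := E i; have := d_gt0 k.
  have [tz|tz] := eqVneq t 0; last by nia.
  move=> dk; have : a = 0%MM; last by move/eqP; rewrite (negbTE a0).
  by apply/mnmP => l; rewrite mnm0E; have := E l; rewrite tz; nia.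
by exists false => i; rewrite /sgnb; have := E i; have := d_gt0 k; nia.
Qed.

Lemma chamber_init B : chamber B 1%:M.
Proof.
move=> g gi c c0 p z m F; apply/qtP => a; rewrite qt1.
have [->|a0] := eqVneq a 0%MM; first exact: (fact_z0 F).
apply: (fact_zE F a0); rewrite gt_eqF // lt_neqAle eq_sym.
have v0 i : 0 < dcomb 1%:M c i.
  rewrite /dcomb mulr_gt0 // (bigD1 i) //= mxE eqxx mulr1 big1 ?addr0 // => j ji.
  by rewrite mxE eq_sym (negbTE ji) mulr0.
apply/andP; split; last by apply: sumr_ge0 => i _; apply: mulr_ge0 => //; apply: ltW.
apply: contra a0; rewrite psumr_eq0 => [/allP h|i _]; last by apply: mulr_ge0 => //; apply: ltW.
apply/eqP/mnmP => i; rewrite mnm0E; have /= := h i (mem_index_enum i).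
by rewrite mulf_eq0 gt_eqF //= => /eqP; lia.
Qed.

Lemma wall_init B : wall B 1%:M.
Proof.
move=> g gi k; exists U_(k)%MM; split; first by rewrite mnm1_eq0.
  by move=> j jk; rewrite pairU mxE eq_sym (negbTE jk) mulr0.
move=> p z m F; apply: (fact_unit gi F); rewrite /dcomb big1 ?mulr0 // => j _.
by rewrite mxE eq_sym; case: eqP.
Qed.

Section Shear.
Variables (B G0 G1 : 'M[int]_n) (k : 'I_n) (s : bool).
Hypothesis skB : skew B.
Notation B1 := (mutmx k B).
Hypothesis G1s : forall j, if s then 0 <= G1 k j else G1 k j <= 0.
Hypothesis G01 : forall i j, G0 i j = tmap (fun i => B1 i k) k (fun i => G1 i j) i.

(** Row k of [G0] is minus that of [G1], so if [s] holds, v_k <= 0 on the cone of [G0], where [vmut]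
    uses [wpos]. *)
Let w := if s then wpos B k else wneg B k.

Lemma G0E i j : G0 i j = if i == k then - G1 k j
  else G1 i j + (pospart (if s then B1 i k else - B1 i k))%:R * G1 k j.
Proof.
by rewrite G01 (@tmap_lin _ n (fun i => B1 i k) k (fun i => G1 i j) s i (G1s j)).
Qed.

Lemma shear_coord i j : d i * G1 i j =
  if i == k then - (d k * G0 k j) else d i * G0 i j + (w i)%:Z * (d k * G0 k j).
Proof.
rewrite !G0E eqxx.
case: (eqVneq i k) => [->|ik]; first by rewrite mulrN opprK.
rewrite mxE eqxx orbT natz /w /wpos /wneg.
have e : d i * (pospart (if s then - B i k else B i k))%:Z =
   d k * (pospart (if s then B k i else - B k i))%:Z.
  by apply: pospart_scale => //; have := skB i k; case: s => /=; lia.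
case: s e => e; rewrite ?opprK mulrDr mulrA e //; ring.
Qed.

Lemma shear_comb c i : dcomb G1 c i =
  if i == k then - dcomb G0 c k else dcomb G0 c i + (w i)%:Z * dcomb G0 c k.
Proof.
rewrite /dcomb !mulr_sumr; case: (eqVneq i k) => [->|ik].
  rewrite -sumrN; apply: eq_bigr => j _.
  by rewrite mulrCA shear_coord eqxx; ring.
rewrite -big_split /=; apply: eq_bigr => j _.
by rewrite mulrCA shear_coord (negbTE ik); ring.
Qed.

Lemma comb_sign c : (forall j, 0 <= c j) ->
  if s then dcomb G0 c k <= 0 else 0 <= dcomb G0 c k.
Proof.
move=> c0; have := shear_comb c k; rewrite eqxx => e.
have : if s then 0 <= dcomb G1 c k else dcomb G1 c k <= 0.
  rewrite /dcomb; have dk := d_gt0 k; case: s G1s => H.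
    apply: mulr_ge0; first exact: ltW.
    by apply: sumr_ge0 => j _; apply: mulr_ge0.
  rewrite pmulr_rle0 //; apply: sumr_le0 => j _; exact: mulr_ge0_le0.
by rewrite e; case: s; rewrite ?oppr_ge0 ?oppr_le0.
Qed.

Lemma vmut_comb c : (forall j, 0 <= c j) -> dcomb G0 c k != 0 ->
  vmut B k (dcomb G0 c) = dcomb G1 c.
Proof.
move=> c0 v0; apply/funext => i; rewrite shear_comb /vmut.
have := comb_sign c0; rewrite /w; case: eqP => // _.
case: s => h; first by rewrite ifF // ltNge h.
by rewrite ifT // lt_neqAle eq_sym v0 h.
Qed.

Lemma chamber_shear : G1 \in unitmx -> chamber B1 G1 -> chamber B G0.
Proof.
move=> uG ch g gi c c0 p z m F.
have c0' j : 0 <= c j by apply: ltW.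
have vk : dcomb G0 c k != 0.
  have := shear_comb c k; rewrite eqxx => e; rewrite -oppr_eq0 -e.
  apply: mulf_neq0; first by rewrite gt_eqF.
  apply/eqP => S0.
  have z0 j : G1 k j = 0.
    case: s G1s => H.
      have /allP/(_ j (mem_index_enum _))/= : all (fun j => c j * G1 k j == 0) (index_enum 'I_n).
        have := psumr_eq0 (P := xpredT) (index_enum 'I_n) (F := fun j => c j * G1 k j).
        rewrite S0 eqxx => <- // i _; exact: mulr_ge0.
      by rewrite mulf_eq0 gt_eqF //= => /eqP.
    have /allP/(_ j (mem_index_enum _))/= : all (fun j => - (c j * G1 k j) == 0) (index_enum 'I_n).
      have := psumr_eq0 (P := xpredT) (index_enum 'I_n) (F := fun j => - (c j * G1 k j)).
      rewrite sumrN S0 oppr0 eqxx => <- // i _; rewrite oppr_ge0; exact: mulr_ge0_le0.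
    by rewrite oppr_eq0 mulf_eq0 gt_eqF //= => /eqP.
  have := congr1 (fun M : 'M_n => M k k) (mulmxV uG); rewrite !mxE eqxx big1 // => j _.
  by rewrite z0 mul0r.
have [zb [p' [z' [m' [F' [zz' z's]]]]]] := mut_fact d_gt0 skB gi vk F.
rewrite vmut_comb // in F'.
have e := ch _ (mut_inc_inc d_gt0 skB k gi) c c0 _ _ _ F'.
apply/qtP => a; rewrite qt1; have [->|a0] := eqVneq a 0%MM; first exact: (fact_z0 F).
apply/eqP; apply: contraNT a0 => za.
have ba := zb a za; have := zz' a ba; rewrite e qt1.
case: eqP => [e0 _|_ /esym/eqP]; last by rewrite (negbTE za).
move: e0 ba; rewrite /vflip /vbelow; case: ifP => _ /eqP.
  by move=> r0 ba; rewrite -(refl_eq0 (wneg_k d_gt0 skB k) ba).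
by move=> r0 ba; rewrite -(refl_eq0 (wpos_k d_gt0 skB k) ba).
Qed.

Lemma wall_shear : wall B1 G1 -> wall B G0.
Proof.
move=> wa g gi l; have gi' := mut_inc_inc d_gt0 skB k gi.
pose c j : int := (j != l)%:Z.
have c0 j : 0 <= c j by [].
(* Either the facet lies in the hyperplane v_k = 0, with normal e_k, or its sum of generators is off
   it and the normal is the reflection of the mutated one. *)
have [vk|vk] := eqVneq (dcomb G0 c k) 0.
  exists U_(k)%MM; split; first by rewrite mnm1_eq0.
    move=> j jl; rewrite pairU.
    have e : \sum_j c j * G0 k j = 0.
      by move: vk; rewrite /dcomb => /eqP; rewrite mulf_eq0 gt_eqF //= => /eqP.
    have s0 i : if s then G0 k i <= 0 else 0 <= G0 k i.
      rewrite G0E eqxx; have := G1s i.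
      by case: s; rewrite ?oppr_le0 ?oppr_ge0.
    suff -> : G0 k j = 0 by rewrite mulr0.
    have : c j * G0 k j = 0; last by rewrite /c jl mul1r.
    case: s s0 => H.
      have /allP/(_ j (mem_index_enum _))/= : all (fun j => - (c j * G0 k j) == 0) (index_enum 'I_n).
        have := psumr_eq0 (P := xpredT) (index_enum 'I_n) (F := fun j => - (c j * G0 k j)).
        by rewrite sumrN e oppr0 eqxx => <- // i _; rewrite oppr_ge0; apply: mulr_ge0_le0.
      by rewrite oppr_eq0 => /eqP.
    have /allP/(_ j (mem_index_enum _))/= : all (fun j => c j * G0 k j == 0) (index_enum 'I_n).
      have := psumr_eq0 (P := xpredT) (index_enum 'I_n) (F := fun j => c j * G0 k j).
      by rewrite e eqxx => <- // i _; apply: mulr_ge0.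
    by move/eqP.
  by move=> p z m F; apply: (fact_unit gi F).
have [a1 [a10 ao aw]] := wa _ gi' l.
have g0 : g 0%MM = 1 by case: gi.
have [p0 [z0 [m0 F0]]] := fact_exists (dcomb G0 c) g0.
have vb : vbelow B k (dcomb G0 c) a1.
  have [_ [p' [z' [m' [F' [_ z's]]]]]] := mut_fact d_gt0 skB gi vk F0.
  by apply: z's; rewrite vmut_comb // in F'; apply: aw F'.
have vw : (forall a, vbelow B k (dcomb G0 c) a = belowk k w a) /\
          (forall a, vflip B k (dcomb G0 c) a = refl k w a).
  rewrite /vbelow /vflip /w; have := comb_sign c0; case: s => h.
    by rewrite ltNge h.
  by rewrite lt_neqAle eq_sym vk h.
have wk : w k = 0%N.
  by rewrite /w; case: s; rewrite ?(wpos_k d_gt0 skB) ?(wneg_k d_gt0 skB).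
have b1 : belowk k w a1 by rewrite -vw.1.
exists (refl k w a1); split.
- by rewrite refl_eq0.
- move=> j jl; rewrite -(ao j jl); apply/esym.
  apply: (pair_refl wk b1) => i; rewrite shear_coord //.
move=> p z m F.
have [_ [p' [z' [m' [F' [zz' z's]]]]]] := mut_fact d_gt0 skB gi vk F.
rewrite -zz'; last by rewrite vw.1 below_refl.
rewrite vw.2 reflK //; rewrite vmut_comb // in F'; exact: aw F'.
Qed.
End Shear.
End Coherence.

(** * The transition rule and the joint induction *)

Section Main.
Variables (n : nat) (d : 'I_n -> int).
Hypothesis d_gt0 : forall i, 0 < d i.
Notation skew B := (forall i j, d i * B i j = - (d j * B j i)).
Implicit Types (B T C G : 'M[int]_n) (k l i j : 'I_n) (ks : seq 'I_n).

Section TruleStep.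
Variables (B T C0 C1 G0 G1 : 'M[int]_n) (k q : 'I_n) (e0 e1 s s' : bool).
Notation B1 := (mutmx k B).
Hypothesis skB : skew B.
Hypothesis skT : skew T.
Hypothesis du0 : dual d B T C0 G0.
Hypothesis du1 : dual d B1 T C1 G1.
Hypothesis coh0 : coh q C0 e0.
Hypothesis coh1 : coh q C1 e1.
Notation G0' := (G0 *m emx q T e0).
Notation G1' := (G1 *m emx q T e1).
Hypothesis G1s : forall j, if s then 0 <= G1 k j else G1 k j <= 0.
Hypothesis G1s' : forall j, if s' then 0 <= G1' k j else G1' k j <= 0.
Hypothesis G01 : forall i j, G0 i j = tmap (fun i => B1 i k) k (fun i => G1 i j) i.

Let b i := B1 i k.
Let E0 i j : G0 i j = if i == k then - G1 k j
  else G1 i j + (pospart (if s then b i else - b i))%:Z * G1 k j.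
Proof. by rewrite (G0E G1s G01) natz. Qed.

Let ek e : ecol q T e q = 0. Proof. exact: (ecol_k q e d_gt0 skT). Qed.

Lemma emx_col (M : 'M[int]_n) e i :
  (M *m emx q T e) i q = - M i q + \sum_l M i l * ecol q T e l.
Proof. by rewrite mul_emx eqxx mul1r; ring. Qed.

Lemma emx_col_single (M : 'M[int]_n) e i : (forall j, j != q -> M i j = 0) ->
  (M *m emx q T e) i q = - M i q.
Proof.
move=> H; rewrite emx_col big1 ?addr0 // => l _.
by have [->|lq] := eqVneq l q; rewrite ?ek ?mulr0 // H ?mul0r.
Qed.

(** Up to D, C is the inverse transpose of G. Negating row k of G and adding multiples of it to
    other rows therefore changes only row k of C. *)
Lemma cvec_off l : l != k -> C0 l q = C1 l q.
Proof.
have [w wE] : exists w : 'I_n -> int, forall i j, i != k ->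
    d i * G0 i j = d i * G1 i j + w i * (d k * G1 k j).
  exists (fun i => ((if s then wpos B k else wneg B k) i)%:Z) => i j ik.
  have := shear_coord d_gt0 skB G1s G01 i j; rewrite (negbTE ik) (E0 k) eqxx => ->.
  by ring.
pose x i := C1 i q - (if i == k then \sum_(m | m != k) C0 m q * w m - C0 k q else C0 i q).
suff x0 i : x i = 0.
  by move=> lk; have := x0 l; rewrite /x (negbTE lk) => /eqP; rewrite subr_eq0 => /eqP.
move: i; apply: (dual_ker d_gt0 du1) => j.
have h0 := dual_pair q j du0; have h1 := dual_pair q j du1.
rewrite (eq_bigr (fun i => C1 i q * d i * G1 i j - (if i == k then
    \sum_(m | m != k) C0 m q * w m - C0 k q else C0 i q) * d i * G1 i j)).
  2: by move=> i _; rewrite /x; ring.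
rewrite sumrB h1 -h0 (bigD1 k) //= [X in _ - X](bigD1 k) //= eqxx (E0 k) eqxx.
rewrite (eq_bigr (fun i => C0 i q * (d i * G1 i j) + (C0 i q * w i) * (d k * G1 k j))); last first.
  by move=> i ik; rewrite -mulrA wE //; ring.
rewrite big_split /= -mulr_suml.
rewrite [X in _ - (_ + X)](eq_bigr (fun i => C0 i q * (d i * G1 i j))).
  2: by move=> i /negbTE ->; rewrite mulrA.
ring.
Qed.

Lemma single_row_unit : (forall j, j != q -> G1 k j = 0) ->
  exists u, G1 k q * u = 1.
Proof.
move=> H; exists (invmx G1 q k).
have [_ _ uG _] := du1; have := congr1 (fun M : 'M_n => M k k) (mulmxV uG).
rewrite !mxE eqxx (bigD1 q) //= big1 ?addr0 // => j jq.
by rewrite H // mul0r.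
Qed.

Lemma unit_pm (x u : int) : x * u = 1 -> x = 1 \/ x = -1.
Proof.
move=> h; have : (`|x| * `|u| == 1)%N by rewrite -abszM h.
by rewrite muln_eq1 => /andP[/eqP hx _]; lia.
Qed.

(* The c-vectors of the two patterns agree off k, so they have the same sign
   unless they are parallel to e_k, and then row k would change sign. *)
Lemma trule_same : s = s' -> forall i,
  G0' i q = tmap b k (fun i => G1' i q) i.
Proof.
move=> ss i; have lin := @tmap_lin _ n b k (fun i => G1' i q) s i.
rewrite lin; last by rewrite ss; exact: G1s'.
have H : \sum_l G0 i l * ecol q T e0 l = \sum_l G0 i l * ecol q T e1 l.
  have [-> //|ne] := eqVneq e0 e1.
  have C1z l : l != k -> C1 l q = 0.
    move=> lk; have := coh0 l; have := coh1 l; rewrite /sgnb (cvec_off lk).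
    by case: e0 e1 ne => [] [] //= _; lia.
  have P j : d k * C1 k q * G1 k j = d q * (q == j)%:Z.
    rewrite -(dual_pair q j du1) (bigD1 k) //= big1 ?addr0; first by ring.
    by move=> l lk; rewrite C1z // !mul0r.
  have Pq := P q; rewrite eqxx mulr1 in Pq.
  have Z j : j != q -> G1 k j = 0.
    move=> jq; have := P j; rewrite eq_sym (negbTE jq) mulr0 => /eqP.
    rewrite !mulf_eq0 => /orP[/orP[|]|/eqP //]; first by rewrite gt_eqF.
    by move=> /eqP cz; move: Pq; rewrite cz mulr0 mul0r => /esym/eqP; rewrite gt_eqF.
  have := G1s' q; rewrite (emx_col_single e1 Z) -ss; have := G1s q.
  have xz : G1 k q != 0.
    by apply/eqP => xz; move: Pq; rewrite xz mulr0 => /esym/eqP; rewrite gt_eqF.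
  by case: (s) => *; exfalso; move/eqP: xz; apply; lia.
rewrite emx_col H !emx_col E0; case: (eqVneq i k) => [ik|ik].
  rewrite ik (eq_bigr (fun l => - (G1 k l * ecol q T e1 l))).
    by rewrite sumrN; ring.
  by move=> l _; rewrite E0 eqxx mulNr.
rewrite natz (eq_bigr (fun l => G1 i l * ecol q T e1 l +
  (pospart (if s then b i else - b i))%:Z * (G1 k l * ecol q T e1 l))).
  by rewrite big_split /= -mulr_sumr; ring.
by move=> l _; rewrite E0 (negbTE ik) mulrDl mulrA.
Qed.

(* Row k vanishes off q, so the c-vectors are e_k and - e_k up to order, and the
   two patterns mutate with opposite signs. *)
Lemma trule_cross : s' = ~~ s -> forall i,
  G0' i q = tmap b k (fun i => G1' i q) i.
Proof.
move=> ss i; have lin := @tmap_lin _ n b k (fun i => G1' i q) s' i.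
rewrite lin; last exact: G1s'.
have Z j : j != q -> G1 k j = 0.
  move=> jq; have := G1s' j; have := G1s j; rewrite mul_emx (negbTE jq) mul0r addr0 ss.
  by case: (s) => /= *; lia.
have [u /unit_pm x1] := single_row_unit Z.
set x := G1 k q in x1.
have C1E l : d q * (k == l)%:Z = d k * x * C1 l q.
  suff : d q * (k == l)%:Z - d k * x * C1 l q = 0 by move/eqP; rewrite subr_eq0 => /eqP.
  move: l; apply: (dual_ker d_gt0 du1) => j.
  rewrite (eq_bigr (fun l => d q * d l * G1 l j * (l == k)%:Z - d k * x * (C1 l q * d l * G1 l j))).
    2: by move=> l _; rewrite eq_sym; ring.
  rewrite sumrB sum_delta -mulr_sumr (dual_pair q j du1).
  case: (eqVneq q j) => [<-|qj]; first by rewrite -/x /=; ring.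
  by rewrite Z 1?eq_sym //=; ring.
have C0E l : d q * (k == l)%:Z = - (d k * x * C0 l q).
  suff : d q * (k == l)%:Z + d k * x * C0 l q = 0 by move/eqP; rewrite addr_eq0 => /eqP.
  move: l; apply: (dual_ker d_gt0 du0) => j.
  rewrite (eq_bigr (fun l => d q * d l * G0 l j * (l == k)%:Z + d k * x * (C0 l q * d l * G0 l j))).
    2: by move=> l _; rewrite eq_sym; ring.
  rewrite big_split /= sum_delta -mulr_sumr (dual_pair q j du0) E0 eqxx.
  case: (eqVneq q j) => [<-|qj]; first by rewrite -/x /=; ring.
  by rewrite Z 1?eq_sym //=; ring.
have Cz l : l != k -> C1 l q = 0.
  move=> lk; have := C1E l; rewrite eq_sym (negbTE lk) mulr0 => /esym/eqP.
  rewrite !mulf_eq0 gt_eqF //= => /orP[/eqP x0|/eqP //].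
  by case: x1; rewrite x0.
have y1 : C1 k q = 1 \/ C1 k q = -1.
  have [_ _ _ uC] := du1; have := congr1 (fun M : 'M_n => M q q) (mulVmx uC).
  rewrite !mxE eqxx (bigD1 k) //= big1 ?addr0 => [|j jk]; last by rewrite Cz // mulr0.
  by rewrite mulrC => /unit_pm.
have := C1E k; have := C0E k; rewrite eqxx mulr1 => c0 c1.
have dq := d_gt0 q; have dk := d_gt0 k.
have yx : C1 k q = x by case: x1 y1 => ? [] ?; nia.
have e1E : e1 = (0 < x).
  have := coh1 k; rewrite /sgnb yx; case: (e1); case: x1 => -> //=.
have e0E : e0 = ~~ e1.
  have y0 : C0 k q * x < 0 by nia.
  have := coh0 k; rewrite /sgnb e1E; case: (e0); case: x1 y0 => -> //=; lia.
have sE : s = (0 < x) by have := G1s q; rewrite -/x; case: (s); case: x1 => -> //=.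
(* The mutations with opposite signs differ by column q of G T = B C; the c-vector being x e_k, this
   is x times column k of [B1], the jump between the two linear pieces of [tmap]. *)
have sumT : \sum_l G1 i l * T l q = b i * x.
  have [_ h _ _] := du1; have := congr1 (fun M : 'M_n => M i q) h; rewrite !mxE => ->.
  rewrite (bigD1 k) //= big1 ?addr0 ?yx //; last by move=> l lk; rewrite Cz // mulr0.
have dE : \sum_l G1 i l * ecol q T e0 l - \sum_l G1 i l * ecol q T e1 l =
          if s then b i * x else - (b i * x).
  rewrite -sumrB -sumT e0E e1E -sE; case: (s); rewrite /ecol /sgnb /=; last first.
    rewrite -sumrN; apply: eq_bigr => l _; rewrite opprK; have := pospart_sub (T l q).
    by move: (pospart _)%:Z (pospart _)%:Z => a a' ->; ring.
  apply: eq_bigr => l _; rewrite opprK; have := pospart_sub (T l q).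
  by move: (pospart _)%:Z (pospart _)%:Z => a a' ->; ring.
have Zsum e : \sum_l G1 k l * ecol q T e l = 0.
  rewrite big1 // => l _; have [->|lq] := eqVneq l q; first by rewrite ek mulr0.
  by rewrite Z // mul0r.
rewrite (emx_col_single e1 Z) -/x emx_col E0.
case: (eqVneq i k) => [ik|ik].
  rewrite ik (eq_bigr (fun l => - (G1 k l * ecol q T e0 l))).
    by rewrite sumrN Zsum -/x; ring.
  by move=> l _; rewrite E0 eqxx mulNr.
rewrite natz (eq_bigr (fun l => G1 i l * ecol q T e0 l +
  (pospart (if s then b i else - b i))%:Z * (G1 k l * ecol q T e0 l))).
  2: by move=> l _; rewrite E0 (negbTE ik) mulrDl mulrA.
rewrite big_split /= -mulr_sumr Zsum mulr0 addr0 emx_col -/x.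
have := dE; rewrite ss; have := pospart_sub (b i).
move: (\sum_l G1 i l * ecol q T e0 l) (\sum_l G1 i l * ecol q T e1 l) => S0 S1.
case: (s) => /= bE SE.
  have -> : S0 = S1 + b i * x by rewrite -SE; ring.
  by move: (pospart (b i))%:Z (pospart (- b i))%:Z bE => P P' ->; ring.
have -> : S0 = S1 - b i * x by rewrite -SE; ring.
by move: (pospart (b i))%:Z (pospart (- b i))%:Z bE => P P' ->; ring.
Qed.

Lemma trule_step i j : G0' i j = tmap b k (fun i => G1' i j) i.
Proof.
have [->|jq] := eqVneq j q; last first.
  rewrite mul_emx (negbTE jq) mul0r addr0 G01; congr (tmap _ _ _ _); apply/funext => l.
  by rewrite mul_emx (negbTE jq) mul0r addr0.
by have [ss|ss] := eqVneq s' s; [apply: trule_same | apply: trule_cross; case: (s') (s) ss => [] []].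
Qed.
End TruleStep.

Lemma mutseq_skew B ks : skew B -> skew (mutseq B ks).
Proof.
move=> skB; elim/last_ind: ks => // ks k IH i j; rewrite mutseq_rcons.
exact: mutmx_skew d_gt0 IH k i j.
Qed.

Definition good B ks := [/\ dual d B (mutseq B ks) (cmat B ks) (gmat B ks),
  chamber d B (gmat B ks) & wall d B (gmat B ks)].

Definition trule B k ks := forall i j, gmat B (k :: ks) i j =
  tmap (fun i => mutmx k B i k) k (fun i => gmat (mutmx k B) ks i j) i.

Lemma trule_nil B k : skew B -> trule B k [::].
Proof.
move=> skB i j; rewrite -[[:: k]]/(rcons [::] k) gmat_rcons.
have c1 : coh k (1%:M : 'M[int]_n) true by move=> l; rewrite /sgnb mxE; case: eqP.
rewrite (mutg_emx d_gt0 skB c1); last first.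
  by move=> l; have [_ h _ _] := dual_init d B;
     have := congr1 (fun M : 'M_n => M l k) h; rewrite !mxE.
have H : 0 <= (1%:M : 'M[int]_n) k j by rewrite mxE; case: eqP.
rewrite (@tmap_lin _ n (fun i => mutmx k B i k) k (fun i => gmat (mutmx k B) [::] i j) true) //.
rewrite /gmat /= natz mul1mx /ecol /sgnb !mxE ?eqxx ?orbT.
case: (eqVneq i k) => [->|ik].
  by rewrite (ecol_k k true d_gt0 skB) eq_sym; case: (j == k).
by rewrite /ecol /sgnb [j == k]eq_sym !natz /=; ring.
Qed.

Lemma good_nil B : good B [::].
Proof.
by split; [exact: dual_init | exact: chamber_init | exact: wall_init].
Qed.

Lemma good_rcons_dual B ks k : skew B -> good B ks ->
  dual d B (mutseq B (rcons ks k)) (cmat B (rcons ks k)) (gmat B (rcons ks k)).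
Proof.
move=> skB [du _ wa]; have [eps co] := wall_coh d_gt0 k skB du wa.
rewrite mutseq_rcons cmat_rcons gmat_rcons.
exact: (dual_step d_gt0 (mutseq_skew ks skB) co du).
Qed.

Lemma gmat_step B ks k : skew B -> good B ks -> exists2 eps, coh k (cmat B ks) eps &
  gmat B (rcons ks k) = gmat B ks *m emx k (mutseq B ks) eps.
Proof.
move=> skB [du _ wa]; have [eps co] := wall_coh d_gt0 k skB du wa.
exists eps => //; rewrite gmat_rcons (mutg_emx d_gt0 (mutseq_skew ks skB) co) // => i.
by have [_ h _ _] := du; have := congr1 (fun M : 'M_n => M i k) h; rewrite !mxE.
Qed.

(** Induction on the length, using both ends. Duality comes from the sequence without its last
    letter, where walls give the sign needed to mutate. Chambers and walls come from [mutmx k B] and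
    ks via the transition rule, itself deduced by [trule_step] from the rule for ks without its last
    letter. *)
Lemma good_all N : forall B ks, skew B -> size ks = N ->
  good B ks /\ (forall k ks', ks = k :: ks' -> trule B k ks').
Proof.
elim/ltn_ind: N => N IH B ks skB sz.
case: ks sz => [|k ks] sz; first by split; [exact: good_nil|].
have skB1 := mutmx_skew d_gt0 skB k.
have [good1 _] := IH (size ks) ltac:(by rewrite -sz /=) _ _ skB1 erefl.
have tr : trule B k ks.
  case/lastP: ks sz good1 => [|ks q] sz good1; first exact: trule_nil.
  rewrite /= size_rcons in sz.
  have [g0 tr0] := IH (size ks).+1 ltac:(by rewrite -sz) B (k :: ks) skB erefl.
  have [g1 _] := IH (size ks) ltac:(by rewrite -sz; lia) _ ks skB1 erefl.
  have {}tr0 := tr0 k ks erefl.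
  have [e0 co0 G0E] := gmat_step q skB g0; have [e1 co1 G1E] := gmat_step q skB1 g1.
  have [du0 _ _] := g0; have [du1 ch1 _] := g1; have [_ ch1' _] := good1.
  have [s Hs] := chamber_rowcoh d_gt0 k skB1 ch1.
  have [s' Hs'] := chamber_rowcoh d_gt0 k skB1 ch1'.
  move=> i j; rewrite -rcons_cons G0E G1E; rewrite G1E in Hs'.
  exact: (trule_step skB (mutseq_skew (k :: ks) skB) du0 du1 co0 co1 Hs Hs' tr0).
split; last by move=> k' ks' [<- <-].
have du : dual d B (mutseq B (k :: ks)) (cmat B (k :: ks)) (gmat B (k :: ks)).
  have : k :: ks != [::] by [].
  case/lastP: (k :: ks) sz => // ks' q; rewrite size_rcons => sz _.
  have [gd _] := IH (size ks') ltac:(by rewrite -sz) B ks' skB erefl.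
  exact: good_rcons_dual.
have [du1 ch1 wa1] := good1.
have [s Hs] := chamber_rowcoh d_gt0 k skB1 ch1.
have [_ _ uG _] := du1.
split => //; first exact: (chamber_shear d_gt0 skB Hs tr uG ch1).
exact: (wall_shear d_gt0 skB Hs tr wa1).
Qed.

Lemma gmat_good B ks : skew B -> good B ks.
Proof. by move=> skB; case: (good_all skB (erefl (size ks))). Qed.

Lemma gmat_trule B k ks : skew B -> trule B k ks.
Proof. by move=> skB; case: (good_all skB (erefl (size (k :: ks)))) => _; apply. Qed.

Lemma gmat_rowcoh B ks r : skew B ->
  exists s : bool, forall j, if s then 0 <= gmat B ks r j else gmat B ks r j <= 0.
Proof.
by move=> skB; have [_ ch _] := gmat_good ks skB; apply: (chamber_rowcoh d_gt0 r skB ch).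
Qed.
End Main.

(** * The g-vectors *)

Section Degrees.
Variables (n : nat) (B : 'M[int]_n).
Implicit Types (p q : {mpoly int[n + n]}) (a b g : 'I_n -> int) (f : ratfun n).
Notation mdegB := (Defs.mdeg B).
Notation "a \+ b" := (fun i => a i + b i).

Lemma mdeg_add (m m' : 'X_{1..n + n}) i : mdegB (m + m')%MM i = mdegB m i + mdegB m' i.
Proof.
rewrite /Defs.mdeg mnmDE PoszD (eq_bigr (fun j => (m (rshift n j))%:Z * B i j
  + (m' (rshift n j))%:Z * B i j)).
  by rewrite big_split /=; ring.
by move=> j _; rewrite mnmDE PoszD mulrDl.
Qed.

Lemma homogM p q a b : homog_of B p a -> homog_of B q b -> homog_of B (p * q) (a \+ b).
Proof.
move=> hp hq m /msuppM_le /allpairsP[[m1 m2] /= [h1 h2 ->]].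
by apply/funext => i; rewrite mdeg_add (hp _ h1) (hq _ h2).
Qed.

Lemma homogD p q a : homog_of B p a -> homog_of B q a -> homog_of B (p + q) a.
Proof.
by move=> hp hq m /msuppD_le; rewrite mem_cat => /orP[/hp|/hq].
Qed.

Lemma homog_eq p a b : p != 0 -> homog_of B p a -> homog_of B p b -> a = b.
Proof.
move=> p0 ha hb; have := p0; rewrite -msupp_eq0; case E : (msupp p) => [|m s] // _.
by rewrite -(ha m) ?E ?mem_head // -(hb m) ?E ?mem_head.
Qed.

Lemma tofrac_neq0 p : p != 0 -> p%:F != 0 :> ratfun n.
Proof. by move=> p0; rewrite tofrac_eq0. Qed.

Lemma gvector_uniq f g g' : has_gvector B f g -> has_gvector B f g' -> g =1 g'.
Proof.
move=> [p [q [a [b [[p0 q0 hp hq fE] gE]]]]] [p' [q' [a' [b' [[p0' q0' hp' hq' fE'] gE']]]]].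
have e : p * q' = p' * q.
  apply/eqP; rewrite -tofrac_eq !tofracM -eqr_div ?tofrac_neq0 //.
  by rewrite -fE -fE'.
have := homogM hp hq'; rewrite e => h; have h' := homogM hp' hq.
have pq0 : p' * q != 0 by rewrite mulf_neq0.
move=> i; have := congr1 (fun u : 'I_n -> int => u i) (homog_eq pq0 h h').
by rewrite gE gE' /=; lia.
Qed.

Notation ev1 p := (p.@[fun=> 1]).

(* Positivity at the point (1, ..., 1) survives sums, unlike being nonzero. *)
Definition pos_gvector f g := exists p q a b,
  [/\ 0 < ev1 p, 0 < ev1 q, homog_of B p a, homog_of B q b & f = p%:F / q%:F]
  /\ g = fun i => a i - b i.

Lemma ev1_neq0 p : 0 < ev1 p -> p != 0.
Proof. by apply: contraTneq => ->; rewrite raddf0 ltxx. Qed.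

Lemma pos_gvectorP f g : pos_gvector f g -> has_gvector B f g.
Proof.
move=> [p [q [a [b [[p0 q0 hp hq fE] ->]]]]]; exists p, q, a, b.
by split => //; split; rewrite ?ev1_neq0.
Qed.

Lemma pos_gvectorM f f' g g' : pos_gvector f g -> pos_gvector f' g' ->
  pos_gvector (f * f') (g \+ g').
Proof.
move=> [p [q [a [b [[p0 q0 hp hq ->] ->]]]]] [p' [q' [a' [b' [[p0' q0' hp' hq' ->] ->]]]]].
exists (p * p'), (q * q'), (a \+ a'), (b \+ b'); split; last by apply/funext => i; ring.
split; rewrite ?mevalM ?mulr_gt0 //; try exact: homogM.
by rewrite !tofracM mulf_div.
Qed.

Lemma pos_gvectorV f g : pos_gvector f g -> pos_gvector f^-1 (fun i => - g i).
Proof.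
move=> [p [q [a [b [[p0 q0 hp hq ->] ->]]]]].
exists q, p, b, a; split; last by apply/funext => i; ring.
by split => //; rewrite invf_div.
Qed.

Lemma pos_gvectorD f f' g : pos_gvector f g -> pos_gvector f' g -> pos_gvector (f + f') g.
Proof.
move=> [p [q [a [b [[p0 q0 hp hq ->] e]]]]] [p' [q' [a' [b' [[p0' q0' hp' hq' ->] e']]]]].
exists (p * q' + p' * q), (q * q'), (a \+ b'), (b \+ b'); split; last first.
  by rewrite e; apply/funext => i; ring.
split; rewrite ?mevalD ?mevalM ?addr_gt0 ?mulr_gt0 //; try exact: homogM.
  apply: homogD; first exact: homogM.
  have -> : a \+ b' = a' \+ b; last exact: homogM.
  by apply/funext => i; have := congr1 (fun u : 'I_n -> int => u i) (etrans (esym e) e'); lia.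
by rewrite addf_div ?tofrac_neq0 ?ev1_neq0 // tofracD !tofracM.
Qed.

Lemma homog1 : homog_of B 1 (fun=> 0).
Proof.
move=> m; rewrite -[1]mpolyC1 msupp1 inE => /eqP ->; apply/funext => i.
by rewrite /Defs.mdeg mnm0E big1 ?subr0 // => j _; rewrite mnm0E mul0r.
Qed.

Lemma pos_gvector_poly p a : 0 < ev1 p -> homog_of B p a -> pos_gvector p%:F a.
Proof.
move=> p0 hp; exists p, 1, a, (fun=> 0); split; last by apply/funext => i; rewrite subr0.
split => //; first by rewrite rmorph1.
- exact: homog1.
- by rewrite tofrac1 divr1.
Qed.

Lemma pos_gvector1 : pos_gvector 1 (fun=> 0).
Proof. by rewrite -tofrac1; apply: pos_gvector_poly; rewrite ?rmorph1 //; apply: homog1. Qed.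

Lemma pos_gvectorX f g e : pos_gvector f g -> pos_gvector (f ^+ e) (fun i => e%:Z * g i).
Proof.
move=> h; elim: e => [|e IH].
  by have -> : (fun i => 0%:Z * g i) = (fun=> 0); [apply/funext => i; rewrite mul0r | exact: pos_gvector1].
rewrite exprS; have -> : (fun i => e.+1%:Z * g i) = g \+ (fun i => e%:Z * g i).
  by apply/funext => i; lia.
exact: pos_gvectorM.
Qed.

Lemma pos_gvector_prod (I : finType) (F : I -> ratfun n) (D : I -> 'I_n -> int) :
  (forall l, pos_gvector (F l) (D l)) ->
  pos_gvector (\prod_l F l) (fun i => \sum_l D l i).
Proof.
move=> h.
have -> : (fun i => \sum_l D l i) = \big[(fun a b => a \+ b)/(fun=> 0)]_l D l.
  by apply/funext => i; elim/big_rec2: _ => // l x y _ ->.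
elim/big_rec2: _; first exact: pos_gvector1.
by move=> l x y _ hx; apply: pos_gvectorM.
Qed.

Lemma pos_gvector_xvar l : pos_gvector (xvar l) (fun i => (i == l)%:Z).
Proof.
apply: pos_gvector_poly; first by rewrite mevalXU.
move=> m; rewrite msuppX inE => /eqP ->; apply/funext => i.
rewrite /Defs.mdeg mnm1E (inj_eq (@lshift_inj n n)) [l == i]eq_sym big1 ?subr0 // => j _.
by rewrite mnm1E eq_lrshift mul0r.
Qed.

Lemma pos_gvector_yvar l : pos_gvector (yvar l) (fun i => - B i l).
Proof.
apply: pos_gvector_poly; first by rewrite mevalXU.
move=> m; rewrite msuppX inE => /eqP ->; apply/funext => i.
rewrite /Defs.mdeg mnm1E eq_rlshift sub0r (bigD1 l) //= mnm1E eqxx mul1r big1 ?addr0 // => j jl.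
by rewrite mnm1E (inj_eq (@rshift_inj n n)) eq_sym (negbTE jl) mul0r.
Qed.
End Degrees.

(** By G T = B C the two monomials of an exchange relation have equal degree; exchanges being free
    of subtraction, positivity at (1, ..., 1) persists. *)
Lemma cluster_gvector n (d : 'I_n -> int) (B : 'M[int]_n) ks l :
  (forall i, 0 < d i) -> (forall i j, d i * B i j = - (d j * B j i)) ->
  pos_gvector B (sclus (seed_at B ks) l) (fun i => gmat B ks i l).
Proof.
move=> d_gt0 skB; elim/last_ind: ks l => [|ks k IH] l.
  have -> : (fun i => gmat B [::] i l) = (fun i => (i == l)%:Z).
    by apply/funext => i; rewrite /gmat /= mxE natz.
  exact: pos_gvector_xvar.
rewrite /seed_at foldl_rcons /= -/(seed_at B ks) gmat_rcons.
case: (eqVneq l k) => [->|lk]; last first.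
  by have -> : (fun i => mutg B k (mutseq B ks) (cmat B ks) (gmat B ks) i l) =
    (fun i => gmat B ks i l) by apply/funext => i; rewrite mxE (negbTE lk).
set T := stop _; set C := sbot _.
have TE : T = mutseq B ks by apply: stop_seed.
pose g1 i := \sum_l gmat B ks i l * (pospart (T l k))%:Z - \sum_l B i l * (pospart (C l k))%:Z.
have -> : (fun i => mutg B k (mutseq B ks) (cmat B ks) (gmat B ks) i k) =
    (fun i => g1 i + - gmat B ks i k).
  by apply/funext => i; rewrite mxE eqxx /g1 -TE; ring.
apply: pos_gvectorM; last by apply: pos_gvectorV; apply: IH.
have H (u w : 'I_n -> nat) (g : 'I_n -> int) :
  (forall i, g i = \sum_l gmat B ks i l * (u l)%:Z - \sum_l B i l * (w l)%:Z) ->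
  pos_gvector B (\prod_i sclus (seed_at B ks) i ^+ u i * \prod_j yvar j ^+ w j) g.
  move=> gE.
  have -> : g = fun i => (\sum_l (u l)%:Z * gmat B ks i l) + (\sum_l (w l)%:Z * (- B i l)).
    apply/funext => i; rewrite gE -sumrN; congr (_ + _); apply: eq_bigr => m _; ring.
  apply: pos_gvectorM; apply: pos_gvector_prod => m; apply: pos_gvectorX => //.
  exact: pos_gvector_yvar.
apply: pos_gvectorD; first exact: H.
apply: H => i; rewrite /g1.
have [_ h _ _] : dual d B (mutseq B ks) (cmat B ks) (gmat B ks).
  by have [] := gmat_good d_gt0 ks skB.
have := congr1 (fun M : 'M_n => M i k) h; rewrite !mxE -TE -/C => e.
have A (M N : 'M[int]_n) : \sum_l M i l * (pospart (N l k))%:Z =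
    \sum_l M i l * (pospart (- N l k))%:Z + \sum_l M i l * N l k.
  rewrite -big_split; apply: eq_bigr => m _ /=; have := pospart_sub (N m k).
  by move: (pospart _)%:Z (pospart _)%:Z => a a' ->; ring.
by rewrite !A e; ring.
Qed.

(** * The g-vector fan *)

Lemma mutmxK n (k : 'I_n) : involutive (mutmx k).
Proof.
move=> B; apply/matrixP => i j; rewrite !mxE eqxx orbT /=.
case: (eqVneq i k) => [->|ik] /=; first by rewrite opprK.
case: (eqVneq j k) => [->|jk] /=; first by rewrite opprK.
have := pospart_sub (B k j); have := pospart_sub (B i k); rewrite !opprK.
move: (pospart (B k j))%:Z (pospart (- B k j))%:Z (pospart (B i k))%:Z (pospart (- B i k))%:Z.
by move=> a a' b b' -> ->; ring.
Qed.

Section Tmap.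
Variables (R : realDomainType) (n : nat) (b : 'I_n -> int) (k : 'I_n).
Implicit Types v w : 'I_n -> R.

Lemma tmapK v i : tmap (fun i => - b i) k (tmap b k v) i = v i.
Proof.
rewrite /tmap eqxx; case: (eqVneq i k) => [->|ik]; first by rewrite opprK.
rewrite opprK oppr_ge0; case: (ltrgtP (v k) 0) => [h|h|->]; rewrite ?mulrN ?addrK //.
by rewrite !mulr0 oppr0 !addr0.
Qed.

Lemma tmap_lipschitz v w i (e : R) : (forall j, `|v j - w j| < e) ->
  `|tmap b k v i - tmap b k w i| < e * (1 + `|b i|%N%:R).
Proof.
move=> h; have e0 : 0 < e by apply: le_lt_trans (h k).
have hM (x : int) : (x == b i) || (x == - b i) -> (pospart x)%:R <= `|b i|%N%:R :> R.
  by move=> hx; rewrite ler_nat /pospart; case: ifP => _ //; case/orP: hx => /eqP ->; lia.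
have M0 : 0 <= `|b i|%N%:R :> R by [].
rewrite /tmap; case: (eqVneq i k) => [ik|ik].
  rewrite -opprD normrN; apply: lt_le_trans (h k) _.
  by rewrite ler_peMr ?lerDl // ltW.
have hk := h k; have hi := h i; set x := v k in hk *; set y := w k in hk *.
set p : R := (pospart (if 0 <= x then b i else - b i))%:R.
set q : R := (pospart (if 0 <= y then b i else - b i))%:R.
have p0 : 0 <= p by []. have q0 : 0 <= q by [].
have pM : p <= `|b i|%N%:R by apply: hM; case: ifP; rewrite ?eqxx ?orbT.
have qM : q <= `|b i|%N%:R by apply: hM; case: ifP; rewrite ?eqxx ?orbT.
(* If x and y have opposite signs, |p x - q y| = p |x| + q |y| and |x - y| = |x| + |y|. *)
have key : `|p * x - q * y| <= `|b i|%N%:R * `|x - y|.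
  have := erefl p; have := erefl q; rewrite {2}/p {2}/q.
  have [x0|x0] := leP 0 x; have [y0|y0] := leP 0 y => qE pE.
  - by rewrite qE -pE -mulrBr normrM ger0_norm // ler_wpM2r.
  - rewrite !ger0_norm; nra.
  - rewrite !ler0_norm; nra.
  - by rewrite qE -pE -mulrBr normrM ger0_norm // ler_wpM2r.
have -> : v i + p * x - (w i + q * y) = (v i - w i) + (p * x - q * y).
  by rewrite opprD addrACA.
apply: le_lt_trans (ler_normD _ _) _; rewrite mulrDr mulr1.
apply: ltr_leD => //; apply: le_trans key _; rewrite mulrC.
by apply: ler_wpM2r => //; exact: ltW.
Qed.
End Tmap.

(** * Cones of the fan when the initial seed is mutated *)

Section Cones.
Variables (R : realType) (n : nat) (d : 'I_n -> int).
Hypothesis d_gt0 : forall i, 0 < d i.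
Notation skew B := (forall i j, d i * B i j = - (d j * B j i)).
Implicit Types (B : 'M[int]_n) (k i j : 'I_n) (ks us : seq 'I_n) (v w : 'I_n -> R).

Definition gcone B ks v := exists2 lam : 'I_n -> R, (forall l, 0 <= lam l) &
  forall i, v i = \sum_l lam l * (gmat B ks i l)%:~R.

Definition gcones_dense B := forall v (e : R), 0 < e ->
  exists w, (exists ks, gcone B ks w) /\ forall i, `|v i - w i| < e.

Lemma gfan_gcone B v : skew B -> gfan_support B v -> exists ks, gcone B ks v.
Proof.
move=> skB [ks [g [lam [hg lam0 vE]]]]; exists ks, lam => // i; rewrite vE.
apply: eq_bigr => l _; congr (_ * _%:~R).
exact: (gvector_uniq (hg l) (pos_gvectorP (cluster_gvector ks l d_gt0 skB))).
Qed.

(** Row k has a sign, so the cone lies on one side of v_k = 0; there [tmap] is linear and takes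
    generators to generators. *)
Lemma gcone_mut B ks k v : skew B -> gcone B ks v ->
  gcone (mutmx k B) (k :: ks) (tmap (fun i => B i k) k v).
Proof.
move=> skB [lam lam0 vE].
have tr := gmat_trule d_gt0 k ks (mutmx_skew d_gt0 skB k); rewrite /trule mutmxK in tr.
have [s hs] := gmat_rowcoh d_gt0 ks k skB.
exists lam => // i.
have vs : if s then 0 <= v k else v k <= 0.
  rewrite vE; case: s hs => hs.
    by apply: sumr_ge0 => l _; apply: mulr_ge0 => //; rewrite ler0z.
  by apply: sumr_le0 => l _; apply: mulr_ge0_le0 => //; rewrite lerz0.
rewrite (tmap_lin _ _ vs).
have hs' l := hs l.
case: (eqVneq i k) => [ik|ik].
  rewrite vE -sumrN; apply: eq_bigr => l _; rewrite tr.
  rewrite (@tmap_lin _ n _ k (fun i => gmat B ks i l) s i (hs l)) ik eqxx.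
  by rewrite rmorphN mulrN.
rewrite !vE mulr_sumr -big_split; apply: eq_bigr => l _ /=; rewrite tr.
rewrite (@tmap_lin _ n _ k (fun i => gmat B ks i l) s i (hs l)) (negbTE ik).
by rewrite rmorphD rmorphM /= rmorph_nat mulrDr mulrCA.
Qed.

Lemma gcones_dense_mut B k : skew B -> gcones_dense B -> gcones_dense (mutmx k B).
Proof.
move=> skB dB v e e0.
pose v0 := tmap (fun i => mutmx k B i k) k v.
pose M : R := 1 + \sum_i `|B i k|%N%:R.
have M1 i : 1 + `|B i k|%N%:R <= M.
  by rewrite lerD2l (bigD1 i) //= lerDl; apply: sumr_ge0.
have M0 : 0 < M by rewrite /M ltr_pwDl // sumr_ge0.
have eM : 0 < e / M by apply: divr_gt0.
have [w [[ks cw] hw]] := dB v0 _ eM.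
exists (tmap (fun i => B i k) k w); split; first by exists (k :: ks); apply: gcone_mut.
move=> i; have vE : v i = tmap (fun i => B i k) k v0 i.
  rewrite -[LHS](tmapK (fun i => mutmx k B i k) k v); congr (tmap _ _ _ _).
  by apply/funext => l; rewrite mxE eqxx orbT opprK.
rewrite vE; apply: lt_le_trans (tmap_lipschitz (fun i => B i k) k i hw) _.
by rewrite mulrAC ler_pdivrMr // ler_wpM2l // ltW.
Qed.

Lemma gcones_dense_mutseq B ks : skew B -> gcones_dense B -> gcones_dense (mutseq B ks).
Proof.
move=> skB dB; elim/last_ind: ks => // ks k IH; rewrite mutseq_rcons.
by apply: gcones_dense_mut => //; apply: mutseq_skew.
Qed.

Definition nonneg_row B ks i := forall l, 0 <= gmat B ks i l.

(* Row i is negative in column q and zero elsewhere. Mutating the initial seed at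
   i reverses it, and leaves a positive entry in row j, which has a sign. *)
Lemma nonneg_rows_step B P q i j : skew B -> i != j ->
  nonneg_row B P i -> nonneg_row B P j -> gmat B (rcons P q) i q < 0 ->
  nonneg_row (mutmx i B) (i :: rcons P q) i /\ nonneg_row (mutmx i B) (i :: rcons P q) j.
Proof.
move=> skB ij hi hj neg.
have skB' := mutmx_skew d_gt0 skB i.
have other r l : l != q -> gmat B (rcons P q) r l = gmat B P r l.
  by move=> lq; rewrite gmat_rcons mxE (negbTE lq).
have tr := gmat_trule d_gt0 i (rcons P q) skB'; rewrite /trule mutmxK in tr.
have [s hs] := gmat_rowcoh d_gt0 (rcons P q) i skB.
have sF : s = false by have := hs q; case: (s) => //; lia.
rewrite sF in hs.
have z l : l != q -> gmat B (rcons P q) i l = 0.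
  by move=> lq; have := hs l; have := hi l; rewrite other //; lia.
split=> [l|].
  rewrite tr (@tmap_lin _ n _ i (fun r => gmat B (rcons P q) r l) false i (hs l)) eqxx.
  by rewrite oppr_ge0; apply: hs.
have jE l : l != q -> gmat (mutmx i B) (i :: rcons P q) j l = gmat B P j l.
  move=> lq; rewrite tr (@tmap_lin _ n _ i (fun r => gmat B (rcons P q) r l) false j (hs l)).
  by rewrite eq_sym (negbTE ij) z // mulr0 addr0 other.
have [s' hs'] := gmat_rowcoh d_gt0 (i :: rcons P q) j skB'.
case: s' hs' => hs' //.
have jz l : l != q -> gmat B (rcons P q) j l = 0.
  by move=> lq; have := hs' l; have := hj l; rewrite jE // other //; lia.
(* In the remaining case rows i and j both vanish off column q, which contradicts invertibility. *)
have [[_ _ uG _] _ _] := gmat_good d_gt0 (rcons P q) skB.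
have E r t : (forall l, l != q -> gmat B (rcons P q) r l = 0) ->
    gmat B (rcons P q) r q * invmx (gmat B (rcons P q)) q t = (r == t)%:Z.
  move=> rz; have := congr1 (fun N : 'M_n => N r t) (mulmxV uG).
  rewrite !mxE natz => <-; rewrite [RHS](bigD1 q) //= big1 ?addr0 // => l lq.
  by rewrite rz // mul0r.
have := E i i z; have := E j i jz; have := E j j jz; rewrite !eqxx eq_sym (negbTE ij) /=.
by move=> e1 /eqP; rewrite mulf_eq0 => /orP[/eqP e2|/eqP ->]; [rewrite e2 mul0r in e1 | rewrite mulr0].
Qed.

(** A new last mutation q changes only column q; if row i or j turns negative there, one mutation of
    the initial seed at that index repairs both rows. The path from the moved seed first runs back
    through us, whence [rev us]. *)
Lemma nonneg_rows B i j ks : skew B -> i != j -> exists us,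
  [/\ all (pred2 i j) us, nonneg_row (mutseq B us) (rev us ++ ks) i &
      nonneg_row (mutseq B us) (rev us ++ ks) j].
Proof.
move=> skB ij; elim/last_ind: ks => [|ks q [us [aus hi hj]]].
  exists [::]; split=> // l; rewrite /gmat /= mxE; exact: ler0n.
have skU := mutseq_skew d_gt0 us skB.
have [pi|ni] := leP 0 (gmat (mutseq B us) (rcons (rev us ++ ks) q) i q).
  have [pj|nj] := leP 0 (gmat (mutseq B us) (rcons (rev us ++ ks) q) j q).
    exists us; split=> // l; rewrite -rcons_cat; have [->//|lq] := eqVneq l q;
      rewrite gmat_rcons mxE (negbTE lq); [exact: hi | exact: hj].
  have ji : j != i by rewrite eq_sym.
  have [h1 h2] := nonneg_rows_step skU ji hj hi nj.
  exists (rcons us j); rewrite all_rcons aus /= eqxx orbT mutseq_rcons rev_rcons /= -rcons_cat.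
  by split.
have [h1 h2] := nonneg_rows_step skU ij hi hj ni.
exists (rcons us i); rewrite all_rcons aus /= eqxx mutseq_rcons rev_rcons /= -rcons_cat.
by split.
Qed.

(* The irrational cone of a rank two subpattern with b_ij b_ji <= -5: it is stable
   under the mutations at i and j, and its points have a negative coordinate. *)
Definition bad B i j v := [/\ B i j < 0, 0 < B j i, 0 < v i, v j < 0 &
  (B j i)%:~R * v i ^+ 2 - (B i j * B j i)%:~R * (v i * v j) - (B i j)%:~R * v j ^+ 2 < 0].

(** With b = b_ij and c = b_ji, the form takes the same value at the image, i and j being exchanged.
    If v_j + c v_i <= 0, then c v_i^2 - b v_j (v_j + c v_i) would be nonnegative; so the image has
    the right signs. *)
Lemma bad_first B i j v : i != j -> bad B i j v ->
  bad (mutmx i B) j i (tmap (fun l => B l i) i v).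
Proof.
move=> ij [b0 c0 x0 y0 Q]; have ji : j == i = false by rewrite eq_sym (negbTE ij).
have Tj : tmap (fun l => B l i) i v j = v j + (B j i)%:~R * v i.
  by rewrite /tmap ji ltW // /pospart c0 -[in RHS](gtz0_abs c0) -pmulrn.
have Ti : tmap (fun l => B l i) i v i = - v i by rewrite /tmap eqxx.
rewrite /bad Ti Tj !mxE eqxx orbT /= oppr_lt0 oppr_gt0 oppr_lt0.
have bR : (B i j)%:~R < 0 :> R by rewrite ltrz0.
have cR : 0 < (B j i)%:~R :> R by rewrite ltr0z.
move: Q bR cR; rewrite !rmorphN !rmorphM /= !rmorphN /=.
move: (B i j)%:~R (B j i)%:~R (v i) (v j) x0 y0 => b c x y x0 y0 Q bR cR.
split=> //; last by have := Q; nra.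
rewrite ltNge; apply/negP => h; have bc : 0 <= b * y * - (y + c * x).
  by apply: mulr_ge0; [apply: mulr_le0; exact: ltW | rewrite oppr_ge0].
have cx : 0 <= c * x ^+ 2 by apply: mulr_ge0; [exact: ltW | exact: sqr_ge0].
by have : c * x ^+ 2 - b * c * (x * y) - b * y ^+ 2 >= 0; [nra | rewrite leNgt Q].
Qed.

Lemma bad_second B i j v : i != j -> bad B i j v ->
  bad (mutmx j B) j i (tmap (fun l => B l j) j v).
Proof.
move=> ij [b0 c0 x0 y0 Q].
have Ti : tmap (fun l => B l j) j v i = v i - (B i j)%:~R * v j.
  rewrite /tmap (negbTE ij) leNgt y0 /= /pospart oppr_gt0 b0 -mulNr -rmorphN.
  by rewrite -[in RHS](gtz0_abs (_ : 0 < - B i j)) -?pmulrn // oppr_gt0.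
have Tj : tmap (fun l => B l j) j v j = - v j by rewrite /tmap eqxx.
rewrite /bad Ti Tj !mxE eqxx orbT /= oppr_lt0 oppr_gt0 oppr_gt0.
have bR : (B i j)%:~R < 0 :> R by rewrite ltrz0.
have cR : 0 < (B j i)%:~R :> R by rewrite ltr0z.
move: Q bR cR; rewrite !rmorphN !rmorphM /= !rmorphN /=.
move: (B i j)%:~R (B j i)%:~R (v i) (v j) x0 y0 => b c x y x0 y0 Q bR cR.
split=> //; last by have := Q; nra.
rewrite ltNge; apply/negP => h; have bc : 0 <= c * x * (x - b * y).
  by apply: mulr_ge0; [apply: mulr_ge0; exact: ltW | exact: h].
have cy : 0 <= - b * y ^+ 2 by apply: mulr_ge0; [rewrite oppr_ge0; exact: ltW | exact: sqr_ge0].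
by have : c * x ^+ 2 - b * c * (x * y) - b * y ^+ 2 >= 0; [nra | rewrite leNgt Q].
Qed.

Lemma bad_mutseq B i j us v ks : skew B -> i != j -> all (pred2 i j) us ->
  gcone B ks v -> bad B i j v \/ bad B j i v -> exists v',
    gcone (mutseq B us) (rev us ++ ks) v' /\
    (bad (mutseq B us) i j v' \/ bad (mutseq B us) j i v').
Proof.
move=> skB ij; have ji : j != i by rewrite eq_sym.
elim/last_ind: us => [|us k IH]; first by exists v.
rewrite all_rcons => /andP[kij aus] cv bv; have [v' [cv' bv']] := IH aus cv bv.
exists (tmap (fun l => mutseq B us l k) k v'); rewrite mutseq_rcons rev_rcons; split.
  by apply: gcone_mut => //; apply: mutseq_skew.
case/orP: kij => /eqP ->; case: bv' => h.
- by right; apply: bad_first.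
- by left; apply: bad_second.
- by right; apply: bad_second.
- by left; apply: bad_first.
Qed.

Lemma bad_not_gcone B i j v ks : skew B -> i != j -> gcone B ks v ->
  bad B i j v \/ bad B j i v -> False.
Proof.
move=> skB ij cv bv; have [us [aus hi hj]] := nonneg_rows ks skB ij.
have [v' [[lam lam0 vE] bv']] := bad_mutseq skB ij aus cv bv.
have pos r : nonneg_row (mutseq B us) (rev us ++ ks) r -> 0 <= v' r.
  by move=> hr; rewrite vE; apply: sumr_ge0 => l _; rewrite mulr_ge0 // ler0z.
by case: bv' => [] [_ _ _ neg _]; move: neg; rewrite ltNge pos.
Qed.

Lemma bad_open B i j : i != j -> B i j < 0 -> 0 < B j i -> B i j * B j i <= -5 ->
  exists v, forall w, (forall l, `|v l - w l| < 10%:R^-1) -> bad B i j w.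
Proof.
(* For v_j = -2 the form is least at v_i = - b_ij, with value - b_ij (b_ij b_ji + 4) < 0. *)
move=> ij b0 c0 bc5; exists (fun l => if l == i then - (B i j)%:~R else if l == j then -2 else 0).
move=> w hw; have := hw i; have := hw j; rewrite !eqxx eq_sym (negbTE ij) {hw}.
rewrite {1}/bad b0 c0.
have bR : (B i j)%:~R <= -1 :> R by rewrite -(rmorphN1 (intmul 1)) ler_int; lia.
have cR : 1 <= (B j i)%:~R :> R by rewrite ler1z; lia.
have bcR : (B i j * B j i)%:~R <= -5 :> R.
  by rewrite -[-5]/((-5)%:~R) ler_int.
rewrite rmorphM /= in bcR; rewrite rmorphM /=; move: bR cR bcR.
move: (B i j)%:~R (B j i)%:~R (w i) (w j) => b c x y bR cR bcR.
rewrite !ltr_norml => /andP[y1 y2] /andP[x1 x2].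
have yN : y < 0 by lra.
have xP : 0 < x by lra.
split => //.
pose a := - b; pose s := x - a; pose t := - y - 2.
have xE : x = a + s by rewrite /s; ring.
have yE : y = - (2 + t) by rewrite /t; ring.
have bE : b = - a by rewrite /a opprK.
have a1 : 1 <= a by rewrite /a; lra.
have s1 : - 10%:R^-1 <= s <= 10%:R^-1 by rewrite /s /a; apply/andP; split; lra.
have t1 : - 10%:R^-1 <= t <= 10%:R^-1 by rewrite /t; apply/andP; split; lra.
have P5 : 5 <= a * c by rewrite /a mulNr; lra.
move: xE yE bE a1 s1 t1 P5; clearbody a s t => -> -> -> a1 /andP[sl su] /andP[tl tu] P5.
(* For |s|, |t| <= 1/10 the error is at most 3 a c / 100, less than 9 (a c - 4) / 10 once a c >=
   5. *)
have -> : c * (a + s) ^+ 2 - - a * c * ((a + s) * - (2 + t)) - - a * (- (2 + t)) ^+ 2 =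
  - (a * (a * c - 4) * (1 + t)) + (c * s ^+ 2 - a * c * (s * t) + a * t ^+ 2) by ring.
have s2 : s ^+ 2 <= 100%:R^-1 by nra.
have t2 : t ^+ 2 <= 100%:R^-1 by nra.
have st : - (s * t) <= 100%:R^-1 by have := sqr_ge0 (s + t); rewrite sqrrD; nra.
have cP : c <= a * c by nra.
have aP : a <= a * c by nra.
have h1 : c * s ^+ 2 <= a * c * 100%:R^-1.
  by apply: le_trans (ler_wpM2r _ cP); [apply: ler_wpM2l => //; lra | lra].
have h2 : a * c * - (s * t) <= a * c * 100%:R^-1 by apply: ler_wpM2l => //; lra.
have h3 : a * t ^+ 2 <= a * c * 100%:R^-1.
  by apply: le_trans (ler_wpM2r _ aP); [apply: ler_wpM2l => //; lra | lra].
have h4 : a * c - 4 <= a * (a * c - 4) by rewrite ler_peMl //; lra.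
have h5 : (a * c - 4) * (9%:R / 10%:R) <= a * (a * c - 4) * (1 + t).
  by apply: ler_pM => //; lra.
lra.
Qed.

Lemma exists_large_entry B : skew B -> mutation_infinite B -> exists ks i j,
  [/\ i != j, mutseq B ks i j < 0, 0 < mutseq B ks j i &
      mutseq B ks i j * mutseq B ks j i <= -5].
Proof.
move=> skB; apply: contra_notP => H.
(* An entry of absolute value at least 5 faces a nonzero entry of opposite sign, giving a product at
   most -5. Otherwise all entries lie in [-4, 4] and are coded by ['I_9], so finitely many matrices
   occur. *)
pose f (N : 'M['I_9]_n) : 'M[int]_n := \matrix_(i, j) ((N i j : nat)%:Z - 4).
exists (codom f) => ks; set T := mutseq B ks.
have skT : skew T by apply: mutseq_skew.
have small i j : (`|T i j| <= 4)%N.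
  rewrite leqNgt; apply/negP => big; apply: H.
  have Tsk := skT i j; have di := d_gt0 i; have dj := d_gt0 j.
  have ij : i != j.
    by apply: contraTneq big => ->; rewrite (Bkk d_gt0 skT).
  have [neg|pos] := leP (T i j) 0.
    have Tji : 0 < T j i by nia.
    by exists ks, i, j; split => //; rewrite -/T; [lia | nia].
  have Tji : T j i < 0 by nia.
  by exists ks, j, i; split; rewrite // 1?eq_sym // -/T; nia.
have lt9 i j : (absz (T i j + 4)%R < 9)%N by have := small i j; lia.
apply/codomP; exists (\matrix_(i, j) Ordinal (lt9 i j)).
by apply/matrixP => i j; rewrite !mxE /=; have := small i j; lia.
Qed.
End Cones.

Theorem theorem2p11 (R : realType) (n : nat) (B : 'M[int]_n) :
  skew_symmetrizable B -> mutation_infinite B -> ~ gfan_dense R B.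
Proof.
move=> [d [d_gt0 skB]] Binf Bdense.
have [ks [i [j [ij b0 c0 bc5]]]] := exists_large_entry d_gt0 skB Binf.
have cB : gcones_dense R B.
  move=> v e e0; have [w [sw hw]] := Bdense v e e0; exists w; split => //.
  exact: (gfan_gcone d_gt0 skB sw).
have cT := gcones_dense_mutseq d_gt0 ks skB cB.
have skT := mutseq_skew d_gt0 ks skB.
have [v hv] := bad_open R ij b0 c0 bc5.
have [w [[us cw] hw]] := cT v 10%:R^-1 ltac:(by rewrite invr_gt0 ltr0n).
by apply: (bad_not_gcone d_gt0 skT ij cw); left; apply: hv.
Qed.
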